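(* Consider the three-dimensional incompressible Navier-Stokes equations. Suppose $K$ is a compact subset of $H$ and that the set $\mathcal{P}_{\mathrm{wsss}}(K)$ of weak stationary statistical solutions of the Navier-Stokes equations carried by $K$ is nonempty. Let $\phi\in\mathcal{C}(K)$. Then $$\max_{\mu\in\mathcal{P}_{\mathrm{wsss}}(K)}\int_K\phi(u)\,d\mu(u)=\inf_{\Psi\in\mathcal{T}^{\mathrm{cyl}}(W')}\ \max_{u\in K}\left\{\phi(u)+\langle F(u),\Psi'(u)\rangle_{W',W}\right\}.$$
   Context: Let $\Omega\subset\mathbb{R}^3$ be a bounded domain with smooth boundary and $\nu>0$. The Navier-Stokes equations are $\partial_t u-\nu\Delta u+(u\cdot\nabla)u+\nabla p=f$, $\nabla\cdot u=0$ in $\Omega$, with $u=0$ on $\partial\Omega$ and time-independent $f$. $H$ is the space of square-integrable divergence-free vector fields on $\Omega$ with vanishing normal component on $\partial\Omega$, with the $L^2(\Omega)^3$ inner product; $V=H\cap H^1_0(\Omega)^3$, with the $H_0^1$ inner product $\langle\nabla u,\nabla v\rangle_{L^2}$; $H$ is identified with its dual, so $V\subset H\subset V'$; $f\in V'$. The Stokes operator $A:V\to V'$ is given by $\langle Au,v\rangle_{V',V}=\langle\nabla u,\nabla v\rangle_{L^2}$, and $D(A)=\{u\in V:\ Au\in H\}$. $B(\cdot,\cdot):V\times V\to V'$ is given by $\langle B(u,v),w\rangle_{V',V}=\int_\Omega((u\cdot\nabla)v)\cdot w\,dx$, and $F(u)=f-\nu Au-B(u,u)$. $W=D(A)\cap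 W^{1,\infty}(\Omega)^3$, with its natural Banach norm, and $H\subset W'$ through the $L^2$ inner product. $F$ extends to a continuous map $F:H\to W'$, given by $\langle F(u),w\rangle_{W',W}=\langle f,w\rangle_{V',V}-\nu\langle u,Aw\rangle_{L^2}+\int_\Omega((u\cdot\nabla)w)\cdot u\,dx$. $\mathcal{T}^{\mathrm{cyl}}(W')$ is the set of functions $\Psi:W'\to\mathbb{R}$ of the form $\Psi(u)=\psi(\langle u,w_1\rangle_{W',W},\ldots,\langle u,w_m\rangle_{W',W})$, with $m\in\mathbb{N}$, $w_j\in W$, $\psi\in\mathcal{C}^1_c(\mathbb{R}^m)$; its derivative is $\Psi'(u)=\sum_{j=1}^m\partial_j\psi(\langle u,w_1\rangle_{W',W},\ldots,\langle u,w_m\rangle_{W',W})\,w_j\in W$. Weak stationary statistical solution of the Navier-Stokes equations: a Borel probability measure $\mu$ on $H$ such that, for every $\Psi\in\mathcal{T}^{\mathrm{cyl}}(W')$, the map $u\mapsto\langle F(u),\Psi'(u)\rangle_{W',W}$ is $\mu$-integrable and $\int_H\langle F(v),\Psi'(v)\rangle_{W',W}\,d\mu(v)=0$. For a Borel set $E\subset H$, $\mathcal{P}_{\mathrm{wsss}}(E)$ is the set of all such $\mu$ carried by $E$, i.e. with $\mu(H\setminus E)=0$. $\mathcal{C}(K)$ is the space of continuous real-valued functions on $K$ (with the norm topology of $H$). *)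

(* Defs.v *)
From HB Require Import structures.
From mathcomp Require Import all_boot all_order all_algebra.
From mathcomp Require Import all_classical all_reals all_analysis.
From mathcomp Require Import measurable_realfun ring lra.

Set Implicit Arguments.
Unset Strict Implicit.
Unset Printing Implicit Defensive.

Import Order.TTheory GRing.Theory Num.Theory.
Import numFieldNormedType.Exports.

Local Open Scope classical_set_scope.
Local Open Scope ring_scope.
Local Open Scope quotient_scope.

Section L2space.
Context (d : measure_display) (T : measurableType d) (R : realType).
Variables (mu : {measure set T -> \bar R}) (I : finType).

Definition L2rep := I -> LfunType mu (lee1n 2 : (1 <= 2%:R%:E)%E).

HB.instance Definition _ := GRing.Lmodule.on L2rep.

Definition L2null : {pred L2rep} :=
  fun u => `[< forall i, {ae mu, forall x, u i x = 0} >].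

Lemma L2null_zmod_closed : zmod_closed L2null.
Proof.
split; first by apply/asboolP => i; apply: aeW => x.
move=> u v /asboolP u0 /asboolP v0; apply/asboolP => i.
have := v0 i; have := u0 i; apply: filterS2 => x ux vx.
by rewrite /= [LHS](_ : _ = u i x - v i x)// ux vx subr0.
Qed.

HB.instance Definition _ :=
  GRing.isZmodClosed.Build L2rep L2null L2null_zmod_closed.

(* I-indexed families of square-integrable functions, modulo equality almost
   everywhere. *)
Definition L2 : Type := Quotient.quot L2null.

HB.instance Definition _ := GRing.Zmodule.on L2.
HB.instance Definition _ := EqQuotient.on L2.

Definition L2fun (u : L2) : I -> T -> R := fun i => (repr u : L2rep) i.

Definition ip (u v : L2) : R :=
  \sum_(i : I) (\int[mu]_x (L2fun u i x * L2fun v i x)).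

Lemma L2eqP (u v : L2rep) :
  reflect (forall i, {ae mu, forall x, u i x = v i x}) (\pi_L2 u == \pi_L2 v).
Proof.
rewrite -Quotient.idealrBE; apply: (iffP (asboolP _)) => h i.
- have := h i; apply: filterS => x.
  by rewrite [X in X = _](_ : _ = u i x - v i x)// => /subr0_eq.
- have := h i; apply: filterS => x uv.
  by rewrite [LHS](_ : _ = u i x - v i x)// uv subrr.
Qed.

Lemma L2fun_pi (u : L2rep) i : {ae mu, forall x, L2fun (\pi u) i x = u i x}.
Proof. by apply: (L2eqP (repr (\pi_L2 u)) u _ i); rewrite reprK. Qed.


Definition L2of (u : L2rep) : L2 := \pi_L2 u.

Lemma L2fun_of (u : L2rep) i : {ae mu, forall x, L2fun (L2of u) i x = u i x}.
Proof. by apply: (L2eqP (repr (L2of u)) u _ i); rewrite /L2of reprK. Qed.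

Lemma L2ofK (u : L2) : L2of (repr u) = u.
Proof. exact: reprK. Qed.

Lemma L2of_D (u v : L2rep) : L2of (u + v) = L2of u + L2of v.
Proof. by rewrite /L2of [RHS]piE. Qed.

Lemma L2of_eq (u v : L2rep) :
  (forall i, {ae mu, forall x, u i x = v i x}) -> L2of u = L2of v.
Proof. by move=> /L2eqP/eqP. Qed.

Definition L2scale (a : R) (u : L2) : L2 := L2of (a *: (repr u : L2rep)).

Lemma L2scale_of a (u : L2rep) : L2scale a (L2of u) = L2of (a *: u).
Proof.
apply: L2of_eq => i; have := L2fun_of u i; apply: filterS => x ux.
transitivity (a * L2fun (L2of u) i x) => //.
by rewrite ux.
Qed.

Fact L2scaleA a b u : L2scale a (L2scale b u) = L2scale (a * b) u.
Proof. by rewrite -[u]L2ofK !L2scale_of scalerA. Qed.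
Fact L2scale1 : left_id 1 L2scale.
Proof. by move=> u; rewrite -[u]L2ofK L2scale_of scale1r. Qed.
Fact L2scaleDr : right_distributive L2scale +%R.
Proof.
move=> a u v; rewrite -[u]L2ofK -[v]L2ofK !L2scale_of -!L2of_D.
by rewrite L2scale_of scalerDr.
Qed.
Fact L2scaleDl u : {morph L2scale^~ u : a b / a + b}.
Proof. by move=> a b; rewrite -[u]L2ofK !L2scale_of scalerDl L2of_D. Qed.

HB.instance Definition _ := GRing.Zmodule_isLmodule.Build R L2
  L2scaleA L2scale1 L2scaleDr L2scaleDl.

Lemma L2funD (u v : L2) i :
  {ae mu, forall x, L2fun (u + v) i x = L2fun u i x + L2fun v i x}.
Proof.
have -> : u + v = L2of (repr u + repr v : L2rep) by rewrite L2of_D !L2ofK.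
exact: L2fun_of.
Qed.

Lemma L2funZ a (u : L2) i :
  {ae mu, forall x, L2fun (a *: u) i x = a * L2fun u i x}.
Proof. exact: L2fun_of. Qed.

Lemma L2fun_eq0 (u : L2) :
  (forall i, {ae mu, forall x, L2fun u i x = 0}) -> u = 0.
Proof.
move=> h; rewrite -[u]L2ofK.
have -> : (0 : L2) = L2of 0 by rewrite /L2of [LHS]piE.
exact: L2of_eq.
Qed.

Lemma L2fun_Lfun (u : L2) i : L2fun u i \in Lfun mu 2%:E.
Proof. exact: LfunP. Qed.

Lemma L2fun_measurable (u : L2) i : measurable_fun setT (L2fun u i).
Proof. by have /andP[/set_mem] := L2fun_Lfun u i. Qed.

Lemma L2fun_mul_integrable (u v : L2) i :
  mu.-integrable setT (EFin \o (fun x => L2fun u i x * L2fun v i x)).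
Proof. by apply/Lfun1_integrable/Lfun2_mul_Lfun1; exact: L2fun_Lfun. Qed.

Lemma ipC u v : ip u v = ip v u.
Proof.
apply: eq_bigr => i _; apply: eq_Rintegral => x _; exact: mulrC.
Qed.

Lemma ipDl u v w : ip (u + v) w = ip u w + ip v w.
Proof.
rewrite /ip -big_split; apply: eq_bigr => i _ /=.
rewrite -RintegralD//; try exact: L2fun_mul_integrable.
congr fine; apply: ae_eq_integral => //.
- exact/measurable_EFinP/measurable_funM/L2fun_measurable/L2fun_measurable.
- apply/measurable_EFinP/measurable_funD;
    exact/measurable_funM/L2fun_measurable/L2fun_measurable.
- by have := L2funD u v i; apply: filterS => x /= -> _; rewrite mulrDl.
Qed.

Lemma ipZl a u w : ip (a *: u) w = a * ip u w.
Proof.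
rewrite /ip mulr_sumr; apply: eq_bigr => i _ /=.
rewrite -RintegralZl//; last exact: L2fun_mul_integrable.
congr fine; apply: ae_eq_integral => //.
- exact/measurable_EFinP/measurable_funM/L2fun_measurable/L2fun_measurable.
- apply/measurable_EFinP/measurable_funM => //;
    exact/measurable_funM/L2fun_measurable/L2fun_measurable.
- by have := L2funZ a u i; apply: filterS => x /= -> _; rewrite mulrA.
Qed.

Lemma ipDr u v w : ip w (u + v) = ip w u + ip w v.
Proof. by rewrite ipC ipDl !(ipC w). Qed.

Lemma ipZr a u w : ip w (a *: u) = a * ip w u.
Proof. by rewrite ipC ipZl (ipC w). Qed.

Lemma ip_ge0 u : 0 <= ip u u.
Proof.
apply: sumr_ge0 => i _; apply: Rintegral_ge0 => x _; exact: sqr_ge0.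
Qed.

Lemma ip_eq0 u : ip u u = 0 -> u = 0.
Proof.
move=> /eqP; rewrite psumr_eq0 => [/allP h|i _]; last first.
  by apply: Rintegral_ge0 => x _; exact: sqr_ge0.
apply: L2fun_eq0 => i; have /eqP := h i (mem_index_enum i).
move=> ui; have /integrableP[mui fui] := L2fun_mul_integrable u u i.
have : (\int[mu]_x `|(L2fun u i x * L2fun u i x)%:E| = 0)%E.
  rewrite -[LHS]fineK; last first.
    by rewrite ge0_fin_numE//; exact: integral_ge0.
  rewrite -[RHS]/(0%R%:E) -ui; congr (fine _)%:E; apply: eq_integral => x _.
  by rewrite gee0_abs// lee_fin sqr_ge0.
move=> /(ae_eq_integral_abs mu measurableT mui).
apply: filterS => x /= /(_ Logic.I) [] /eqP.
by rewrite mulf_eq0 orbb => /eqP.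
Qed.

Lemma ip_CS u v : ip u v ^+ 2 <= ip u u * ip v v.
Proof.
have [/ip_eq0 ->|v0] := eqVneq (ip v v) 0.
  have -> : ip u 0 = 0 by rewrite -[0](scale0r 0) ipZr mul0r.
  by rewrite expr0n mulr_ge0 ?ip_ge0.
have vp : 0 < ip v v by rewrite lt_neqAle eq_sym v0 ip_ge0.
have := ip_ge0 (u + (- (ip u v / ip v v)) *: v).
rewrite !(ipDl, ipDr, ipZl, ipZr) (ipC v u).
rewrite -(@pmulr_rge0 _ (ip v v))// => h; rewrite -subr_ge0.
by apply: (le_trans h); rewrite le_eqVlt; apply/orP; left; apply/eqP; field.
Qed.

Definition L2norm (u : L2) : R := Num.sqrt (ip u u).

Lemma ip_le_norm u v : `|ip u v| <= L2norm u * L2norm v.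
Proof. by rewrite -sqrtrM ?ip_ge0// -sqrtr_sqr ler_wsqrtr// ip_CS. Qed.

Fact L2normD u v : L2norm (u + v) <= L2norm u + L2norm v.
Proof.
have n0 w : 0 <= L2norm w by exact: sqrtr_ge0.
have n2 w : L2norm w ^+ 2 = ip w w by rewrite sqr_sqrtr ?ip_ge0.
rewrite -(@ler_pXn2r _ 2)// ?nnegrE ?addr_ge0// sqrrD !n2.
rewrite !(ipDl, ipDr) (ipC v u).
have := le_trans (ler_norm _) (ip_le_norm u v); lra.
Qed.

Fact L2normZ a u : L2norm (a *: u) = `|a| * L2norm u.
Proof.
by rewrite /L2norm ipZl ipZr mulrA -expr2 sqrtrM ?sqr_ge0// sqrtr_sqr.
Qed.

Fact L2norm0_eq0 u : L2norm u = 0 -> u = 0.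
Proof.
by move=> /eqP; rewrite sqrtr_eq0 => h; apply/ip_eq0/le_anti; rewrite h ip_ge0.
Qed.

HB.instance Definition _ := @Lmodule_isNormed.Build R L2
  L2norm L2normD L2normZ L2norm0_eq0.

End L2space.

Coercion L2fun : L2 >-> Funclass.

Section Space3.
Context (R : realType).

Definition space3 : Type :=
  (measurableTypeR R * measurableTypeR R * measurableTypeR R)%type.

HB.instance Definition _ := NormedModule.on space3.
HB.instance Definition _ := Measurable.on space3.

Definition lebesgue3 : {measure set space3 -> \bar R} :=
  ((lebesgue_measure \x lebesgue_measure) \x lebesgue_measure)%E.

Lemma open_measurable3 (U : set space3) : open U -> measurable U.
Proof.
move=> oU.
pose B (p : rat * rat * rat * nat) : set space3 :=
  (ball (ratr p.1.1.1 : R) p.2.+1%:R^-1 `*`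
   ball (ratr p.1.1.2 : R) p.2.+1%:R^-1) `*`
   ball (ratr p.1.2 : R) p.2.+1%:R^-1.
have mB p : measurable (B p).
  by do 2! (apply: measurableX; last exact: measurable_ball);
     exact: measurable_ball.
have -> : U = \bigcup_p (if `[< B p `<=` U >] then B p else set0).
  apply/seteqP; split=> [x Ux|x [p _]]; last first.
    by case: ifPn => // /asboolP; apply.
  have /nbhs_ballP[e /= e0 xeU] : nbhs x U by exact: open_nbhs_nbhs.
  have [n ne] : exists n, n.+1%:R^-1 < e / 2.
    have [n _ /(_ n (leqnn n))] := near_infty_natSinv_lt (PosNum (divr_gt0 e0 (ltr0n R 2))).
    by exists n.
  have dr (a : R) : exists q : rat, ball a n.+1%:R^-1 (ratr q : R).
    have r0 : 0 < n.+1%:R^-1 :> R by rewrite invr_gt0.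
    have [|b [ab [q _ qb]]] := @dense_rat R (ball a n.+1%:R^-1) _ (ball_open a _).
      by exists a; exact: ballxx.
    by exists q; rewrite qb.
  have [q1 h1] := dr x.1.1; have [q2 h2] := dr x.1.2; have [q3 h3] := dr x.2.
  exists (q1, q2, q3, n) => //; rewrite ifT.
    by split=> /=; [split|] => /=; exact: ball_sym.
  apply/asboolP => y [[/= y1 y2] y3]; apply: xeU.
  have tr (a b c : R) : ball a n.+1%:R^-1 b -> ball b n.+1%:R^-1 c -> ball a e c.
    move=> ab bc; have := ball_triangle ab bc; apply: le_ball.
    by rewrite (splitr e); apply/ltW/ltrD.
  by split; [split|]; [exact: tr h1 y1|exact: tr h2 y2|exact: tr h3 y3].
by apply: countable_bigcupT_measurable => [|p];
  [exact: countableP|case: ifP => // _; exact: mB].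
Qed.

Lemma continuous_measurable3 (g : space3 -> R) :
  continuous g -> measurable_fun setT g.
Proof.
move=> /continuousP cg.
apply: (measurability _ (RGenOInfty.measurableE R)) => _ [_ [a ->] <-].
rewrite setTI preimage_itvoy; apply: open_measurable3.
exact: (cg _ (@open_gt R a)).
Qed.
End Space3.

Section Domain.
Context (R : realType).
Local Notation E := (space3 R).

Definition basis3 (j : 'I_3) : E :=
  ((j == 0 :> nat)%:R, (j == 1 :> nat)%:R, (j == 2 :> nat)%:R).

Definition partial (j : 'I_3) (g : E -> R) : E -> R := fun x => 'D_(basis3 j) g x.

(* All iterated partial derivatives being differentiable is C^infinity. *)
Definition smooth (g : E -> R) :=
  forall (s : seq 'I_3) (x : E), differentiable (foldr partial g s) x.

(* Near each boundary point the set is a sublevel set {g < 0} of a C^infinity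
   function whose gradient does not vanish at that point. *)
Definition smooth_boundary (D : set E) :=
  forall x, (closure D `\` D) x -> exists (U : set E) (g : E -> R),
    [/\ open U, U x, smooth g, exists j, partial j g x != 0 &
        forall y, U y -> D y <-> g y < 0].

Record smooth_domain := SmoothDomain {
  dom :> set E;
  dom_open : open dom;
  dom_neq0 : dom !=set0;
  dom_connected : connected dom;
  dom_bounded : bounded_set dom;
  dom_boundary : smooth_boundary dom }.

Definition supp (T : topologicalType) (g : T -> R) : set T :=
  closure [set x | g x != 0].

Variable Om : smooth_domain.

Definition vol : {measure set E -> \bar R} :=
  mrestr (@lebesgue3 R) (open_measurable3 (@dom_open Om)).

Definition test_fun (g : E -> R) :=
  [/\ smooth g, compact (supp g) & supp g `<=` dom Om].

(* G (i, j) is the weak derivative of the component u i in the direction j. *)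
Definition weak_grad (I : finType) (u : L2 vol I) (G : L2 vol (I * 'I_3)%type) :=
  forall g, test_fun g -> forall i j,
    \int[vol]_x (u i x * partial j g x) = - \int[vol]_x (G (i, j) x * g x).

Local Notation vfield := (L2 vol 'I_3).
Local Notation tfield := (L2 vol ('I_3 * 'I_3)%type).

Definition divergence_free (u : vfield) :=
  forall g, test_fun g -> \sum_j \int[vol]_x (u j x * partial j g x) = 0.

(* For a divergence-free u, Green's formula defines the normal trace u.n as the
   functional sending the trace of q in H^1 to the integral of u . grad q. *)
Definition normal_trace0 (u : vfield) :=
  forall (q : L2 vol unit) (dq : L2 vol (unit * 'I_3)%type), weak_grad q dq ->
    \sum_j \int[vol]_x (u j x * dq (tt, j) x) = 0.

Definition Hset : set vfield := [set u | divergence_free u /\ normal_trace0 u].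

Definition H1 : set vfield := [set u | exists G, weak_grad u G].

Definition grad (u : vfield) : tfield := xget 0 [set G | weak_grad u G].

Definition test_graph : set (vfield * tfield)%type :=
  [set p : vfield * tfield | exists g : 'I_3 -> E -> R,
    [/\ forall i, test_fun (g i),
        forall i, {ae vol, forall x, p.1 i x = g i x} &
        forall i j, {ae vol, forall x, p.2 (i, j) x = partial j (g i) x}]].

Definition H10 : set vfield := [set u | H1 u /\ closure test_graph (u, grad u)].

Definition V : set vfield := Hset `&` H10.

(* h represents the functional <Aw, .> on V. As V is dense in H, membership of h
   in the closure of V excludes nothing; it makes h unique without appealing to
   that density. *)
Definition stokes_repr (w h : vfield) :=
  [/\ Hset h, closure V h & forall v, V v -> ip h v = ip (grad w) (grad v)].

Definition DA : set vfield := [set w | V w /\ exists h, stokes_repr w h].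

Definition stokes (w : vfield) : vfield := xget 0 [set h | stokes_repr w h].

Definition W : set vfield := [set w |
  [/\ DA w, forall i, finite_norm vol +oo%E (w i) &
      forall ij, finite_norm vol +oo%E (grad w ij)]].

Definition Wnorm (w : vfield) : R :=
  `|w| + `|stokes w| + \sum_i fine ('N[vol]_+oo[EFin \o w i])
  + \sum_ij fine ('N[vol]_+oo[EFin \o grad w ij]).

(* Bounded linear functionals on the subspace X normed by N; the values of the
   underlying function outside X are irrelevant. *)
Record dual (X : set vfield) (N : vfield -> R) := Dual {
  dual_fun :> vfield -> R;
  dual_linear : forall a u v, X u -> X v ->
    dual_fun (a *: u + v) = a * dual_fun u + dual_fun v;
  dual_bounded : exists C, forall u, X u -> `|dual_fun u| <= C * N u }.

Definition Vdual := dual V (fun v => `|grad v|).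
Definition Wdual := dual W Wnorm.

Definition Hspace : Type := set_type Hset.

HB.instance Definition _ := PseudoMetric.on Hspace.

Lemma Hset0 : Hset 0.
Proof.
have h (F : 'I_3 -> E -> R) : (forall j, measurable_fun setT (F j)) ->
    \sum_j \int[vol]_x ((0 : vfield) j x * F j x) = 0.
  move=> mF; apply: big1 => j _.
  have z : {ae vol, forall x, (0 : vfield) j x = 0}.
    by have := L2funZ 0 (0 : vfield) j; rewrite scale0r;
      apply: filterS => x ->; rewrite mul0r.
  transitivity (\int[vol]_(x in [set: E]) (0 : R)).
    congr fine; apply: ae_eq_integral => //; last first.
      by apply: filterS z => x /= -> _; rewrite mul0r.
    apply/measurable_EFinP/measurable_funM; last exact: mF.
    exact: L2fun_measurable.
  by rewrite /Rintegral integral0.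
split=> [g [sg _ _]|q dq _]; apply: h => j; last exact: L2fun_measurable.
apply: continuous_measurable3 => x.
exact: differentiable_continuous (sg [:: j] x).
Qed.

HB.instance Definition _ := isPointed.Build Hspace (exist _ 0 (mem_set Hset0)).

Definition Hval (u : Hspace) : vfield := \val u.
Coercion Hval : Hspace >-> L2.

Lemma Hspace_dual_linear (u : Hspace) a v w : W v -> W w ->
  ip u (a *: v + w) = a * ip u v + ip u w.
Proof. by move=> _ _; rewrite ipDr ipZr. Qed.

Lemma Hspace_dual_bounded (u : Hspace) :
  exists C, forall w, W w -> `|ip u w| <= C * Wnorm w.
Proof.
exists `|Hval u| => w _; apply: le_trans (ip_le_norm _ _) _.
apply: ler_wpM2l; first exact: sqrtr_ge0.
by rewrite /Wnorm -!addrA lerDl !addr_ge0// sumr_ge0// => i _;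
  rewrite fine_ge0// Lnorm_ge0.
Qed.

Definition Wdual_of_H (u : Hspace) : Wdual :=
  Dual (@Hspace_dual_linear u) (Hspace_dual_bounded u).

(* The value <F(u), w> of the functional F(u), for w in W; grad w (j, i) is the
   derivative of w_j in the direction i. *)
Definition NSF (nu : R) (f : Vdual) (u : Hspace) (w : vfield) : R :=
  f w - nu * ip u (stokes w)
  + \int[vol]_x (\sum_(i < 3) \sum_(j < 3) u i x * grad w (j, i) x * u j x).

Definition C1c (m : nat) (psi : 'rV[R]_m -> R) :=
  [/\ forall x, differentiable psi x,
      forall j : 'I_m, continuous (fun x => 'D_(delta_mx 0 j) psi x) &
      compact (supp psi)].

(* An element of T^cyl is carried with one of its presentations by psi and the
   w_j; distinct presentations of a function have the same derivative, because
   the derivative at g is the vector of W representing the Gateaux differential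
   of the function at g. *)
Record cylindrical := Cylindrical {
  cyl_dim : nat;
  cyl_vec : 'I_cyl_dim -> vfield;
  cyl_psi : 'rV[R]_cyl_dim -> R;
  cyl_vecW : forall j, W (cyl_vec j);
  cyl_psiC1c : C1c cyl_psi }.

Definition cyl_coord (Psi : cylindrical) (g : Wdual) : 'rV[R]_(cyl_dim Psi) :=
  \row_j g (cyl_vec j).

Definition cyl_eval (Psi : cylindrical) (g : Wdual) : R :=
  cyl_psi (cyl_coord Psi g).

Coercion cyl_eval : cylindrical >-> Funclass.

Definition cyl_deriv (Psi : cylindrical) (g : Wdual) : vfield :=
  \sum_(j < cyl_dim Psi)
    'D_(delta_mx 0 j) (@cyl_psi Psi) (cyl_coord Psi g) *: cyl_vec j.

Definition borelH := g_sigma_algebraType (@open Hspace).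

(* u |-> <F(u), Psi'(u)>, with u in H regarded as an element of W'. *)
Definition NSF_deriv (nu : R) (f : Vdual) (Psi : cylindrical) (u : Hspace) : R :=
  NSF nu f u (cyl_deriv Psi (Wdual_of_H u)).

Definition wsss (nu : R) (f : Vdual) : set (probability borelH R) :=
  [set mu : probability borelH R | forall Psi : cylindrical,
    mu.-integrable setT (fun v : borelH => (NSF_deriv nu f Psi v)%:E) /\
    \int[mu]_(v in [set: borelH]) NSF_deriv nu f Psi v = 0].

Definition wsss_on (nu : R) (f : Vdual) (D : set Hspace) :
    set (probability borelH R) :=
  [set mu : probability borelH R | wsss nu f mu /\ mu (~` D) = 0%E].

End Domain.

Definition is_max (R : realType) (A : set R) (m : R) := A m /\ ubound A m.

(* Main.v *)
Require Import Defs.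
From HB Require Import structures.
From mathcomp Require Import all_boot all_order all_algebra.
From mathcomp Require Import all_classical all_reals all_analysis.
From mathcomp Require Import measurable_realfun ess_sup_inf ring lra.

Set Implicit Arguments.
Unset Strict Implicit.
Unset Printing Implicit Defensive.

Import Order.TTheory GRing.Theory Num.Theory.
Import numFieldNormedType.Exports.

Local Open Scope classical_set_scope.
Local Open Scope ring_scope.

(** Integrating phi + <F, Psi'> against a stationary statistical solution carried
by K gives the integral of phi, which is therefore at most the maximum on the
right-hand side. Conversely, the functions <F, Psi'> form, on K, a linear
space: the sum of two compactly supported cylindrical functions agrees, to
first order on the bounded set K, with a compactly supported one. Hence
p(g) = inf_Psi sup_K (g + <F, Psi'>) is a sublinear functional, finite because
a stationary solution exists; by Hahn-Banach a linear functional below p takes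
the value p(phi) at phi. It is positive, has mass one and vanishes on the
<F, Psi'>, so the probability measure on K representing it is a stationary
statistical solution for which the integral of phi is the infimum.

The linearity and continuity of <F(u), w> in w and u rest on the uniqueness of
weak gradients, that is on the fundamental lemma of the calculus of
variations. *)

(** * The Hahn-Banach theorem *)

Section HahnBanach.
Context (R : realType) (V : lmodType R).
Implicit Types (p q : V -> R) (x y z : V).

(** Hahn-Banach is applied to all functions bounded on [K], not only to continuous ones, so it
    produces a mean that is merely finitely additive; compactness of [K] turns its values on
    continuous functions into integrals against a Borel measure. Domination by p yields the
    properties of the mean: the zero perturbation gives positivity and mass one, and the
    perturbation -a l, for each real a, forces the value 0 on l. No extension from a subspace is
    used, since a dominated linear functional can be made to touch p at one prescribed point;
    touching it at phi is what makes the maximum attained.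

    The space W makes <F(u), Psi'(u)> continuous in u: gradients of its elements are essentially
    bounded, so the convection term is a bounded quadratic form on H. Continuity matters because the
    measure reproduces the mean on continuous functions only. Elements of [L2] are classes, so
    linear identities are obtained through integrals and almost everywhere equality, never
    pointwise. *)

Definition sublinear p :=
  (forall x y, p (x + y) <= p x + p y) /\
  (forall a x, 0 <= a -> p (a *: x) <= a * p x).

Lemma sublinearZ p a x : sublinear p -> 0 <= a -> p (a *: x) = a * p x.
Proof.
move=> [pD pZ]; rewrite le_eqVlt => /predU1P[<-|a0].
  apply/le_anti; rewrite pZ//= mul0r scale0r.
  by have := pD 0 0; rewrite addr0; lra.
apply/le_anti; rewrite (pZ _ _ (ltW a0))/= -ler_pdivlMl//.
have := pZ a^-1 (a *: x); rewrite scalerA mulVf ?gt_eqF// scale1r.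
by apply; rewrite invr_ge0 ltW.
Qed.

Lemma sublinear0 p : sublinear p -> p 0 = 0.
Proof. by move=> sp; rewrite -[X in p X](scale0r 0) sublinearZ// mul0r. Qed.

Lemma sublinearN p x : sublinear p -> - p (- x) <= p x.
Proof.
move=> sp; have := sp.1 x (- x).
by rewrite subrr sublinear0//; lra.
Qed.

(* The largest sublinear functional below [q] which is additive along the ray
   of [y]. *)
Definition ray_inf q y x := inf [set q (x + t *: y) - t * q y | t in [set t | 0 <= t]].

(** Subadditivity at [x + t *: y] and [- x] gives a lower bound in which [t] no longer occurs. *)
Lemma ray_inf_lb q y x : sublinear q ->
  has_lbound [set q (x + t *: y) - t * q y | t in [set t | 0 <= t]].
Proof.
move=> sq; exists (- q (- x)) => _ [t /= t0 <-].
rewrite -sublinearZ//.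
by have := sq.1 (x + t *: y) (- x); rewrite addrAC subrr add0r; lra.
Qed.

Lemma ray_inf_le q y x t : sublinear q -> 0 <= t ->
  ray_inf q y x <= q (x + t *: y) - t * q y.
Proof. by move=> sq t0; apply: ge_inf; [exact: ray_inf_lb|exists t]. Qed.

Lemma le_ray_inf q y x c : (forall t, 0 <= t -> c <= q (x + t *: y) - t * q y) ->
  c <= ray_inf q y x.
Proof.
move=> h; apply: lb_le_inf => [|_ [t /= t0 <-]]; last exact: h.
by exists (q (x + 0 *: y) - 0 * q y); exists 0 => /=.
Qed.

Lemma ray_inf_sublinear q y : sublinear q -> sublinear (ray_inf q y).
Proof.
move=> sq; split=> [x z|a x].
- rewrite -lerBlDr; apply: le_ray_inf => s s0.
  rewrite lerBlDr -lerBlDl; apply: le_ray_inf => t t0; rewrite lerBlDl.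
  (* The parameters [s] for [x] and [t] for [z] merge into [s + t] for the sum. *)
  apply: (le_trans (ray_inf_le y (x + z) sq (addr_ge0 s0 t0))).
  have := sq.1 (x + s *: y) (z + t *: y).
  rewrite addrACA -scalerDl mulrDl; lra.
- rewrite le_eqVlt => /predU1P[<-|a0].
    rewrite scale0r mul0r; apply: (le_trans (ray_inf_le y 0 sq (lexx 0))).
    by rewrite scale0r mul0r addr0 subr0 sublinear0.
  rewrite -ler_pdivrMl//; apply: le_ray_inf => t t0; rewrite ler_pdivrMl//.
  apply: (le_trans (ray_inf_le y (a *: x) sq (mulr_ge0 (ltW a0) t0))).
  by rewrite -scalerA -scalerDr (sublinearZ _ sq (ltW a0)) mulrBr mulrA.
Qed.

Lemma ray_inf_lesub q y x : sublinear q -> ray_inf q y x <= q x.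
Proof.
move=> sq; apply: (le_trans (ray_inf_le y x sq (lexx 0))).
by rewrite scale0r addr0 mul0r subr0.
Qed.

(** Zorn's lemma for the reversed pointwise order: the pointwise infimum of a chain is its upper
    bound, kept finite by [- p (- x)]. *)
Lemma minimal_sublinear p : sublinear p -> exists q,
  [/\ sublinear q, forall x, q x <= p x &
      forall r, sublinear r -> (forall x, r x <= q x) -> r = q].
Proof.
move=> sp.
pose T := {q : V -> R | sublinear q /\ forall x, q x <= p x}.
pose rel (q r : T) := `[< forall x, sval r x <= sval q x >].
have [| | | |[q [sq qp]] qmin] := @Zorn T rel.
- by move=> q; apply/asboolP.
- by move=> q r s /asboolP qr /asboolP rs; apply/asboolP => x; exact: le_trans (rs x) (qr x).
- move=> [q hq] [r hr] /asboolP /= qr /asboolP /= rq; apply: eq_exist.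
  by apply/funext => x; apply/le_anti; rewrite qr rq.
- move=> A totA; have [/set0P[q0 Aq0]|A0] := boolP (A != set0); last first.
    (* The empty chain has no infimum; [p] itself serves. *)
    exists (exist _ p (conj sp (fun=> lexx _))) => q Aq.
    by move: A0; rewrite negbK => /eqP A0; rewrite A0 in Aq.
  pose S x := [set sval q x | q in A].
  have Slb x : has_lbound (S x).
    exists (- p (- x)) => _ [q Aq <-].
    have [sq qp] := svalP q; apply: le_trans (sublinearN x sq).
    by rewrite lerN2.
  have Sle (q : T) x : A q -> inf (S x) <= sval q x.
    by move=> Aq; apply: ge_inf => //; exists q.
  have leS c x : (forall q : T, A q -> c <= sval q x) -> c <= inf (S x).
    move=> h; apply: lb_le_inf => [|_ [q Aq <-]]; last exact: h.
    by exists (sval q0 x); exists q0.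
  suff si : sublinear (fun x => inf (S x)) /\ (forall x, inf (S x) <= p x).
    by exists (exist _ (fun x => inf (S x)) si) => q Aq; apply/asboolP => x /=; exact: Sle.
  split=> [|x]; last by apply: le_trans (Sle _ _ Aq0) ((svalP q0).2 x).
  split=> [x y|a x a0].
  + suff h (q r : T) : A q -> A r -> inf (S (x + y)) <= sval q x + sval r y.
      rewrite -lerBlDr; apply: (leS _ _) => q Aq; rewrite lerBlDr -lerBlDl.
      by apply: (leS _ _) => r Ar; rewrite lerBlDl; exact: h.
    move=> Aq Ar.
    (* Two members of a chain have a common lower one, and a single subadditive [s] then bounds the
       sum. *)
    have [s As [sq sr]] : exists2 s : T, A s & (forall z, sval s z <= sval q z) /\
        forall z, sval s z <= sval r z.
      by have [/asboolP h|/asboolP h] := totA _ _ Aq Ar; [exists r|exists q].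
    apply: (le_trans (Sle _ _ As)); apply: (le_trans ((svalP s).1.1 _ _)).
    exact: lerD.
  + move: a0; rewrite le_eqVlt => /predU1P[<-|a0].
      rewrite scale0r mul0r; apply: (le_trans (Sle _ _ Aq0)).
      by rewrite sublinear0//; exact: (svalP q0).1.
    rewrite -ler_pdivrMl//; apply: (leS _ _) => q Aq; rewrite ler_pdivrMl//.
    apply: (le_trans (Sle _ _ Aq)); rewrite (sublinearZ _ (svalP q).1)//.
    exact: ltW.
- exists q; split => // r sr rq.
  have rp x : r x <= p x by exact: le_trans (rq x) (qp x).
  have := qmin (exist _ r (conj sr rp)) => /(_ _)/(congr1 sval)/= -> //.
  exact/asboolP.
Qed.

(** Minimality forces [ray_inf q y = q]; the parameter [t = 1] then reads [q x <= q (x + y) - q y],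
    the missing half of additivity. *)
Lemma minimal_sublinear_scalar q : sublinear q ->
  (forall r, sublinear r -> (forall x, r x <= q x) -> r = q) -> scalar q.
Proof.
move=> sq qmin.
have qr y : ray_inf q y = q.
  by apply: qmin => [|x]; [exact: ray_inf_sublinear|exact: ray_inf_lesub].
have qD x y : q (x + y) = q x + q y.
  apply/le_anti; rewrite sq.1/= -[X in X + _ <= _](congr1 (@^~ x) (qr y)).
  by have := ray_inf_le y x sq ler01; rewrite scale1r mul1r; lra.
have qN x : q (- x) = - q x.
  by apply/eqP; rewrite -addr_eq0 -qD addNr sublinear0.
move=> a x y; rewrite qD; congr (_ + _).
have [a0|a0] := leP 0 a; first exact: sublinearZ.
have := @sublinearZ q (- a) x sq; rewrite oppr_ge0 => /(_ (ltW a0)).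
by rewrite scaleNr qN mulNr => /oppr_inj.
Qed.

(** The minimal functional is taken below [ray_inf p y] instead of [p]: as
    [ray_inf p y (- y) <= - p y], it satisfies [- l y <= - p y], hence equality at [y]. *)
Theorem Hahn_Banach_sublinear p y : sublinear p -> exists l : V -> R,
  [/\ scalar l, forall x, l x <= p x & l y = p y].
Proof.
move=> sp; have [q [sq qr qmin]] := minimal_sublinear (ray_inf_sublinear y sp).
have lq := minimal_sublinear_scalar sq qmin.
have qp x : q x <= p x by apply: le_trans (qr x) (ray_inf_lesub y x sp).
exists q; split => //; apply/le_anti; rewrite qp/=.
have := qr (- y); have := sublinearN y sq.
have := ray_inf_le y (- y) sp ler01.
rewrite scale1r addNr sublinear0// mul1r.
have -> : q (- y) = - q y.
  by have := lq (- 1) y 0; rewrite scaleN1r mulN1r addr0 sublinear0// addr0.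
lra.
Qed.

End HahnBanach.

(** * Integral representation of means on a compact set *)

Definition bounded_on (R : realType) (T : Type) (K : set T) (f : T -> R) :=
  exists C, forall x, K x -> `|f x| <= C.

Section BoundedOn.
Context (R : realType) (T : Type) (K : set T).
Implicit Types f g : T -> R.

Lemma bounded_on_cst c : bounded_on K (fun=> c : R).
Proof. by exists `|c|. Qed.

Lemma bounded_on_lin a f g : bounded_on K f -> bounded_on K g ->
  bounded_on K (fun x => a * f x + g x).
Proof.
move=> [C fC] [D gD]; exists (`|a| * C + D) => x Kx.
by rewrite (le_trans (ler_normD _ _))// lerD ?gD// normrM ler_wpM2l ?fC.
Qed.

Lemma bounded_onD f g : bounded_on K f -> bounded_on K g ->
  bounded_on K (fun x => f x + g x).
Proof.
move=> bf bg; have := bounded_on_lin 1 bf bg.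
by under eq_fun do rewrite mul1r.
Qed.

Lemma bounded_on_sum (I : Type) (r : seq I) (F : I -> T -> R) :
  (forall i, bounded_on K (F i)) -> bounded_on K (fun x => \sum_(i <- r) F i x).
Proof.
move=> bF; elim: r => [|i r ih].
  by under eq_fun do rewrite big_nil; exact: bounded_on_cst.
by under eq_fun do rewrite big_cons; exact: bounded_onD.
Qed.

End BoundedOn.

Lemma continuous_bounded_on (R : realType) (T : topologicalType) (K : set T)
  (f : T -> R) : compact K -> {within K, continuous f} -> bounded_on K f.
Proof.
move=> cK cf; have [->|/set0P K0] := eqVneq K set0; first by exists 0.
have [c _ cmax] := compact_EVT_max K0 cK cf.
have [d _ dmin] := compact_EVT_min K0 cK cf.
exists (`|f c| + `|f d|) => x Kx.
have := cmax x (mem_set Kx); have := dmin x (mem_set Kx).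
have := ler_norm (f c); have := ler_norm (- f d); rewrite normrN.
have := normr_ge0 (f c); have := normr_ge0 (f d).
by rewrite ler_norml => *; apply/andP; split; lra.
Qed.

Lemma within_open_lt (R : realType) (T : topologicalType) (K : set T)
    (f : T -> R) c : {within K, continuous f} ->
  exists2 W : set T, open W & forall x, K x -> W x <-> f x < c.
Proof.
move=> /continuousP/(_ [set y | y < c] (@open_lt R c))/open_subspaceP[W oW WK].
exists W => // x Kx; split=> [Wx|fx].
  have : (W `&` K) x by split.
  by rewrite WK => -[].
have : ([set x | f x < c] `&` K) x by split.
by rewrite -WK => -[].
Qed.

Lemma within_open_gt (R : realType) (T : topologicalType) (K : set T)
    (f : T -> R) c : {within K, continuous f} ->
  exists2 W : set T, open W & forall x, K x -> W x <-> c < f x.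
Proof.
move=> /continuousP/(_ [set y | y > c] (@open_gt R c))/open_subspaceP[W oW WK].
exists W => // x Kx; split=> [Wx|fx].
  have : (W `&` K) x by split.
  by rewrite WK => -[].
have : ([set x | c < f x] `&` K) x by split.
by rewrite -WK => -[].
Qed.

(** * Continuous approximations of the indicator of an open set *)

Section Inradius.
Context (R : realType) (T : pseudoMetricType R).
Implicit Types (U : set T) (x y : T).

(** Adjoining 0 keeps the set nonempty and makes its supremum 0 off [U]; the cap at 1 keeps it
    bounded when every ball around [x] lies in [U]. *)
Definition inradius_set U x :=
  [set r : R | r = 0 \/ [/\ 0 < r, r <= 1 & ball x r `<=` U]].

(* The distance from [x] to the complement of [U], truncated at 1. *)
Definition inradius U x : R := sup (inradius_set U x).

Lemma has_sup_inradius U x : has_sup (inradius_set U x).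
Proof. by split; [exists 0; left|exists 1 => r [->|[]]]. Qed.

Lemma le_inradius U x r : 0 < r -> r <= 1 -> ball x r `<=` U -> r <= inradius U x.
Proof. by move=> r0 r1 rU; apply: sup_upper_bound (has_sup_inradius U x) _ _; right. Qed.

Lemma inradius_ge0 U x : 0 <= inradius U x.
Proof. by apply: sup_upper_bound (has_sup_inradius U x) _ _; left. Qed.

(** If [ball x s] lies in [U], so does [ball y (s - r)], by the triangle inequality. *)
Lemma inradius_lip U x y r : 0 < r -> ball x r y -> inradius U x <= inradius U y + r.
Proof.
move=> r0 xy; apply: ge_sup (has_sup_inradius U x).1 _ => s [->|[s0 s1 sU]].
  by rewrite addr_ge0 ?inradius_ge0// ltW.
have [sr|rs] := leP s r; first by rewrite (le_trans sr)// lerDr inradius_ge0.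
rewrite -lerBlDr; apply: le_inradius; [by rewrite subr_gt0|by lra|].
move=> z yz; apply: sU.
by have := ball_triangle xy yz; rewrite addrC subrK.
Qed.

Lemma inradius_continuous U : continuous (inradius U).
Proof.
move=> x; apply/cvgrPdist_le => e e0.
have : nbhs x (ball x e) by exact: nbhsx_ballx.
apply: filterS => y xy; have := inradius_lip U e0 xy.
have := inradius_lip U e0 (ball_sym xy).
by rewrite ler_norml => *; apply/andP; split; lra.
Qed.

Lemma inradius_gt0 U x : open U -> U x -> 0 < inradius U x.
Proof.
move=> oU Ux; have /nbhs_ballP[r /= r0 rU] : nbhs x U by exact: open_nbhs_nbhs.
have m0 : 0 < Num.min r 1 by rewrite lt_min r0/=.
apply: (lt_le_trans m0); apply: le_inradius => //; first by rewrite ge_min lexx orbT.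
by apply: subset_trans rU; apply: le_ball; rewrite ge_min lexx.
Qed.

Lemma inradius_eq0 U x : ~ U x -> inradius U x = 0.
Proof.
move=> Ux; apply/le_anti; rewrite inradius_ge0 andbT.
apply: ge_sup (has_sup_inradius U x).1 _ => s [->//|[s0 _ sU]].
by exfalso; apply/Ux/sU/ballxx.
Qed.

(** For open [U] these Urysohn-type functions increase with [n] to the indicator of [U]. *)
Definition inner U n x : R := Num.min 1 (n%:R * inradius U x).

Lemma inner_ge0 U n x : 0 <= inner U n x.
Proof. by rewrite le_min ler01 mulr_ge0 ?inradius_ge0. Qed.

Lemma inner_le1 U n x : inner U n x <= 1.
Proof. by rewrite ge_min lexx. Qed.

Lemma inner_out U n x : ~ U x -> inner U n x = 0.
Proof. by move=> Ux; rewrite /inner inradius_eq0// mulr0 min_r. Qed.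

Lemma inner_gt0 U n x : 0 < inner U n x -> U x.
Proof. by move=> h; apply: contrapT => /(inner_out n) e; rewrite e ltxx in h. Qed.

Lemma inner_continuous U n : continuous (inner U n).
Proof.
move=> x.
apply: (@continuous_min _ _ (fun=> 1) (fun y => n%:R * inradius U y)).
  exact: cvg_cst.
by apply: cvgMr; exact: inradius_continuous.
Qed.

End Inradius.

Section Mean.
Context (R : realType) (T : Type) (K : set T).

(** The second clause carries both positivity and mass one: applied to differences it gives
    monotonicity, applied to constants it fixes their values. It also makes [Lam f] depend, for
    bounded [f], on the values on [K] only. *)
Definition mean_on (Lam : (T -> R) -> R) :=
  (forall a f g, bounded_on K f -> bounded_on K g ->
     Lam (fun x => a * f x + g x) = a * Lam f + Lam g) /\
  (forall f c, bounded_on K f -> (forall x, K x -> f x <= c) -> Lam f <= c).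

Variable Lam : (T -> R) -> R.
Hypothesis LamP : mean_on Lam.

Lemma meanD f g : bounded_on K f -> bounded_on K g ->
  Lam (fun x => f x + g x) = Lam f + Lam g.
Proof.
move=> bf bg; rewrite -[Lam f]mul1r -LamP.1//.
by congr Lam; apply/funext => x; rewrite mul1r.
Qed.

Lemma mean0 : Lam (fun=> 0) = 0.
Proof.
have b0 := bounded_on_cst K (0 : R).
have := meanD b0 b0; under [X in Lam X]eq_fun do rewrite addr0.
by move=> h; apply: (addrI (Lam (fun=> 0))); rewrite addr0.
Qed.

Lemma meanZ a f : bounded_on K f -> Lam (fun x => a * f x) = a * Lam f.
Proof.
move=> bf; have := LamP.1 a _ _ bf (bounded_on_cst K 0).
by rewrite mean0 addr0; under [X in Lam X]eq_fun do rewrite addr0.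
Qed.

Lemma mean_cst c : Lam (fun=> c) = c.
Proof.
have h e : Lam (fun=> e) <= e by apply: LamP.2 => //; exact: bounded_on_cst.
apply/le_anti; rewrite h/= -lerN2 -mulN1r -meanZ; last exact: bounded_on_cst.
by rewrite (le_trans (h _))// mulN1r.
Qed.

Lemma mean_le f g : bounded_on K f -> bounded_on K g ->
  (forall x, K x -> f x <= g x) -> Lam f <= Lam g.
Proof.
move=> bf bg fg; have : Lam (fun x => -1 * g x + f x) <= 0.
  apply: LamP.2 => [|x Kx]; first exact: bounded_on_lin.
  by rewrite mulN1r addrC subr_le0 fg.
by rewrite LamP.1// mulN1r addrC subr_le0.
Qed.

Lemma mean_sum (I : Type) (r : seq I) (F : I -> T -> R) :
  (forall i, bounded_on K (F i)) ->
  Lam (fun x => \sum_(i <- r) F i x) = \sum_(i <- r) Lam (F i).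
Proof.
move=> bF; elim: r => [|i r ih].
  by under [X in Lam X]eq_fun do rewrite big_nil; rewrite mean0 big_nil.
under [X in Lam X]eq_fun do rewrite big_cons.
by rewrite meanD// ?ih ?big_cons//; exact: bounded_on_sum.
Qed.

End Mean.

Lemma bounded_inner (R : realType) (T : pseudoMetricType R) (K U : set T) n :
  bounded_on K (inner U n).
Proof. by exists 1 => x _; rewrite ger0_norm ?inner_ge0// inner_le1. Qed.

(** * The outer measure generated by a mean *)

Section OuterMeasureOfMean.
Context (R : realType) (T : pseudoPMetricType R) (K : set T).
Variable Lam : (T -> R) -> R.
Hypotheses (cK : compact K) (LamP : mean_on K Lam).
Implicit Types (f : T -> R) (U V : set T).

Definition open_mass U : R := sup [set Lam (inner U n) | n in [set: nat]].

Lemma has_sup_open_mass U : has_sup [set Lam (inner U n) | n in [set: nat]].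
Proof.
split; first by exists (Lam (inner U 0%N)); exists 0%N.
exists 1 => _ [n _ <-]; apply: LamP.2; first exact: bounded_inner.
by move=> x _; exact: inner_le1.
Qed.

Lemma mean_inner_le U n : Lam (inner U n) <= open_mass U.
Proof. by apply: sup_upper_bound (has_sup_open_mass U) _ _; exists n. Qed.

Lemma mean_inner_ge0 U n : 0 <= Lam (inner U n).
Proof.
rewrite -(mean0 LamP); apply: (mean_le LamP) => [||x _].
- exact: bounded_on_cst.
- exact: bounded_inner.
- exact: inner_ge0.
Qed.

Lemma open_mass_ge0 U : 0 <= open_mass U.
Proof. exact: le_trans (mean_inner_ge0 U 0) (mean_inner_le U 0). Qed.

Lemma open_mass_out U : (forall x, K x -> ~ U x) -> open_mass U = 0.
Proof.
move=> KU; apply/le_anti; rewrite open_mass_ge0 andbT.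
apply: ge_sup (has_sup_open_mass U).1 _ => _ [n _ <-].
apply: LamP.2; first exact: bounded_inner.
by move=> x /KU Ux; rewrite inner_out.
Qed.

(** The open sets [G N], where [f < e] or some [inner (U i) N] with [i < N] has reached 1, cover
    [K]; by compactness finitely many suffice, and the largest index serves for all of them. *)
Lemma cover_inner f (U : nat -> set T) e : {within K, continuous f} ->
    (forall x, K x -> f x <= 1) -> (forall n, open (U n)) ->
    (forall x, K x -> 0 < f x -> exists n, U n x) -> 0 < e ->
  exists N, forall x, K x -> f x - e <= \sum_(i < N) inner (U i) N x.
Proof.
move=> cf f1 oU fU e0.
have [W oW WK] := within_open_lt e cf.
pose G N := W `|` \bigcup_(i in [set i | (i < N)%N])
  [set x | 1 < N%:R * inradius (U i) x].
have oG N : open (G N).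
  apply: openU => //; apply: bigcup_open => i _.
  apply: (@open_comp _ _ (fun x => N%:R * inradius (U i) x) [set y | 1 < y]).
    by move=> x _; apply: cvgMr; exact: inradius_continuous.
  exact: open_gt.
have KG : K `<=` \bigcup_(N in [set: nat]) G N.
  move=> x Kx; have [fe|fe] := ltP (f x) e.
    by exists 0%N => //; left; exact/(WK _ Kx).
  have [n Un] := fU x Kx (lt_le_trans e0 fe).
  have h0 := inradius_gt0 (oU n) Un.
  (* The index must exceed [n], to include [U n], and the inverse of the inradius, to saturate
     [inner (U n)] at [x]. *)
  exists (maxn n.+1 (Num.truncn (inradius (U n) x)^-1).+1) => //; right.
  exists n => /=; first by rewrite leq_max ltnSn.
  rewrite -ltr_pdivrMr// div1r.
  apply: (lt_le_trans (truncnS_gt _)).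
  by rewrite ler_nat leq_maxr.
have := cK; rewrite compact_cover => /(_ _ _ _ (fun N _ => oG N) KG)[D _ KD].
pose M := (\max_(N <- finmap.enum_fset D) N)%N.
exists M => x Kx.
have s0 : 0 <= \sum_(i < M) inner (U i) M x.
  by apply: sumr_ge0 => i _; exact: inner_ge0.
have [N /= DN [Wx|[i /= iN Ui]]] := KD x Kx.
  apply: le_trans s0; rewrite subr_le0; apply: ltW; exact/(WK _ Kx).
have NM : (N <= M)%N.
  exact: (@leq_bigmax_seq _ _ xpredT id).
rewrite (bigD1 (Ordinal (leq_trans iN NM)))//=.
have -> : inner (U i) M x = 1.
  rewrite /inner min_l// ltW// (lt_le_trans Ui)// ler_wpM2r ?inradius_ge0//.
  by rewrite ler_nat.
rewrite lerBlDr (le_trans (f1 _ Kx))// -addrA lerDl addr_ge0 ?(ltW e0)//.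
by apply: sumr_ge0 => j _; exact: inner_ge0.
Qed.

(** Applying [Lam] to the finite bound of [cover_inner] loses only [e]. Comparison with a single
    open set and countable subadditivity are both instances. *)
Lemma mean_cover_le f (U : nat -> set T) : {within K, continuous f} ->
    (forall x, K x -> f x <= 1) -> (forall n, open (U n)) ->
    (forall x, K x -> 0 < f x -> exists n, U n x) ->
  ((Lam f)%:E <= \sum_(n <oo) (open_mass (U n))%:E)%E.
Proof.
move=> cf f1 oU fU; apply/lee_addgt0Pr => e e0.
have [N fN] := cover_inner cf f1 oU fU e0.
have bf := continuous_bounded_on cK cf.
have : Lam f - e <= \sum_(i < N) open_mass (U i).
  rewrite -[X in _ - X](mean_cst LamP) -mulN1r -(meanZ LamP)//; last exact: bounded_on_cst.
  rewrite -(meanD LamP)//; last exact: bounded_on_cst.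
  apply: (@le_trans _ _ (Lam (fun x => \sum_(i < N) inner (U i) N x))).
    apply: (mean_le LamP) => [||x Kx].
    - exact/bounded_onD/bounded_on_cst.
    - by apply: bounded_on_sum => i; exact: bounded_inner.
    - by rewrite mulN1r; exact: fN.
  rewrite (mean_sum LamP)//; last by move=> i; exact: bounded_inner.
  by apply: ler_sum => i _; exact: mean_inner_le.
rewrite lerBlDr -lee_fin EFinD => /le_trans; apply; apply: leeD2r.
rewrite -sumEFin -(big_mkord xpredT (fun i => (open_mass (U i))%:E)).
by apply: nneseries_lim_ge => n _ _; rewrite lee_fin open_mass_ge0.
Qed.

Lemma mean_le_open_mass f V : {within K, continuous f} ->
  (forall x, K x -> f x <= 1) -> open V -> (forall x, K x -> 0 < f x -> V x) ->
  Lam f <= open_mass V.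
Proof.
move=> cf f1 oV fV; rewrite -lee_fin.
pose U n := if n is 0%N then V else set0.
have -> : (open_mass V)%:E = (\sum_(n <oo) (open_mass (U n))%:E)%E.
  rewrite nneseries_recl//; last by move=> n _; rewrite lee_fin open_mass_ge0.
  rewrite eseries0 ?adde0// => -[//|n] _ _ /=.
  by rewrite open_mass_out// => x _ [].
apply: mean_cover_le => // [[|n]|x Kx fx] /=; [by []|exact: open0|].
by exists 0%N; exact: fV.
Qed.

Lemma open_mass_cover V (U : nat -> set T) : (forall n, open (U n)) ->
  V `<=` \bigcup_n U n -> ((open_mass V)%:E <= \sum_(n <oo) (open_mass (U n))%:E)%E.
Proof.
move=> oU VU.
have h n : ((Lam (inner V n))%:E <= \sum_(n <oo) (open_mass (U n))%:E)%E.
  apply: mean_cover_le => //.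
  - by apply: continuous_subspaceT; exact: inner_continuous.
  - by move=> x _; exact: inner_le1.
  - by move=> x _ /inner_gt0/VU[m _ Um]; exists m.
(* An infinite series needs no argument, and the bound for [n = 0] excludes the value -oo. *)
move: h; case: (\sum_(n <oo) _)%E => [r|h|/(_ 0%N)//]; last by rewrite leey.
move=> h; rewrite lee_fin; apply: ge_sup (has_sup_open_mass V).1 _ => _ [n _ <-].
by rewrite -lee_fin.
Qed.

Lemma open_mass_le U V : open V -> U `<=` V -> open_mass U <= open_mass V.
Proof.
move=> oV UV; apply: ge_sup (has_sup_open_mass U).1 _ => _ [n _ <-].
apply: mean_le_open_mass => // [|x _|x _ /inner_gt0/UV//].
  by apply: continuous_subspaceT; exact: inner_continuous.
exact: inner_le1.
Qed.

Definition outer_mass (A : set T) : \bar R :=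
  ereal_inf [set (open_mass U)%:E | U in [set U | open U /\ A `<=` U]].

Lemma outer_mass_open U : open U -> outer_mass U = (open_mass U)%:E.
Proof.
move=> oU; apply/le_anti/andP; split.
  by apply: ereal_inf_lbound; exists U => //; split.
apply: le_ereal_inf_tmp => _ [V [oV UV] <-]; rewrite lee_fin; exact: open_mass_le.
Qed.

Lemma outer_mass0 : outer_mass set0 = 0%E.
Proof. by rewrite (outer_mass_open open0) open_mass_out// => x _ []. Qed.

Lemma outer_mass_ge0 A : (0 <= outer_mass A)%E.
Proof.
by apply: le_ereal_inf_tmp => _ [V _ <-]; rewrite lee_fin open_mass_ge0.
Qed.

Lemma le_outer_mass : {homo outer_mass : A B / A `<=` B >-> (A <= B)%E}.
Proof.
move=> A B AB; apply: le_ereal_inf => _ [V [oV BV] <-].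
by exists V => //; split => //; exact: subset_trans BV.
Qed.

Lemma outer_mass_adherent A e : 0 < e ->
  exists U, [/\ open U, A `<=` U & ((open_mass U)%:E <= outer_mass A + e%:E)%E].
Proof.
move=> e0; have fA : outer_mass A \is a fin_num.
  rewrite ge0_fin_numE ?outer_mass_ge0//; apply: le_lt_trans (ltry (open_mass setT)).
  by apply: ereal_inf_lbound; exists setT => //; split=> //; exact: openT.
have [_ [U [oU AU] <-] /ltW h] := lb_ereal_inf_adherent e0 fA.
by exists U.
Qed.

Lemma outer_mass_sigma_subadditive : sigma_subadditive outer_mass.
Proof.
move=> F; apply/lee_addgt0Pr => e e0.
have en n : 0 < e / (2 ^ n.+1)%:R by rewrite divr_gt0// ltr0n expn_gt0.
have /choice[U UP] n := outer_mass_adherent (F n) (en n).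
apply: (@le_trans _ _ (open_mass (\bigcup_n U n))%:E).
  apply: ereal_inf_lbound; exists (\bigcup_n U n) => //; split.
    by apply: bigcup_open => n _; have [] := UP n.
  by apply: subset_bigcup => n _; have [] := UP n.
apply: (le_trans (@open_mass_cover _ U _ _)) => //.
  by move=> n; have [] := UP n.
apply: le_trans (epsilon_trick xpredT _ (ltW e0)); last first.
  by move=> n; exact: outer_mass_ge0.
apply: lee_nneseries => n _; first by rewrite lee_fin open_mass_ge0.
by have [] := UP n.
Qed.

Definition mean_outer_measure : {outer_measure set T -> \bar R} :=
  HB.pack outer_mass (isOuterMeasure.Build R T outer_mass
    outer_mass0 outer_mass_ge0 le_outer_mass outer_mass_sigma_subadditive).

(** After [A] is enlarged to an open [V], the part of [V] outside [U] need not be open. It is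
    enlarged to the open set [V'] on which [f], a function nearly realizing the mass of the part
    inside [U], stays below [d / 2]. *)
Lemma outer_mass_split U A : open U ->
  (outer_mass (A `&` U) + outer_mass (A `&` ~` U) <= outer_mass A)%E.
Proof.
move=> oU; apply/lee_addgt0Pr => e e0.
have [V [oV AV VA]] := outer_mass_adherent A e0.
apply: le_trans VA.
apply: (@le_trans _ _ (outer_mass (V `&` U) + outer_mass (V `&` ~` U))%E).
  by apply: leeD; apply: le_outer_mass; exact: setSI.
have oVU : open (V `&` U) by exact: openI.
rewrite (outer_mass_open oVU).
apply/lee_addgt0Pr => d d0; rewrite -EFinD.
have [_ [n _ <-] hn] := sup_adherent (divr_gt0 d0 (ltr0n R 2)) (has_sup_open_mass (V `&` U)).
rewrite -/(open_mass _) in hn.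
pose f : T -> R := inner (V `&` U) n.
pose V' := V `&` [set x | f x < d / 2].
have cf : continuous f by exact: inner_continuous.
have oV' : open V'.
  apply: openI => //; apply: (@open_comp _ _ f [set y | y < d / 2]).
    by move=> x _; exact: cf.
  exact: open_lt.
have VV' : V `&` ~` U `<=` V'.
  move=> x [Vx Ux]; split => //=; rewrite /f inner_out ?divr_gt0//.
  by move=> [].
apply: (@le_trans _ _ ((open_mass (V `&` U))%:E + (open_mass V')%:E)%E).
  by rewrite -(outer_mass_open oV'); apply: leeD2l; exact: le_outer_mass.
rewrite -EFinD lee_fin.
(* [f] and [inner V' m] overlap only where [f < d / 2]; after subtraction of [d / 2] their sum is at
   most 1 and is positive only in [V]. *)
suff h m : Lam f - d / 2 + Lam (inner V' m) <= open_mass V.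
  rewrite -lerBrDl; apply: ge_sup (has_sup_open_mass V').1 _ => _ [m _ <-].
  have := h m; rewrite /f; move: hn; lra.
have bV' : bounded_on K (inner V' m) by exact: bounded_inner.
have bf : bounded_on K f by exact: bounded_inner.
have -> : Lam f - d / 2 + Lam (inner V' m) =
    Lam (fun x => f x + (- (d / 2) + inner V' m x)).
  rewrite (meanD LamP)// ?(meanD LamP) ?(mean_cst LamP) ?addrA//; try exact: bounded_on_cst.
  exact/bounded_onD/bV'/bounded_on_cst.
have d2 : 0 < d / 2 by rewrite divr_gt0.
apply: mean_le_open_mass => // [|x _|x _].
- apply: continuous_subspaceT => x; apply: cvgD; first exact: cf.
  by apply: cvgD; [exact: cvg_cst|exact: inner_continuous].
- have [fx|fx] := ltP (f x) (d / 2).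
    by have := inner_le1 V' m x; lra.
  rewrite inner_out; last by move=> [_] /=; rewrite ltNge fx.
  by have := inner_le1 (V `&` U) n x; rewrite -/(f x); lra.
- move=> h; apply: contrapT => Vx; move: h.
  by rewrite /f !inner_out => [|[]//|[]//]; lra.
Qed.

Lemma open_caratheodory U : open U -> mean_outer_measure.-caratheodory U.
Proof.
by move=> oU; apply: le_caratheodory_measurable => A; exact: outer_mass_split.
Qed.

End OuterMeasureOfMean.

(** The Caratheodory measurable sets form a sigma-algebra on which the outer measure is countably
    additive, and they contain the one generated by [G]. *)
Lemma restrict_outer_probability (R : realType) (T : pointedType)
    (G : set (set T)) (mu : {outer_measure set T -> \bar R}) :
  G `<=` mu.-caratheodory -> mu setT = 1%E ->
  exists P : probability (g_sigma_algebraType G) R, forall A, P A = mu A.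
Proof.
move=> Gmu mu1.
have sub : <<s G >> `<=` mu.-caratheodory.
  apply: smallest_sub => //; split.
  - exact: caratheodory_measurable_set0.
  - by move=> A mA; rewrite setTD; exact: caratheodory_measurable_setC.
  - by move=> F mF; exact: caratheodory_measurable_bigcup.
pose P : set (g_sigma_algebraType G) -> \bar R := mu.
have P0 : P set0 = 0%E by exact: outer_measure0.
have Pge0 A : (0 <= P A)%E by exact: outer_measure_ge0.
have Psigma : semi_sigma_additive P.
  move=> F mF tF mUF; apply: (@caratheodory_measure_sigma_additive R T mu) => //.
    by move=> n; exact: sub (mF n).
  exact: sub mUF.
pose m : {measure set (g_sigma_algebraType G) -> \bar R} :=
  HB.pack P (isMeasure.Build _ _ _ P P0 Pge0 Psigma).
pose p : probability (g_sigma_algebraType G) R :=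
  HB.pack P m (Measure_isProbability.Build _ _ _ m mu1).
by exists p.
Qed.

(** * The Riesz representation of a mean *)

Section Riesz.
Context (R : realType) (T : pseudoPMetricType R) (K : set T).
Local Notation borelT := (g_sigma_algebraType (@open T)).

Lemma within_continuous_measurable (f : T -> R) : closed K ->
  {within K, continuous f} -> measurable_fun (K : set borelT) f.
Proof.
move=> cK cf; have mK : measurable (K : set borelT).
  rewrite -[K]setCK; apply: measurableC; apply: sub_sigma_algebra.
  exact: closed_openC.
move=> _; apply: (measurability _ (RGenOInfty.measurableE R)) => //.
move=> _ [_ [a ->] <-]; have [W oW WK] := within_open_gt a cf.
rewrite (_ : _ `&` _ = W `&` K); last first.
  apply/seteqP; split=> x /=; rewrite in_itv/= andbT => -[]; last first.
    by move=> Wx Kx; split=> //; exact/(WK _ Kx).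
  by move=> Kx fx; split=> //; exact/(WK _ Kx).
by apply: measurableI => //; exact: sub_sigma_algebra.
Qed.

Lemma within_continuous_integrable (P : probability borelT R) (f : T -> R) :
  compact K -> closed K -> {within K, continuous f} ->
  P.-integrable (K : set borelT) (EFin \o f).
Proof.
move=> coK cK cf; have mK : measurable (K : set borelT).
  rewrite -[K]setCK; apply: measurableC; apply: sub_sigma_algebra.
  exact: closed_openC.
apply: measurable_bounded_integrable => //.
- by apply: le_lt_trans (ltry 1); exact: probability_le1.
- exact: within_continuous_measurable.
- have [C fC] := continuous_bounded_on coK cf.
  by exists C; split; [exact: num_real|move=> D /ltW CD x Kx; exact: le_trans (fC x Kx) CD].
Qed.

Lemma within_continuous_min (g h : T -> R) : {within K, continuous g} ->
  {within K, continuous h} -> {within K, continuous (fun x => Num.min (g x) (h x))}.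
Proof. by move=> cg ch x; exact: (continuous_min (cg x) (ch x)). Qed.

Lemma within_continuousD (g h : T -> R) : {within K, continuous g} ->
  {within K, continuous h} -> {within K, continuous (fun x => g x + h x)}.
Proof. by move=> cg ch x; apply: cvgD; [exact: cg|exact: ch]. Qed.

Lemma within_continuousZ a (g : T -> R) : {within K, continuous g} ->
  {within K, continuous (fun x => a * g x)}.
Proof. by move=> cg x; apply: cvgMr; exact: cg. Qed.

Lemma within_continuous_cst (a : R) : {within K, continuous (fun=> a)}.
Proof. by move=> x; exact: cvg_cst. Qed.

Arguments within_continuousZ a [g] _ _.
Arguments within_continuous_cst a _ : clear implicits.

Variable Lam : (T -> R) -> R.
Hypotheses (coK : compact K) (cK : closed K) (LamP : mean_on K Lam).

Section Represented.
Variable P : probability borelT R.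
Hypothesis Popen : forall U, open U -> P U = (open_mass Lam U)%:E.
Hypothesis PK : P (~` K) = 0%E.

Let mK : measurable (K : set borelT).
Proof.
by rewrite -[K]setCK; apply: measurableC; apply: sub_sigma_algebra; exact: closed_openC.
Qed.

Let PK1 : fine (P K) = 1.
Proof.
have := probability_setC P mK; rewrite PK => /eqP.
by rewrite eq_sym sube_eq// ?fin_num_measure// add0e => /eqP <-.
Qed.

Let intK (g : T -> R) : {within K, continuous g} ->
  P.-integrable (K : set borelT) (EFin \o g).
Proof. exact: within_continuous_integrable. Qed.

Let bdK (g : T -> R) : {within K, continuous g} -> bounded_on K g.
Proof. exact: continuous_bounded_on. Qed.

(* Layer cake: the k-th layer of [y = n g] has mean at most the mass of
   [{y > k}], hence at most the integral of the k-th layer of [y + 1]. *)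
Let mean_layer_le (y : T -> R) k : {within K, continuous y} ->
  Lam (fun x => Num.min (y x) k.+1%:R) - Lam (fun x => Num.min (y x) k%:R) <=
  \int[P]_(x in (K : set borelT)) Num.min (y x + 1) k.+1%:R -
  \int[P]_(x in (K : set borelT)) Num.min (y x + 1) k%:R.
Proof.
move=> cy; have cy1 := within_continuousD cy (within_continuous_cst 1).
have cm (g : T -> R) (j : nat) : {within K, continuous g} ->
    {within K, continuous (fun x => Num.min (g x) j%:R)}.
  by move=> cg; exact: within_continuous_min cg (within_continuous_cst _).
have [W oW WK] := within_open_gt k%:R cy.
rewrite -(RintegralB mK); [|exact/intK/cm|exact/intK/cm].
apply: (@le_trans _ _ (open_mass Lam W)).
  have -> : Lam (fun x => Num.min (y x) k.+1%:R) - Lam (fun x => Num.min (y x) k%:R) =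
      Lam (fun x => -1 * Num.min (y x) k%:R + Num.min (y x) k.+1%:R).
    rewrite LamP.1; [|exact/bdK/cm|exact/bdK/cm].
    by rewrite mulN1r addrC.
  apply: (mean_le_open_mass coK LamP) => // [|x Kx|x Kx].
  - exact: within_continuousD (within_continuousZ _ (cm _ _ cy)) (cm _ _ cy).
  - by rewrite -natr1; case: (leP (y x) k%:R) => h1; case: (leP (y x) (k%:R + 1)) => h2; lra.
  - rewrite -natr1 => h; apply/(WK _ Kx).
    by move: h; case: (leP (y x) k%:R) => h1; case: (leP (y x) (k%:R + 1)) => h2; lra.
have -> : open_mass Lam W = \int[P]_(x in (K : set borelT)) \1_W x.
  have mW : measurable (W : set borelT) by exact: sub_sigma_algebra.
  rewrite /Rintegral integral_indic//.
  (* The trace of [W] on [K] has the measure of [W], since the complement of [K] is null. *)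
  rewrite [X in fine X](_ : _ = P W); first by rewrite Popen.
  rewrite -[in RHS](setIT W) -(setUv K) setIUr measureU//.
  - rewrite [X in (_ + X)%E](_ : _ = 0%E) ?adde0//.
    apply/eqP; rewrite eq_le measure_ge0 andbT -PK le_measure ?inE//.
      by apply: measurableI => //; exact: measurableC.
    exact: measurableC.
  - exact: measurableI.
  - by apply: measurableI => //; exact: measurableC.
  - by rewrite setIACA setICr setI0.
apply: le_Rintegral => // [||x Kx].
- apply: measurable_bounded_integrable => //.
  + by apply: le_lt_trans (ltry 1); exact: probability_le1.
  + by apply: measurable_indic; exact: sub_sigma_algebra.
  + exists 1; split; first exact: num_real.
    move=> M M1 x Kx; rewrite /= indicE; case: (_ \in _) => /=; rewrite ?normr1 ?normr0; lra.
- have := intK (within_continuousD (cm _ k.+1 cy1) (within_continuousZ (-1) (cm _ k cy1))).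
  by apply: eq_integrable => // x _ /=; rewrite mulN1r.
rewrite indicE -natr1; case: (boolP (x \in W)) => [/set_mem/(WK _ Kx) h|_] /=;
  by case: (leP (y x + 1) k%:R) => h1; case: (leP (y x + 1) (k%:R + 1)) => h2; lra.
Qed.

(** The layer estimates telescope to [n * Lam g] on the left and to at most the integral of
    [n * g + 1] on the right; as [P K] is 1, division by [n] leaves the error 1/n. *)
Let mean_le_integral01 (g : T -> R) : {within K, continuous g} ->
  (forall x, K x -> 0 <= g x <= 1) -> Lam g <= \int[P]_(x in (K : set borelT)) g x.
Proof.
move=> cg g01; apply/ler_addgt0Pr => e e0.
pose n := (Num.truncn e^-1).+1.
have n0 : 0 < n%:R :> R by rewrite ltr0n.
have ne : n%:R^-1 <= e.
  by rewrite -[leRHS]invrK lef_pV2 ?posrE ?invr_gt0// ltW// truncnS_gt.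
apply: le_trans (lerD (lexx _) ne).
pose y x := n%:R * g x.
have cy : {within K, continuous y} by exact: within_continuousZ.
have cy1 := within_continuousD cy (within_continuous_cst 1).
have : Lam (fun x => Num.min (y x) n%:R) - Lam (fun x => Num.min (y x) 0%:R) <=
    \int[P]_(x in (K : set borelT)) Num.min (y x + 1) n%:R -
    \int[P]_(x in (K : set borelT)) Num.min (y x + 1) 0%:R.
  pose a k := Lam (fun x => Num.min (y x) k%:R).
  pose b k := \int[P]_(x in (K : set borelT)) Num.min (y x + 1) k%:R.
  rewrite -/(a n) -/(a 0%N) -/(b n) -/(b 0%N).
  rewrite -!(telescope_sumr _ (leq0n n)).
  by apply: ler_sum => k _; exact: mean_layer_le.
have y0 x : K x -> 0 <= y x by move=> /g01/andP[g0 _]; rewrite mulr_ge0.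
have cst0 : {within K, continuous (fun x => Num.min (y x) 0)}.
  exact: within_continuous_min cy (within_continuous_cst 0).
have -> : Lam (fun x => Num.min (y x) 0%:R) = 0.
  rewrite -[RHS](mean0 LamP); apply/le_anti/andP; split; apply: (mean_le LamP);
    try exact: bounded_on_cst; try exact: bdK;
    by move=> x /y0; rewrite ?ge_min ?lexx ?orbT// => h; rewrite min_r.
have -> : Lam (fun x => Num.min (y x) n%:R) = n%:R * Lam g.
  rewrite -(meanZ LamP); last exact: bdK.
  have h x : K x -> Num.min (y x) n%:R = n%:R * g x.
    by move=> /g01/andP[_ g1]; rewrite min_l// ler_piMr.
  by apply/le_anti/andP; split; apply: (mean_le LamP); try (exact: bdK);
    try (exact/bdK/(within_continuous_min cy)/within_continuous_cst);
    move=> x Kx; rewrite h.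
have -> : \int[P]_(x in (K : set borelT)) Num.min (y x + 1) 0%:R = 0.
  transitivity (\int[P]_(x in (K : set borelT)) (0 : R)).
    apply: eq_Rintegral => x /set_mem Kx; rewrite min_r// addr_ge0//; exact: y0.
  by rewrite Rintegral_cst// mul0r.
rewrite !subr0 => h.
have {h} : n%:R * Lam g <= \int[P]_(x in (K : set borelT)) (y x + 1).
  apply: (le_trans h); apply: le_Rintegral => //; [|exact: intK|].
    exact/intK/(within_continuous_min cy1)/within_continuous_cst.
  by move=> x _; rewrite ge_min lexx.
rewrite RintegralD//; [|exact: intK|exact/intK/within_continuous_cst].
rewrite Rintegral_cst// mul1r PK1 RintegralZl//; last exact: intK.
by rewrite -ler_pdivlMl// mulrDr mulKf ?gt_eqF// mulr1.
Qed.

(** Both sides respect affine changes of [g], so [g] is rescaled into the unit interval; the 1 in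
    [D] keeps the scale positive when [C] is 0. *)
Let mean_le_integral (g : T -> R) : {within K, continuous g} ->
  Lam g <= \int[P]_(x in (K : set borelT)) g x.
Proof.
move=> cg; have [C gC] := bdK cg.
pose D := `|C| + 1; have D0 : 0 < D by rewrite ltr_wpDl.
pose h x := (2 * D)^-1 * (g x + D).
have cgD := within_continuousD cg (within_continuous_cst D).
have ch : {within K, continuous h} by exact: within_continuousZ.
have : Lam h <= \int[P]_(x in (K : set borelT)) h x.
  apply: mean_le_integral01 => // x Kx; rewrite /h.
  have := gC x Kx; have := ler_norm C; rewrite ler_norml => Cn /andP[g1 g2].
  rewrite mulr_ge0 ?invr_ge0 ?mulr_ge0 ?(ltW D0)//=; last by rewrite /D; lra.
  by rewrite ler_pdivrMl ?mulr_gt0// mulr1 /D; lra.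
rewrite (meanZ LamP); last exact: bdK.
rewrite (meanD LamP); [|exact: bdK|exact: bounded_on_cst].
rewrite (mean_cst LamP) RintegralZl//; last exact: intK.
rewrite RintegralD//; [|exact: intK|exact/intK/within_continuous_cst].
rewrite Rintegral_cst// PK1 mulr1 ler_pM2l ?invr_gt0 ?mulr_gt0//.
by rewrite lerD2r.
Qed.

(** The one-sided inequality, used for [g] and for its opposite. *)
Lemma integral_eq_mean (g : T -> R) : {within K, continuous g} ->
  \int[P]_(x in (K : set borelT)) g x = Lam g.
Proof.
move=> cg; apply/le_anti; rewrite mean_le_integral// andbT.
have := mean_le_integral (within_continuousZ (-1) cg).
rewrite (meanZ LamP); last exact: bdK.
by rewrite RintegralZl ?intK// !mulN1r lerN2.
Qed.

End Represented.

Theorem Riesz_mean : exists P : probability borelT R, P (~` K) = 0%E /\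
  forall g, {within K, continuous g} -> \int[P]_(x in (K : set borelT)) g x = Lam g.
Proof.
pose mu := mean_outer_measure coK LamP.
have mu_open U : open U -> mu U = (open_mass Lam U)%:E.
  by move=> oU; exact: (outer_mass_open coK LamP oU).
have [U oU||P PE] := @restrict_outer_probability R T open mu.
- exact: (open_caratheodory coK LamP oU).
- rewrite mu_open; last exact: openT.
  congr EFin; apply/le_anti/andP; split.
    apply: ge_sup (has_sup_open_mass LamP setT).1 _ => _ [n _ <-].
    apply: LamP.2; first exact: bounded_inner.
    by move=> x _; exact: inner_le1.
  rewrite -{1}[1](mean_cst LamP).
  apply: (mean_le_open_mass coK LamP) => //; last exact: openT.
  exact: within_continuous_cst.
(* The complement of the closed set [K] is open, and its inner functions vanish on [K]. *)
have PK : P (~` K) = 0%E.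
  rewrite PE mu_open; last exact: closed_openC.
  by rewrite (open_mass_out LamP)// => x Kx; exact.
exists P; split=> // g; apply: integral_eq_mean => // U oU.
by rewrite PE mu_open.
Qed.

End Riesz.

(** * The duality formula *)

Section BoundedFunctions.
Context (R : realType) (T : Type) (K : set T).

(** Hahn-Banach needs a module as a type. The functions live on all of [T] and are constrained on
    [K] only, to match the domain of [mean_on]. *)
Definition bounded_pred : {pred T -> R^o} := fun f => `[< bounded_on K f >].

Lemma bounded_pred_submod : submod_closed bounded_pred.
Proof.
split; first by apply/asboolP; exact: bounded_on_cst.
move=> a f g /asboolP bf /asboolP bg; apply/asboolP.
exact: (bounded_on_lin a bf bg).
Qed.

HB.instance Definition _ :=
  GRing.isSubmodClosed.Build R (T -> R^o) bounded_pred bounded_pred_submod.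

Definition bounded_fun_on := {f : T -> R^o | f \in bounded_pred}.

HB.instance Definition _ := SubChoice.on bounded_fun_on.
HB.instance Definition _ := [SubChoice_isSubLmodule of bounded_fun_on by <:].

End BoundedFunctions.

Section Minimax.
Context (R : realType) (T : pseudoPMetricType R) (K : set T).
Local Notation borelT := (g_sigma_algebraType (@open T)).
Variables (L : set (T -> R)) (phi : T -> R).
Hypotheses (coK : compact K) (cK : closed K).
Hypotheses (cphi : {within K, continuous phi})
  (cL : forall l, L l -> {within K, continuous l}).
Hypotheses (L0 : L !=set0)
  (LD : forall l m, L l -> L m ->
     exists2 n, L n & forall x, K x -> n x = l x + m x)
  (LZ : forall a l, L l -> exists2 n, L n & forall x, K x -> n x = a * l x)
  (Lge0 : forall l c, L l -> (forall x, K x -> l x <= c) -> 0 <= c).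

(** Upper bounds replace maxima because [g] need only be bounded; the infimum of this set is the
    infimum over [L] of the supremum of [g + l] on [K]. *)
Definition perturbed_bounds (g : T -> R) :=
  [set c | exists2 l, L l & forall x, K x -> g x + l x <= c].

Let p (g : bounded_fun_on R K) : R := inf (perturbed_bounds (val g)).

Let bdd (g : bounded_fun_on R K) : bounded_on K (val g).
Proof. exact/asboolP/(valP g). Qed.

Let has_inf_p g : has_inf (perturbed_bounds (val (g : bounded_fun_on R K))).
Proof.
have [C gC] := bdd g; split.
  have [l Ll] := L0; have [D lD] := continuous_bounded_on coK (cL Ll).
  exists (C + D); exists l => // x Kx.
  by apply: lerD; apply: le_trans (ler_norm _) _; [exact: gC|exact: lD].
(* From [g + l <= c] and [- C <= g] follows [l <= c + C] on [K], and [Lge0] makes that constant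
   nonnegative. *)
exists (- C) => c [l Ll lc]; suff : 0 <= c + C by lra.
apply: (Lge0 Ll) => x Kx; have := lc x Kx; have := gC x Kx.
by rewrite ler_norml => /andP[]; lra.
Qed.

Let p_le g l c : L l -> (forall x, K x -> val (g : bounded_fun_on R K) x + l x <= c) -> p g <= c.
Proof. by move=> Ll h; apply: ge_inf; [exact: (has_inf_p g).2|exists l]. Qed.

Let le_p g c : (forall l d, L l ->
  (forall x, K x -> val (g : bounded_fun_on R K) x + l x <= d) -> c <= d) -> c <= p g.
Proof.
move=> h; apply: lb_le_inf => [|d [l Ll ld]]; first exact: (has_inf_p g).1.
exact: h Ll ld.
Qed.

Let p_sublinear : sublinear p.
Proof.
split=> [f g|a f].
  rewrite -lerBlDr; apply: le_p => l c Ll lc.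
  rewrite lerBlDr -lerBlDl; apply: le_p => m d Lm md; rewrite lerBlDl.
  have [n Ln nE] := LD Ll Lm.
  apply: p_le Ln _ => x Kx; rewrite nE//.
  have -> : val (f + g) x = val f x + val g x by [].
  by have := lc x Kx; have := md x Kx; lra.
rewrite le_eqVlt => /predU1P[<-|a0].
  have [l Ll] := L0; have [n Ln nE] := LZ 0 Ll.
  apply: p_le Ln _ => x Kx; rewrite nE//.
  have -> : val (0 *: f) x = 0 * val f x by [].
  by rewrite !mul0r addr0.
rewrite -ler_pdivrMl//; apply: le_p => l c Ll lc; rewrite ler_pdivrMl//.
have [n Ln nE] := LZ a Ll.
apply: p_le Ln _ => x Kx; rewrite nE//.
have -> : val (a *: f) x = a * val f x by [].
by rewrite -mulrDr ler_pM2l// lc.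
Qed.

Theorem minimax_measure : exists P : probability borelT R,
  [/\ P (~` K) = 0%E,
      forall l, L l -> \int[P]_(x in (K : set borelT)) l x = 0 &
      \int[P]_(x in (K : set borelT)) phi x = inf (perturbed_bounds phi)].
Proof.
have bphi : bounded_on K phi by exact: continuous_bounded_on.
(* Functions unbounded on [K] are sent to 0; [mean_on] never tests them. *)
pose lift (f : T -> R) : bounded_fun_on R K := insubd 0 (f : T -> R^o).
have liftE f : bounded_on K f -> val (lift f) = f.
  by move=> bf; rewrite /lift val_insubd ifT//; exact/asboolP.
have [Lam [LamL Lamp Lamphi]] := Hahn_Banach_sublinear (lift phi) p_sublinear.
have LamZ a x : Lam (a *: x) = a * Lam x.
  have Lam0 : Lam 0 = 0 by have := LamL (-1) 0 0; rewrite scaler0 addr0; lra.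
  by have := LamL a x 0; rewrite !addr0 Lam0 addr0.
have mLam : mean_on K (fun f => Lam (lift f)).
  split=> [a f g bf bg|f c bf fc].
    rewrite -LamL; congr Lam; apply/val_inj; rewrite liftE; last exact: bounded_on_lin.
    by rewrite [RHS](_ : _ = a *: val (lift f) + val (lift g))// !liftE.
  apply: (le_trans (Lamp _)).
  (* The multiple [0 * l] supplies a perturbation that vanishes on [K]. *)
  have [l Ll] := L0; have [n Ln nE] := LZ 0 Ll.
  by apply: p_le Ln _ => x Kx; rewrite liftE// nE// mul0r addr0 fc.
have [P [PK PE]] := Riesz_mean coK cK mLam.
exists P; split => // [l Ll|]; last by rewrite PE// Lamphi /p liftE.
rewrite PE; last exact: cL.
have bl := continuous_bounded_on coK (cL Ll).
(* The perturbation [- a * l] cancels [a * l], so 0 is an admissible bound; the two signs of [a]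
   then force [Lam] to vanish on [l]. *)
have h a : Lam (a *: lift l) <= 0.
  apply: (le_trans (Lamp _)); have [n Ln nE] := LZ (- a) Ll.
  apply: p_le Ln _ => x Kx; rewrite nE//.
  have -> : val (a *: lift l) x = a * val (lift l) x by [].
  by rewrite liftE// mulNr subrr.
by have := h 1; have := h (-1); rewrite !LamZ; lra.
Qed.

End Minimax.

(** * Cutoff functions *)

(** Differentiability is reduced to an inequality, which suits functions defined by cases: the
    squared positive part at its kink, and the flat exponentials at 0. *)
Lemma is_derive_quadratic (R : realType) (f : R -> R) (s d C : R) :
  (forall h, `|h| < 1 -> `|f (s + h) - f s - d * h| <= C * h ^+ 2) ->
  is_derive (s : R) (1 : R) f d.
Proof.
move=> fC.
have C0 : 0 <= C.
  have := fC (1 / 2) _; rewrite ger0_norm; last by lra.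
  move=> /(_ ltac:(lra)) h; have := le_trans (normr_ge0 _) h.
  by rewrite pmulr_lge0// exprn_gt0//; lra.
suff h : h^-1 *: ((f \o shift s) (h *: 1) - f s) @[h --> 0^'] --> d.
  apply: DeriveDef; last exact/cvg_lim.
  by apply/cvg_ex; exists d.
apply/cvgrPdist_le => e e0; near=> h.
have h0 : h != 0 by near: h; exact: nbhs_dnbhs_neq.
have h1 : `|h| < 1.
  near: h; apply: dnbhs0_lt; exact: ltr01.
(* Dividing by [C + 1] rather than [C] covers [C = 0]. *)
have hC : `|h| <= e / (C + 1).
  by near: h; apply: dnbhs0_le; rewrite divr_gt0// ltr_wpDl.
have -> : d - h^-1 *: ((f \o shift s) (h *: 1) - f s) =
    - (h^-1 * (f (s + h) - f s - d * h)).
  have -> : (f \o shift s) (h *: 1) = f (s + h).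
    by rewrite /= -[h *: 1]/(h * 1) mulr1 addrC.
  by rewrite -[h^-1 *: _]/(h^-1 * _); field.
rewrite normrN normrM normfV ler_pdivrMl ?normr_gt0//.
apply: (le_trans (fC _ h1)).
rewrite -real_normK ?num_real// expr2 mulrA mulrC ler_wpM2l//.
apply: (le_trans (ler_wpM2l C0 hC)).
by rewrite mulrA ler_pdivrMr ?ltr_wpDl// mulrC ler_wpM2l ?(ltW e0)// lerDl.
Unshelve. all: by end_near. Qed.

Lemma derive_comp_real (R : realType) (V : normedModType R) (g : V -> R)
    (f : R -> R) (x v : V) d : differentiable g x -> is_derive (g x) 1 f d ->
  differentiable (f \o g) x /\ 'D_v (f \o g) x = d * 'D_v g x.
Proof.
move=> dg [df fd]; have dfx : differentiable f (g x) by exact/derivable1_diffP.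
have dfg : differentiable (f \o g) x by exact: differentiable_comp.
split => //; rewrite deriveE// diff_comp//= deriveE//.
by rewrite diff1E// derive1E fd mulrC.
Qed.

Section SqPos.
Context (R : realType).

Definition sqpos (s : R) : R := (Num.max 0 s) ^+ 2.

Lemma is_derive_sqpos s : is_derive (s : R) (1 : R) sqpos (2 * Num.max 0 s).
Proof.
apply: (@is_derive_quadratic _ _ _ _ 1) => h _; rewrite mul1r ler_norml /sqpos.
case: (leP 0 s) => hs; case: (leP 0 (s + h)) => hsh; apply/andP; split; nra.
Qed.

Lemma continuous_max0 : continuous (fun s : R => 2 * Num.max 0 s).
Proof.
move=> s; apply: cvgMr.
by apply: (@continuous_max _ _ (fun=> 0) id); [exact: cvg_cst|exact: cvg_id].
Qed.

(** A continuously differentiable switch: it is 1 up to [c], where the inner square vanishes, and 0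
    from [c + 1] on, where that square is at least 1. *)
Definition step c (s : R) : R := sqpos (1 - sqpos (s - c)).

Definition step_der c (s : R) : R :=
  2 * Num.max 0 (1 - sqpos (s - c)) * - (2 * Num.max 0 (s - c)).

Lemma is_derive_step c s : is_derive (s : R) (1 : R) (step c) (step_der c s).
Proof.
have h1 : is_derive (s : R) (1 : R) (fun s => s - c) (1 : R).
  by apply: (@is_derive_quadratic _ _ _ _ 0) => h _; rewrite mul0r normr_le0; apply/eqP; ring.
have [d1 e1] : differentiable (fun s => s - c) s /\ 'D_1 (fun s => s - c) s = 1.
  by case: h1 => /derivable1_diffP.
have [d2 e2] := derive_comp_real (1 : R) d1 (is_derive_sqpos (s - c)).
have h3 (t : R) : is_derive t (1 : R) (fun s => 1 - s) (-1 : R).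
  by apply: (@is_derive_quadratic _ _ _ _ 0) => h _; rewrite mul0r normr_le0; apply/eqP; ring.
have [d3 e3] := derive_comp_real (1 : R) d2 (h3 _).
have [d4 e4] := derive_comp_real (1 : R) d3 (is_derive_sqpos _).
apply: DeriveDef; first exact/derivable1_diffP/d4.
by rewrite [LHS]e4 e3 e2 e1 /step_der; ring.
Qed.

Lemma continuous_step_der c : continuous (step_der c).
Proof.
have c1 : continuous (fun s : R => s - c).
  by move=> s; apply: cvgB; [exact: cvg_id|exact: cvg_cst].
have c2 : continuous sqpos.
  move=> s; apply: differentiable_continuous; apply/derivable1_diffP.
  by have [] := is_derive_sqpos s.
move=> s; apply: cvgM; last first.
  by apply: cvgN; exact: (@continuous_comp _ _ _ (fun s => s - c)
    (fun s => 2 * Num.max 0 s) s (c1 s) (@continuous_max0 _)).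
apply: (@continuous_comp _ _ _ (fun s => 1 - sqpos (s - c)) (fun s => 2 * Num.max 0 s));
  last exact: continuous_max0.
apply: cvgB; first exact: cvg_cst.
exact: (@continuous_comp _ _ _ (fun s => s - c) sqpos s (c1 s) (c2 _)).
Qed.

Lemma step1 c s : s <= c -> step c s = 1.
Proof.
move=> sc; rewrite /step /sqpos (max_l _ : Num.max 0 (s - c) = 0) ?subr_le0//.
by rewrite expr0n/= subr0 max_r// expr1n.
Qed.

Lemma step_der0 c s : s <= c -> step_der c s = 0.
Proof.
by move=> sc; rewrite /step_der (max_l _ : Num.max 0 (s - c) = 0) ?subr_le0// mulr0 oppr0 mulr0.
Qed.

Lemma step_supp c s : step c s != 0 -> s <= c + 1.
Proof.
apply: contraNT; rewrite -ltNge => sc; apply/eqP.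
rewrite /step /sqpos max_l ?expr0n// subr_le0 max_r ?subr_ge0; last by lra.
by rewrite exprn_ege1//; lra.
Qed.

End SqPos.

Lemma continuous_addR (R : realType) (T : topologicalType) (f g : T -> R) :
  continuous f -> continuous g -> continuous (fun x => f x + g x).
Proof. by move=> cf cg x; apply: cvgD; [exact: cf|exact: cg]. Qed.

Lemma continuous_mulR (R : realType) (T : topologicalType) (f g : T -> R) :
  continuous f -> continuous g -> continuous (fun x => f x * g x).
Proof. by move=> cf cg x; apply: cvgM; [exact: cf|exact: cg]. Qed.

(** * Continuously differentiable functions of finitely many coordinates *)

Section C1.
Context (R : realType) (m : nat).
Implicit Types (f g : 'rV[R]_m -> R).

Definition C1 f := (forall x, differentiable f x) /\
  forall j : 'I_m, continuous (fun x => 'D_(delta_mx 0 j) f x).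

Lemma C1_cont f : C1 f -> continuous f.
Proof. by move=> [df _] x; exact: differentiable_continuous. Qed.

Lemma C1_cst (c : R) : C1 (fun=> c).
Proof.
split=> [x|j]; first exact: differentiable_cst.
have -> : (fun x : 'rV[R]_m => 'D_(delta_mx 0 j) (fun=> c) x) = (fun=> 0).
  by apply/funext => x; rewrite derive_cst.
exact: cst_continuous.
Qed.

Lemma C1D f g : C1 f -> C1 g -> C1 (fun x => f x + g x).
Proof.
move=> [df cf] [dg cg]; split=> [x|j]; first exact: differentiableD.
have -> : (fun x => 'D_(delta_mx 0 j) (fun x => f x + g x) x) =
    (fun x => 'D_(delta_mx 0 j) f x + 'D_(delta_mx 0 j) g x).
  by apply/funext => x; rewrite deriveD//; exact: diff_derivable.
exact: (continuous_addR (cf j) (cg j)).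
Qed.

Lemma derive_mul f g v x : differentiable f x -> differentiable g x ->
  'D_v (fun x => f x * g x) x = f x * 'D_v g x + g x * 'D_v f x.
Proof. by move=> df dg; rewrite [LHS]deriveM//; exact: diff_derivable. Qed.

Lemma C1M f g : C1 f -> C1 g -> C1 (fun x => f x * g x).
Proof.
move=> C1f C1g; have [df cf] := C1f; have [dg cg] := C1g.
split=> [x|j]; first exact: differentiableM.
under eq_fun do rewrite derive_mul//.
exact: (continuous_addR (continuous_mulR (C1_cont C1f) (cg j))
  (continuous_mulR (C1_cont C1g) (cf j))).
Qed.

Lemma C1_sum (I : Type) (r : seq I) (F : I -> 'rV[R]_m -> R) :
  (forall i, C1 (F i)) -> C1 (fun x => \sum_(i <- r) F i x).
Proof.
move=> CF; elim: r => [|i r ih].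
  by under eq_fun do rewrite big_nil; exact: C1_cst.
by under eq_fun do rewrite big_cons; exact: C1D.
Qed.

Lemma C1_coord k : C1 (fun x => x 0 k).
Proof.
have dl x : differentiable (fun y : 'rV[R]_m => y 0 k) x by exact: differentiable_coord.
split=> [//|j].
have h x : 'D_(delta_mx 0 j) (fun y : 'rV[R]_m => y 0 k) x = (delta_mx 0 j : 'rV[R]_m) 0 k.
  rewrite deriveE//.
  have lf : linear (fun y : 'rV[R]_m => y 0 k : R^o) by move=> a u w; rewrite !mxE.
  pose f : {linear 'rV[R]_m -> R^o} := HB.pack (fun y : 'rV[R]_m => y 0 k : R^o)
    (GRing.isLinear.Build _ _ _ _ _ lf).
  have cf : continuous f by exact: coord_continuous.
  by rewrite -[X in 'd X _]/(f : 'rV[R]_m -> R) (diff_lin _ cf).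
have -> : (fun x => 'D_(delta_mx 0 j) (fun y : 'rV[R]_m => y 0 k) x) =
    (fun=> (delta_mx 0 j : 'rV[R]_m) 0 k) by exact/funext.
exact: cst_continuous.
Qed.

Lemma C1_step c f : C1 f -> C1 (fun x => step c (f x)).
Proof.
move=> C1f; have [df cf] := C1f.
have h j x := derive_comp_real (delta_mx 0 j) (df x) (is_derive_step c (f x)).
split=> [x|j].
  apply: differentiable_comp => //; apply/derivable1_diffP.
  by have [] := is_derive_step c (f x).
have -> : (fun x => 'D_(delta_mx 0 j) (fun x => step c (f x)) x) =
    (fun x => step_der c (f x) * 'D_(delta_mx 0 j) f x).
  by apply/funext => x; rewrite (h j x).2.
apply: continuous_mulR; last exact: (cf j).
move=> x; apply: (@continuous_comp _ _ _ f (step_der c)); first exact: C1_cont.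
exact: continuous_step_der.
Qed.

(** Row vectors carry the maximum norm, which is not differentiable, so the sum of squares is cut
    off instead; [m%:R * B ^+ 2] bounds it on the ball of radius [B]. *)
Definition cutoff B : 'rV[R]_m -> R :=
  fun x => step (m%:R * B ^+ 2) (\sum_(j < m) x 0 j * x 0 j).

Lemma C1_cutoff B : C1 (cutoff B).
Proof.
by apply: C1_step; apply: C1_sum => j; apply: C1M; exact: C1_coord.
Qed.

Lemma coord_norm_le (x : 'rV[R]_m) j : `|x 0 j| <= `|x|.
Proof.
rewrite [leRHS]/Num.norm /= mx_normrE; apply/bigmax_geP; right => /=.
by exists (0, j).
Qed.

Lemma sumsq_le (x : 'rV[R]_m) B : `|x| <= B -> \sum_(j < m) x 0 j * x 0 j <= m%:R * B ^+ 2.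
Proof.
move=> xB; rewrite -[m in m%:R]card_ord -sum1_card natr_sum mulr_suml.
apply: ler_sum => j _; rewrite mul1r -expr2 -real_normK ?num_real//.
have B0 : 0 <= B by exact: le_trans (normr_ge0 x) xB.
by rewrite ler_pXn2r// ?nnegrE// (le_trans (coord_norm_le _ _)).
Qed.

Lemma cutoff1 B x : `|x| <= B -> cutoff B x = 1.
Proof. by move=> xB; rewrite /cutoff step1// sumsq_le. Qed.

Lemma derive_cutoff B x j : `|x| <= B -> 'D_(delta_mx 0 j) (cutoff B) x = 0.
Proof.
move=> xB; have [dq _] : C1 (fun x : 'rV[R]_m => \sum_(j < m) x 0 j * x 0 j).
  by apply: C1_sum => k; apply: C1M; exact: C1_coord.
have := derive_comp_real (delta_mx 0 j) (dq x) (is_derive_step (m%:R * B ^+ 2) _).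
by move=> [_ ->]; rewrite step_der0 ?mul0r// sumsq_le.
Qed.

Lemma cutoff_bounded B : exists C, forall x, cutoff B x != 0 -> `|x| <= C.
Proof.
(* As the constant is at least 1, a square below it has its root below it too. *)
exists (m%:R * B ^+ 2 + 1) => x /step_supp.
set c := m%:R * B ^+ 2 => h.
have c0 : 0 <= c by rewrite mulr_ge0// sqr_ge0.
rewrite [leLHS]/Num.norm /= mx_normrE; apply/bigmax_leP; split => /=; first by lra.
move=> [i j] _ /=; rewrite (ord1 i).
have : x 0 j * x 0 j <= c + 1.
  apply: le_trans h; rewrite (bigD1 j)//= lerDl sumr_ge0// => k _.
  by rewrite -expr2 sqr_ge0.
rewrite -expr2 -real_normK ?num_real//; have := normr_ge0 (x 0 j).
by move: (`|x 0 j|) => t t0 ht; nra.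
Qed.

Lemma compact_supp_bounded f : compact (supp f) -> exists C, forall x, f x != 0 -> `|x| <= C.
Proof.
move=> /compact_bounded[M [_ MP]]; exists (M + 1) => x fx.
by apply: MP; [rewrite ltrDl|exact: subset_closure].
Qed.

Lemma bounded_compact_supp f C : (forall x, f x != 0 -> `|x| <= C) -> compact (supp f).
Proof.
move=> fC; apply: bounded_closed_compact; last exact: closed_closure.
have sub : supp f `<=` [set x | `|x| <= C].
  have /closure_id -> : closed [set x : 'rV[R]_m | `|x| <= C].
    apply: (@closed_comp _ _ (fun x : 'rV[R]_m => `|x|) [set y | y <= C]).
      by move=> x _; exact: norm_continuous.
    exact: closed_le.
  exact: closureS.
exists C; split; first exact: num_real.
by move=> D CD x /sub /= xC; apply: le_trans xC (ltW CD).
Qed.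

End C1.

Section Glue.
Context (R : realType) (m n : nat).

Lemma derive_lsub (f : 'rV[R]_m -> R) z (v : 'rV[R]_(m + n)) :
  (forall x, differentiable f x) ->
  differentiable (f \o lsubmx) z /\ 'D_v (f \o lsubmx) z = 'D_(lsubmx v) f (lsubmx z).
Proof.
move=> df; have dl := @differentiable_lsubmx R 1 m n z.
have dfl : differentiable (f \o lsubmx) z by exact: differentiable_comp.
split=> //; rewrite deriveE// diff_comp//= deriveE//.
by rewrite diff_lin//; exact: continuous_lsubmx.
Qed.

Lemma derive_rsub (f : 'rV[R]_n -> R) z (v : 'rV[R]_(m + n)) :
  (forall x, differentiable f x) ->
  differentiable (f \o rsubmx) z /\ 'D_v (f \o rsubmx) z = 'D_(rsubmx v) f (rsubmx z).
Proof.
move=> df; have dl := @differentiable_rsubmx R 1 m n z.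
have dfl : differentiable (f \o rsubmx) z by exact: differentiable_comp.
split=> //; rewrite deriveE// diff_comp//= deriveE//.
by rewrite diff_lin//; exact: continuous_rsubmx.
Qed.

Lemma lsub_delta_l (j : 'I_m) : lsubmx (delta_mx 0 (lshift n j)) = delta_mx 0 j :> 'rV[R]_m.
Proof. by apply/rowP => k; rewrite !mxE !eqxx/= (inj_eq (@lshift_inj _ _)). Qed.

Lemma lsub_delta_r (j : 'I_n) : lsubmx (delta_mx 0 (rshift m j)) = 0 :> 'rV[R]_m.
Proof. by apply/rowP => k; rewrite !mxE !eqxx/= eq_lrshift. Qed.

Lemma rsub_delta_l (j : 'I_m) : rsubmx (delta_mx 0 (lshift n j)) = 0 :> 'rV[R]_n.
Proof. by apply/rowP => k; rewrite !mxE !eqxx/= eq_rlshift. Qed.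

Lemma rsub_delta_r (j : 'I_n) : rsubmx (delta_mx 0 (rshift m j)) = delta_mx 0 j :> 'rV[R]_n.
Proof. by apply/rowP => k; rewrite !mxE !eqxx/= (inj_eq (@rshift_inj _ _)). Qed.

Lemma C1_lsub (f : 'rV[R]_m -> R) : C1 f -> C1 (fun z : 'rV_(m + n) => f (lsubmx z)).
Proof.
move=> [df cf]; split=> [z|k]; first exact: (derive_lsub z 0 df).1.
have -> : (fun z : 'rV[R]_(m + n) => 'D_(delta_mx 0 k) (fun z => f (lsubmx z)) z) =
    (fun x => 'D_(lsubmx (delta_mx 0 k : 'rV[R]_(m + n))) f x) \o lsubmx.
  by apply/funext => z; exact: (derive_lsub z _ df).2.
move=> z; apply: continuous_comp; first exact: continuous_lsubmx.
case: (split_ordP k) => j ->; rewrite ?lsub_delta_l ?lsub_delta_r.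
  exact: (cf j).
rewrite (_ : (fun _ => _) = fun=> 0); first exact: cst_continuous.
by apply/funext => x; rewrite derive0.
Qed.

Lemma C1_rsub (f : 'rV[R]_n -> R) : C1 f -> C1 (fun z : 'rV_(m + n) => f (rsubmx z)).
Proof.
move=> [df cf]; split=> [z|k]; first exact: (derive_rsub z 0 df).1.
have -> : (fun z : 'rV[R]_(m + n) => 'D_(delta_mx 0 k) (fun z => f (rsubmx z)) z) =
    (fun x => 'D_(rsubmx (delta_mx 0 k : 'rV[R]_(m + n))) f x) \o rsubmx.
  by apply/funext => z; exact: (derive_rsub z _ df).2.
move=> z; apply: continuous_comp; first exact: continuous_rsubmx.
case: (split_ordP k) => j ->; rewrite ?rsub_delta_l ?rsub_delta_r; last exact: (cf j).
rewrite (_ : (fun _ => _) = fun=> 0); first exact: cst_continuous.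
by apply/funext => x; rewrite derive0.
Qed.

(* The sum of two compactly supported functions of separate variables is not
   compactly supported; it is cut off away from the region of interest. *)
Lemma C1c_glue (f : 'rV[R]_m -> R) (g : 'rV[R]_n -> R) B : C1c f -> C1c g ->
  exists2 h : 'rV[R]_(m + n) -> R, C1c h &
    forall z, `|lsubmx z| <= B -> `|rsubmx z| <= B ->
      (forall j, 'D_(delta_mx 0 (lshift n j)) h z = 'D_(delta_mx 0 j) f (lsubmx z)) /\
      (forall j, 'D_(delta_mx 0 (rshift m j)) h z = 'D_(delta_mx 0 j) g (rsubmx z)).
Proof.
move=> [df cf sf] [dg cg sg].
have C1f : C1 f by []; have C1g : C1 g by [].
pose F (z : 'rV[R]_(m + n)) := f (lsubmx z); pose G (z : 'rV[R]_(m + n)) := g (rsubmx z).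
pose cF (z : 'rV[R]_(m + n)) := cutoff B (lsubmx z).
pose cG (z : 'rV[R]_(m + n)) := cutoff B (rsubmx z).
have [C1F C1G] : C1 F /\ C1 G by split; [exact: C1_lsub|exact: C1_rsub].
have C1cF : C1 cF by apply: C1_lsub; exact: C1_cutoff.
have C1cG : C1 cG by apply: C1_rsub; exact: C1_cutoff.
(* Each function is cut off in the variables of the other. Where both cutoffs are 1 with zero
   derivatives, the product rule returns the original partial derivatives. *)
pose h z := cG z * F z + cF z * G z.
have C1h : C1 h by apply: C1D; exact: C1M.
have Dh v z : 'D_v h z = cG z * 'D_v F z + F z * 'D_v cG z +
    (cF z * 'D_v G z + G z * 'D_v cF z).
  rewrite -!derive_mul; try by move: z; case: C1F C1G C1cF C1cG => ? _ [? _] [? _] [? _].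
  rewrite [LHS]deriveD//; apply: diff_derivable; apply: differentiableM;
    by move: z; case: C1F C1G C1cF C1cG => ? _ [? _] [? _] [? _].
exists h => [|z zl zr].
  split; [exact: C1h.1|exact: C1h.2|].
  have [[a fa] [b gb]] := (compact_supp_bounded sf, compact_supp_bounded sg).
  have [[c hc] [d hd]] := (cutoff_bounded m B, cutoff_bounded n B).
  apply: (@bounded_compact_supp _ _ _ (`|a| + `|b| + `|c| + `|d|)) => z hz.
  (* One of the two products is nonzero at [z], and either one bounds both blocks of [z]. *)
  have [lz rz] : `|lsubmx z| <= `|a| + `|b| + `|c| + `|d| /\
      `|rsubmx z| <= `|a| + `|b| + `|c| + `|d|.
    have := (ler_norm a, ler_norm b, ler_norm c, ler_norm d) => -[[[na nb] nc] nd].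
    have := (normr_ge0 a, normr_ge0 b, normr_ge0 c, normr_ge0 d) => -[[[pa pb] pc] pd].
    have [e|e] := eqVneq (cG z * F z) 0.
      have : cF z * G z != 0 by move: hz; rewrite /h e add0r.
      rewrite mulf_eq0 negb_or => /andP[/hc h1 /gb h2]; split; lra.
    move: e; rewrite mulf_eq0 negb_or => /andP[/hd h1 /fa h2]; split; lra.
  rewrite [leLHS]/Num.norm /= mx_normrE; apply/bigmax_leP; split => /=.
    by rewrite !addr_ge0.
  move=> [i j] _ /=; rewrite (ord1 i); case: (split_ordP j) => k ->.
    by apply: le_trans lz; rewrite (_ : z _ _ = lsubmx z 0 k) ?coord_norm_le// mxE.
  by apply: le_trans rz; rewrite (_ : z _ _ = rsubmx z 0 k) ?coord_norm_le// mxE.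
have cF1 : cF z = 1 by exact: cutoff1.
have cG1 : cG z = 1 by exact: cutoff1.
split=> j; rewrite Dh cF1 cG1 !mul1r.
  rewrite (derive_lsub z _ df).2 (derive_rsub z _ dg).2.
  rewrite (derive_lsub z _ (C1_cutoff m B).1).2 (derive_rsub z _ (C1_cutoff n B).1).2.
  by rewrite lsub_delta_l rsub_delta_l !derive0 derive_cutoff// !mulr0 !addr0.
rewrite (derive_lsub z _ df).2 (derive_rsub z _ dg).2.
rewrite (derive_lsub z _ (C1_cutoff m B).1).2 (derive_rsub z _ (C1_cutoff n B).1).2.
by rewrite lsub_delta_r rsub_delta_r !derive0 derive_cutoff// !mulr0 !addr0 add0r.
Qed.

End Glue.

Lemma C1c_scale (R : realType) m a (f : 'rV[R]_m -> R) : C1c f ->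
  C1c (fun x => a * f x) /\
  forall v x, 'D_v (fun x => a * f x) x = a * 'D_v f x.
Proof.
move=> [df cf sf].
have C1cst : C1 (fun _ : 'rV[R]_m => a) by exact: C1_cst.
have Dh v x : 'D_v (fun x => a * f x) x = a * 'D_v f x.
  rewrite derive_mul; [|exact: C1cst.1|exact: df].
  by rewrite derive_cst mulr0 addr0.
have [h1 h2] : C1 (fun x => a * f x) by exact: (C1M C1cst (conj df cf)).
split=> //; split=> //.
have [C fC] := compact_supp_bounded sf.
apply: (@bounded_compact_supp _ _ _ C) => x.
by rewrite mulf_eq0 negb_or => /andP[_ /fC].
Qed.

(** * The fundamental lemma of the calculus of variations *)

Section FlatExponential.
Context (R : realType).
Implicit Types (t : R) (k n : nat).

(* The products of [t^-k] with the flat function exp(-1/t); derivation maps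
   their linear span to itself. *)
Definition flat_exp k t : R := if 0 < t then expR (- t^-1) * t^-1 ^+ k else 0.

Lemma flat_exp_le0 k t : t <= 0 -> flat_exp k t = 0.
Proof. by rewrite /flat_exp ltNge => ->. Qed.

Lemma flat_exp_ge0 k t : 0 <= flat_exp k t.
Proof.
by rewrite /flat_exp; case: ifPn => // t0; rewrite mulr_ge0 ?expR_ge0// exprn_ge0// invr_ge0 ltW.
Qed.

(** The term of order k + 2 in the exponential series at [t^-1] absorbs [t^-1 ^+ k] and leaves the
    factor [t ^+ 2] that [is_derive_quadratic] needs at 0. *)
Lemma flat_exp_quadratic k t : flat_exp k t <= k.+2`!%:R * t ^+ 2.
Proof.
rewrite /flat_exp; case: ifPn => [t0|_]; last by rewrite mulr_ge0// sqr_ge0.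
have s0 : 0 <= t^-1 by rewrite invr_ge0 ltW.
have := expR_ge1Dxn k.+1 s0 => h.
have f0 : 0 < k.+2`!%:R :> R by rewrite ltr0n fact_gt0.
have {}h : t^-1 ^+ k.+2 <= k.+2`!%:R * expR t^-1.
  by rewrite -ler_pdivrMl// mulrC; apply: le_trans h; rewrite lerDr.
rewrite expRN ler_pdivrMl ?expR_gt0//.
have -> : t^-1 ^+ k = t^-1 ^+ k.+2 * t ^+ 2.
  by rewrite -addn2 exprD -mulrA -exprMn mulVf ?gt_eqF// expr1n mulr1.
by rewrite [leRHS](mulrA _ _ (t ^+ 2)) ler_wpM2r ?sqr_ge0// mulrC.
Qed.

Lemma is_derive_flat_exp k t :
  is_derive t 1 (flat_exp k) (flat_exp k.+2 t - k%:R * flat_exp k.+1 t).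
Proof.
have [t0|t0|t0] := ltgtP t 0.
- rewrite !flat_exp_le0 ?ltW// mulr0 subr0.
  apply: (@near_eq_is_derive _ _ _ (fun=> 0)).
  near=> s; rewrite flat_exp_le0// ltW//; near: s; exact: lt_nbhsl.
- pose f s : R := expR (- s^-1) * s^-1 ^+ k.
  have ff : \near t, f t = flat_exp k t.
    by near=> s; rewrite /flat_exp ifT//; near: s; exact: lt_nbhsr.
  apply: (near_eq_is_derive ff).
  have tn0 : t != 0 by rewrite gt_eqF.
  have dinv : is_derive t 1 (fun s : R => s^-1) (- t ^- 2).
    apply: DeriveDef; first exact: derivableV.
    by rewrite deriveV// derive_id -[_ *: _]/(_ * _) mulr1.
  (* In the variable [u = s^-1] the function is an exponential times a power; the chain rule factor
     [- t ^- 2] then raises the index by two or by one. *)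
  have dF (u : R) : is_derive u 1 (fun u : R => expR (- u) * u ^+ k)
      (expR (- u) * (k%:R * u ^+ k.-1) - u ^+ k * expR (- u)).
    have dN : is_derive u 1 (fun u : R => - u) (-1 : R).
      apply: (@is_derive_quadratic _ _ _ _ 0) => h _.
      by rewrite mul0r normr_le0; apply/eqP; ring.
    have [d1 d1E] : differentiable (fun u : R => - u) u /\ 'D_1 (fun u : R => - u) u = -1.
      by case: dN => /derivable1_diffP.
    have [d2 d2E] := derive_comp_real (1 : R) d1 (is_derive_expR (- u)).
    have d3 : derivable (fun u : R => u ^+ k) u 1 by exact: exprn_derivable.
    have d2' : derivable (fun u : R => expR (- u)) u 1 by exact/derivable1_diffP.
    apply: DeriveDef; first exact: derivableM.
    rewrite [LHS]deriveM// exp_derive d2E d1E.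
    rewrite -![_ *: _]/(_ * _); ring.
  have [d1 d1E] : differentiable (fun s : R => s^-1) t /\ 'D_1 (fun s : R => s^-1) t = - t ^- 2.
    by case: dinv => /derivable1_diffP.
  have [d2 d2E] := derive_comp_real (1 : R) d1 (dF _).
  apply: DeriveDef; first exact/derivable1_diffP/d2.
  rewrite [LHS]d2E d1E /flat_exp t0 -exprVn; move: (expR (- t^-1)) (t^-1) => e u.
  by clear; case: k => [|k] /=; rewrite !exprS; ring.
- rewrite t0 !flat_exp_le0// mulr0 subr0.
  apply: (@is_derive_quadratic _ _ _ _ k.+2`!%:R) => h _.
  rewrite add0r (flat_exp_le0 k (lexx 0)) mul0r !subr0.
  by rewrite ger0_norm ?flat_exp_ge0 ?flat_exp_quadratic.
Unshelve. all: by end_near. Qed.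

End FlatExponential.

(** * Smooth bump functions on boxes *)

Section Bump.
Context (R : realType).
Local Notation E := (space3 R).

Definition affine3 (l : E -> R) := exists d : 'I_3 -> R,
  forall x, differentiable l x /\ forall j, partial j l x = d j.

(* Smoothness is proved by membership in an algebra of differentiable functions
   that is stable under partial derivatives. *)
Inductive elementary : (E -> R) -> Prop :=
| elementary_flat k l : affine3 l -> elementary (fun x => flat_exp k (l x))
| elementary_cst c : elementary (fun=> c)
| elementary_add f g : elementary f -> elementary g -> elementary (fun x => f x + g x)
| elementary_mul f g : elementary f -> elementary g -> elementary (fun x => f x * g x).

Lemma elementary_differentiable f : elementary f -> forall x, differentiable f x.
Proof.
elim=> [k l [d ld]|c|g h _ dg _ dh|g h _ dg _ dh] x.
- exact: (derive_comp_real 0 (ld x).1 (is_derive_flat_exp k (l x))).1.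
- exact: differentiable_cst.
- exact: differentiableD.
- exact: differentiableM.
Qed.

Lemma elementary_partial f j : elementary f -> elementary (partial j f).
Proof.
elim=> [k l [d ld]|c|g h eg dg eh dh|g h eg dg eh dh].
- have -> : partial j (fun x => flat_exp k (l x)) =
      (fun x => d j * (flat_exp k.+2 (l x) + - k%:R * flat_exp k.+1 (l x))).
    apply/funext => x; have [dl lE] := ld x.
    have [_ h] := derive_comp_real (basis3 R j) dl (is_derive_flat_exp k (l x)).
    by rewrite [LHS]h -/(partial j l x) lE mulrC mulNr.
  apply: elementary_mul; first exact: elementary_cst.
  apply: elementary_add; first by apply: elementary_flat; exists d.
  by apply: elementary_mul; [exact: elementary_cst|apply: elementary_flat; exists d].
- rewrite (_ : partial j _ = fun=> 0); first exact: elementary_cst.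
  by apply/funext => x; rewrite /partial derive_cst.
- have -> : partial j (fun x => g x + h x) = (fun x => partial j g x + partial j h x).
    apply/funext => x; rewrite /partial [LHS]deriveD//;
      exact/diff_derivable/elementary_differentiable.
  exact: elementary_add.
- have -> : partial j (fun x => g x * h x) =
      (fun x => g x * partial j h x + h x * partial j g x).
    apply/funext => x; rewrite /partial [LHS]deriveM//;
      exact/diff_derivable/elementary_differentiable.
  by apply: elementary_add; exact: elementary_mul.
Qed.

Lemma elementary_smooth f : elementary f -> smooth f.
Proof.
move=> ef s; apply: elementary_differentiable.
by elim: s => //= j s; exact: elementary_partial.
Qed.

Definition coord3 (i : 'I_3) : E -> R :=
  if i == 0 :> nat then fst \o fst else if i == 1 :> nat then snd \o fst else snd.

Lemma continuous_coord3 i : continuous (coord3 i).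
Proof.
rewrite /coord3; case: ifP => _; last case: ifP => _; move=> x.
- by apply: (@continuous_comp _ _ _ (fst : E -> _) fst); [exact: cvg_fst|exact: cvg_fst].
- by apply: (@continuous_comp _ _ _ (fst : E -> _) snd); [exact: cvg_fst|exact: cvg_snd].
- exact: cvg_snd.
Qed.

Lemma affine_coord3 i a b : affine3 (fun x => a * coord3 i x + b).
Proof.
have lc : linear (coord3 i : E -> R^o).
  by rewrite /coord3 => c x y; case: ifP => _; last case: ifP => _.
pose f : {linear E -> R^o} := HB.pack (coord3 i : E -> R^o)
  (GRing.isLinear.Build _ _ _ _ _ lc).
have cf : continuous f by exact: continuous_coord3.
have dc x : differentiable (coord3 i) x by exact: (@linear_differentiable _ _ _ f).
exists (fun j => a * coord3 i (basis3 R j)) => x.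
have d1 : differentiable (fun x => a * coord3 i x) x.
  by apply: (differentiableM (differentiable_cst _ _)).
split; first by apply: differentiableD.
move=> j; rewrite /partial [LHS]deriveD//; try exact: diff_derivable.
rewrite derive_cst addr0 [LHS](deriveZ _ _)//; last exact: diff_derivable.
by rewrite deriveE//; rewrite -[X in 'd X _]/(f : E -> R) diff_lin.
Qed.

Lemma forall3P (P : 'I_3 -> Prop) :
  (forall i, P i) <-> [/\ P (@Ordinal 3 0 isT), P (@Ordinal 3 1 isT) & P (@Ordinal 3 2 isT)].
Proof.
split=> [h|[h0 h1 h2] [[|[|[|//]]] i3]]; first by split.
- by rewrite (_ : Ordinal i3 = @Ordinal 3 0 isT)//; exact/val_inj.
- by rewrite (_ : Ordinal i3 = @Ordinal 3 1 isT)//; exact/val_inj.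
- by rewrite (_ : Ordinal i3 = @Ordinal 3 2 isT)//; exact/val_inj.
Qed.

Definition box (a b : E) := [set x | forall i, coord3 i a < coord3 i x < coord3 i b].
Definition cbox (a b : E) := [set x | forall i, coord3 i a <= coord3 i x <= coord3 i b].

Lemma open_box a b : open (box a b).
Proof.
pose A i := coord3 i @^-1` [set t | coord3 i a < t < coord3 i b].
have oA i : open (A i).
  apply: open_comp; first by move=> x _; exact: continuous_coord3.
  have -> : [set t | coord3 i a < t < coord3 i b] = `]coord3 i a, coord3 i b[%classic.
    by apply/seteqP; split=> t /=; rewrite in_itv.
  exact: itv_open.
have -> : box a b = A (@Ordinal 3 0 isT) `&` A (@Ordinal 3 1 isT) `&` A (@Ordinal 3 2 isT).
  by apply/seteqP; split=> x; [move=> /forall3P[]|move=> [[? ?] ?]; exact/forall3P].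
by apply: openI => //; exact: openI.
Qed.

Lemma compact_cbox a b : compact (cbox a b).
Proof.
have -> : cbox a b = (`[a.1.1, b.1.1] `*` `[a.1.2, b.1.2]) `*` `[a.2, b.2].
  apply/seteqP; split=> x /=; rewrite !in_itv /=.
    by move=> /forall3P[h0 h1 h2].
  by move=> [[h0 h1] h2]; apply/forall3P; split.
by apply: compact_setX; [apply: compact_setX|]; exact: segment_compact.
Qed.

Lemma closed_cbox a b : closed (cbox a b).
Proof. by apply: compact_closed; [exact: norm_hausdorff|exact: compact_cbox]. Qed.

(** The factor [n.+1%:R] inside the flat exponentials drives them to 1 at each point of the open box
    without enlarging the support, so the limit is the indicator of [box a b]. *)
Definition bump (a b : E) n (x : E) : R := \prod_(i < 3)
  (flat_exp 0 (n.+1%:R * (coord3 i x - coord3 i a)) *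
   flat_exp 0 (n.+1%:R * (coord3 i b - coord3 i x))).

Lemma elementary_prod (I : Type) (r : seq I) (F : I -> E -> R) :
  (forall i, elementary (F i)) -> elementary (fun x => \prod_(i <- r) F i x).
Proof.
move=> eF; elim: r => [|i r ih].
  rewrite (_ : (fun _ => _) = fun=> 1); first exact: elementary_cst.
  by apply/funext => x; rewrite big_nil.
rewrite (_ : (fun _ => _) = fun x => F i x * \prod_(j <- r) F j x).
  exact: elementary_mul.
by apply/funext => x; rewrite big_cons.
Qed.

Lemma elementary_bump a b n : elementary (bump a b n).
Proof.
apply: elementary_prod => i; apply: elementary_mul; apply: elementary_flat.
  rewrite (_ : (fun _ => _) = fun x => n.+1%:R * coord3 i x + - (n.+1%:R * coord3 i a)).
    exact: affine_coord3.
  by apply/funext => x; ring.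
rewrite (_ : (fun _ => _) = fun x => - n.+1%:R * coord3 i x + n.+1%:R * coord3 i b).
  exact: affine_coord3.
by apply/funext => x; ring.
Qed.

Lemma flat_exp0_le1 (t : R) : flat_exp 0 t <= 1.
Proof.
rewrite /flat_exp; case: ifP => [t0|_]; last exact: ler01.
by rewrite mulr1 expR_le1 oppr_le0 invr_ge0 ltW.
Qed.

Lemma bump_ge0_le1 a b n x : 0 <= bump a b n x <= 1.
Proof.
rewrite /bump; apply: (big_ind (fun y => 0 <= y <= 1)) => [|y z|i _].
- by rewrite ler01 lexx.
- by move=> /andP[y0 y1] /andP[z0 z1]; rewrite mulr_ge0//= mulr_ile1.
- by rewrite mulr_ge0 ?flat_exp_ge0//= mulr_ile1 ?flat_exp_ge0 ?flat_exp0_le1.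
Qed.

Lemma bump_out a b n x : ~ box a b x -> bump a b n x = 0.
Proof.
move=> /existsNP[i]; move/negP; rewrite negb_and -!leNgt => h.
rewrite /bump (bigD1 i)//= -[RHS](mul0r (\prod_(j < 3 | j != i)
  (flat_exp 0 (n.+1%:R * (coord3 j x - coord3 j a)) *
   flat_exp 0 (n.+1%:R * (coord3 j b - coord3 j x))))); congr (_ * _).
by case/orP: h => h; [rewrite [X in X * _]flat_exp_le0 ?mul0r|
  rewrite [X in _ * X]flat_exp_le0 ?mulr0]; rewrite // pmulr_rle0// subr_le0.
Qed.

Lemma cvg_flat_exp (t : R) : 0 < t -> flat_exp 0 (n.+1%:R * t) @[n --> \oo] --> (1 : R).
Proof.
move=> t0; have -> : (fun n => flat_exp 0 (n.+1%:R * t)) = (fun n => expR (- (n.+1%:R^-1 * t^-1))).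
  by apply/funext => n; rewrite /flat_exp ifT ?mulr_gt0// mulr1 invfM.
have h : (- (n.+1%:R^-1 * t^-1)) @[n --> \oo] --> (- (0 * t^-1) : R).
  by apply: cvgN; apply: cvgMl; exact: cvg_harmonic.
rewrite mul0r oppr0 in h; rewrite -[X in _ --> X]expR0.
by apply: continuous_cvg; [exact: continuous_expR|exact: h].
Qed.

Lemma cvg_bump a b x : box a b x -> bump a b n x @[n --> \oo] --> (1 : R).
Proof.
move=> abx; have -> : 1 = \prod_(i < 3) 1 :> R by rewrite big1_eq.
apply: cvg_big => [|i _]; first exact: mul_continuous.
rewrite -[X in _ --> X]mulr1; have /andP[h1 h2] := abx i.
by apply: cvgM; apply: cvg_flat_exp; rewrite subr_gt0.
Qed.

Lemma test_bump (Om : smooth_domain R) a b n : cbox a b `<=` dom Om -> test_fun Om (bump a b n).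
Proof.
move=> abO; have sub : supp (bump a b n) `<=` cbox a b.
  have /closure_id -> := @closed_cbox a b; apply: closureS => x /= /eqP nz i.
  have /(_ i)/andP[h1 h2] : box a b x by apply: contrapT => /bump_out.
  by rewrite !ltW.
split; first exact/elementary_smooth/elementary_bump.
  by apply: subclosed_compact sub; [exact: closed_closure|exact: compact_cbox].
exact: subset_trans abO.
Qed.

End Bump.

(** The sets whose preimage has integral zero over [C] form a Dynkin class, by integrability of [f].
    The map [p] singles out one factor of the space, while [C] holds the constraints on the others
    fixed. *)
Lemma dynkin_integral0 d d' (S : measurableType d) (T : measurableType d')
    (R : realType) (mu : {measure set S -> \bar R}) (f : S -> \bar R)
    (p : S -> T) (G : set (set T)) (C : set S) :
  mu.-integrable setT f -> measurable_fun setT p -> measurable C ->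
  @measurable _ T = <<s G >> -> setI_closed G ->
  (\int[mu]_(x in C) f x = 0)%E ->
  (forall A, G A -> (\int[mu]_(x in p @^-1` A `&` C) f x = 0)%E) ->
  forall A, measurable A -> (\int[mu]_(x in p @^-1` A `&` C) f x = 0)%E.
Proof.
move=> intf mp mC mG GI C0 G0 A; rewrite mG.
have mpA B : measurable B -> measurable (p @^-1` B `&` C).
  by move=> mB; apply: measurableI => //; rewrite -[X in measurable X]setTI; exact: mp.
apply: (@dynkin_induction _ _ G
  (fun B => (\int[mu]_(x in p @^-1` B `&` C) f x = 0)%E) mG GI) => //.
- by rewrite preimage_setT setTI.
- move=> B mB B0; have : (\int[mu]_(x in C) f x =
      \int[mu]_(x in p @^-1` B `&` C) f x + \int[mu]_(x in p @^-1` (~` B) `&` C) f x)%E.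
    rewrite -integral_setU//.
    + by congr (integral _ _ _); rewrite -setIUl -preimage_setU setUv preimage_setT setTI.
    + exact: mpA.
    + by apply: mpA; exact: measurableC.
    + apply: measurable_funTS; exact: measurable_int intf.
    + by apply/disj_setPS => x [[Bx _] [nBx _]]; exact: nBx.
  by rewrite C0 B0 add0e => <-.
- move=> F mF tF F0; rewrite preimage_bigcup setI_bigcupl integral_bigcup.
  + by apply: eseries0 => i _ _; exact: F0.
  + apply/trivIsetP => i j _ _ ij.
    rewrite setIACA -preimage_setI (proj1 (trivIsetP) tF)//.
    by rewrite preimage_set0 set0I.
  + by move=> k; exact: mpA.
  + apply: integrableS intf => //; apply: bigcup_measurable => k _; exact: mpA.
Qed.

(** * Integrable functions orthogonal to all test functions *)

Section Fundamental.
Context (R : realType) (Om : smooth_domain R).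
Local Notation E := (space3 R).
Local Notation vol := (vol Om).
Variable G : E -> R.
Hypothesis intG : vol.-integrable setT (EFin \o G).
Hypothesis testG : forall g, test_fun Om g -> \int[vol]_x (G x * g x) = 0.

Lemma measurable_box (a b : E) : measurable (box a b).
Proof. by apply: open_measurable3; exact: open_box. Qed.

(** Dominated convergence along the bump functions, which are test functions because the closed box
    lies in the domain. *)
Lemma box_integral0 (a b : E) : cbox a b `<=` dom Om ->
  (\int[vol]_(x in box a b) (G x)%:E = 0)%E.
Proof.
move=> abO; have mG : measurable_fun setT G by apply/measurable_EFinP; exact: measurable_int intG.
have mb n : measurable_fun setT (bump a b n).
  by apply: continuous_measurable3 => x;
    exact/differentiable_continuous/elementary_differentiable/elementary_bump.
pose f n x := (G x * bump a b n x)%:E.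
have fb n : (\int[vol]_x f n x = 0)%E.
  have := testG (test_bump n abO); rewrite /Rintegral => h.
  rewrite -[LHS]fineK ?[X in X%:E]h//.
  have : vol.-integrable setT (f n).
    apply: le_integrable intG => //; first exact/measurable_EFinP/measurable_funM.
    move=> x _; rewrite lee_fin normrM; have /andP[h0 h1] := bump_ge0_le1 a b n x.
    by rewrite (ger0_norm h0) ler_piMr.
  by move=> /integrable_fin_num; apply.
have mB : measurable (box a b) by exact: measurable_box.
have [|||||_ _] := @dominated_convergence _ _ _ vol setT measurableT f
    ((EFin \o G) \_ (box a b)) (fun x => `|G x|%:E).
- by move=> n; exact/measurable_EFinP/measurable_funM.
- by apply/(measurable_restrictT _ _).1 => //; exact/measurable_EFinP/measurable_funTS.
- apply: aeW => x _; rewrite patchE; case: ifPn => [/set_mem xB|/negP xB].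
    apply: cvg_EFin; first exact: nearW.
    rewrite -[X in _ --> X]mulr1; apply: cvgMr; exact: cvg_bump.
  have -> : f ^~ x = (fun=> 0%E).
    by apply/funext => n; rewrite /f bump_out ?mulr0// => /mem_set.
  exact: cvg_cst.
- exact: (integrable_abse intG).
- apply: aeW => x n _; rewrite lee_fin normrM; have /andP[h0 h1] := bump_ge0_le1 a b n x.
  by rewrite (ger0_norm h0) ler_piMr.
under eq_fun do rewrite fb.
by rewrite -integral_mkcond => h; rewrite (cvg_unique _ h (cvg_cst _)).
Qed.

Let RG_setI : setI_closed (@RGenOInfty.G R).
Proof.
move=> _ _ [x ->] [y ->]; exists (Num.max x y).
by apply/seteqP; split=> t /=; rewrite !in_itv/= !andbT gt_max; [move=> [-> ->]|move=> /andP[]].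
Qed.

Let measurable_fst3 : measurable_fun setT (fun x : E => x.1.1).
Proof. by apply: (measurableT_comp (@measurable_fst _ _ _ _)); exact: measurable_fst. Qed.

Let measurable_snd3 : measurable_fun setT (fun x : E => x.1.2).
Proof. by apply: (measurableT_comp (@measurable_snd _ _ _ _)); exact: measurable_fst. Qed.

Let measurable_thd3 : measurable_fun setT (fun x : E => x.2).
Proof. exact: measurable_snd. Qed.

(** The product sigma-algebra is generated by rectangles with measurable sides, not directly by
    boxes. Rays are therefore replaced by measurable sets one coordinate at a time, and the two
    levels of the nested product are treated last. *)
Lemma box_subset_integral0 (a b : E) : cbox a b `<=` dom Om ->
  forall A : set E, measurable A -> (\int[vol]_(x in A `&` box a b) (G x)%:E = 0)%E.
Proof.
move=> abO.
have mB : measurable (box a b) by exact: measurable_box.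
pose Q (A1 A2 A3 : set R) :=
  (\int[vol]_(x in ((A1 `*` A2) `*` A3) `&` box a b) (G x)%:E = 0)%E.
have mR : @measurable _ (measurableTypeR R) = <<s @RGenOInfty.G R >>.
  exact: RGenOInfty.measurableE.
have mray c : measurable (`]c, +oo[%classic : set (measurableTypeR R)).
  exact: measurable_itv.
have base c1 c2 c3 : Q `]c1, +oo[%classic `]c2, +oo[%classic `]c3, +oo[%classic.
  (* A box cut by an octant is again a box, with its lower corner raised. *)
  pose a' : E := ((Num.max a.1.1 c1, Num.max a.1.2 c2), Num.max a.2 c3).
  rewrite /Q (_ : _ `&` _ = box a' b).
    apply: box_integral0; apply: subset_trans abO.
    move=> x /forall3P[/= /andP[h1 h1'] /andP[h2 h2'] /andP[h3 h3']].
    move: h1 h2 h3; rewrite !ge_max => /andP[h1 _] /andP[h2 _] /andP[h3 _].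
    by apply/forall3P; split=> /=; apply/andP.
  apply/seteqP; split=> x /=; rewrite !in_itv/= !andbT.
    move=> [[[k1 k2] k3] /forall3P[/= /andP[h1 h1'] /andP[h2 h2'] /andP[h3 h3']]].
    by apply/forall3P; split=> /=; rewrite gt_max ?h1 ?h2 ?h3/=; apply/andP.
  move=> /forall3P[/=]; rewrite !gt_max => /andP[/andP[h1 k1] h1'].
  move=> /andP[/andP[h2 k2] h2'] /andP[/andP[h3 k3] h3'].
  by split=> //; apply/forall3P; split=> /=; apply/andP.
have inbox x : box a b x -> [/\ a.1.1 < x.1.1, a.1.2 < x.1.2 & a.2 < x.2].
  by move=> /forall3P[/= /andP[h1 _] /andP[h2 _] /andP[h3 _]].
have step1 A1 c2 c3 : measurable (A1 : set (measurableTypeR R)) ->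
    Q A1 `]c2, +oo[%classic `]c3, +oo[%classic.
  move=> mA1; rewrite /Q.
  pose C : set E := ((setT `*` `]c2, +oo[) `*` `]c3, +oo[) `&` box a b.
  have mC : measurable C.
    by apply: measurableI => //; apply: measurableX => //; exact: measurableX.
  rewrite (_ : _ `&` _ = (fun x : E => x.1.1) @^-1` A1 `&` C); last first.
    by apply/seteqP; split=> x /=; rewrite /C/=; tauto.
  apply: (dynkin_integral0 intG measurable_fst3 mC mR RG_setI) => //.
    (* The full line is not a ray, but inside the box it may be replaced by the ray from [a.1.1]. *)
    rewrite -[RHS](base a.1.1 c2 c3); congr (integral _ _ _).
    apply/seteqP; split=> x; rewrite /C/= => -[[[h1 h2] h3] h]; split=> //.
    by rewrite in_itv/= andbT; have [] := inbox _ h.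
  move=> _ [c1 ->]; rewrite -[RHS](base c1 c2 c3); congr (integral _ _ _).
  by apply/seteqP; split=> x; rewrite /C/=; tauto.
have step2 A1 A2 c3 : measurable (A1 : set (measurableTypeR R)) ->
    measurable (A2 : set (measurableTypeR R)) -> Q A1 A2 `]c3, +oo[%classic.
  move=> mA1 mA2; rewrite /Q.
  pose C : set E := ((A1 `*` setT) `*` `]c3, +oo[) `&` box a b.
  have mC : measurable C.
    by apply: measurableI => //; apply: measurableX => //; exact: measurableX.
  rewrite (_ : _ `&` _ = (fun x : E => x.1.2) @^-1` A2 `&` C); last first.
    by apply/seteqP; split=> x /=; rewrite /C/=; tauto.
  apply: (dynkin_integral0 intG measurable_snd3 mC mR RG_setI) => //.
    rewrite -[RHS](step1 A1 a.1.2 c3 mA1); congr (integral _ _ _).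
    apply/seteqP; split=> x; rewrite /C/= => -[[[h1 h2] h3] h]; split=> //.
    by rewrite in_itv/= andbT; have [] := inbox _ h.
  move=> _ [c2 ->]; rewrite -[RHS](step1 A1 c2 c3 mA1); congr (integral _ _ _).
  by apply/seteqP; split=> x; rewrite /C/=; tauto.
have step3 A1 A2 A3 : measurable (A1 : set (measurableTypeR R)) ->
    measurable (A2 : set (measurableTypeR R)) ->
    measurable (A3 : set (measurableTypeR R)) -> Q A1 A2 A3.
  move=> mA1 mA2 mA3; rewrite /Q.
  pose C : set E := ((A1 `*` A2) `*` setT) `&` box a b.
  have mC : measurable C.
    by apply: measurableI => //; apply: measurableX => //; exact: measurableX.
  rewrite (_ : _ `&` _ = (fun x : E => x.2) @^-1` A3 `&` C); last first.
    by apply/seteqP; split=> x /=; rewrite /C/=; tauto.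
  apply: (dynkin_integral0 intG measurable_thd3 mC mR RG_setI) => //.
    rewrite -[RHS](step2 A1 A2 a.2 mA1 mA2); congr (integral _ _ _).
    apply/seteqP; split=> x; rewrite /C/= => -[[[h1 h2] h3] h]; split=> //.
    by rewrite in_itv/= andbT; have [] := inbox _ h.
  move=> _ [c3 ->]; rewrite -[RHS](step2 A1 A2 c3 mA1 mA2); congr (integral _ _ _).
  by apply/seteqP; split=> x; rewrite /C/=; tauto.
have rectI d d' (S : measurableType d) (T : measurableType d') :
    setI_closed [set (A : set S) `*` (B : set T) | A in measurable & B in measurable].
  move=> _ _ [A mA [B mB1 <-]] [A' mA' [B' mB2 <-]].
  exists (A `&` A'); first exact: measurableI.
  exists (B `&` B'); first exact: measurableI.
  by rewrite setXI.
have step12 (A12 : set (measurableTypeR R * measurableTypeR R)) (A3 : set (measurableTypeR R)) :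
    measurable A12 -> measurable A3 ->
    (\int[vol]_(x in (A12 `*` A3) `&` box a b) (G x)%:E = 0)%E.
  move=> mA12 mA3; pose C : set E := (setT `*` A3) `&` box a b.
  have mC : measurable C by apply: measurableI => //; apply: measurableX.
  rewrite (_ : _ `&` _ = (fun x : E => x.1) @^-1` A12 `&` C); last first.
    by apply/seteqP; split=> x /=; rewrite /C/=; tauto.
  apply: (dynkin_integral0 intG (@measurable_fst _ _ _ _) mC
    (measurable_prod_measurableType _ _) (rectI _ _ _ _)) => //.
    rewrite -[RHS](step3 setT setT A3 measurableT measurableT mA3); congr (integral _ _ _).
    by apply/seteqP; split=> x; rewrite /C/=; tauto.
  move=> _ [A1 mA1 [A2 mA2 <-]].
  rewrite -[RHS](step3 A1 A2 A3 mA1 mA2 mA3); congr (integral _ _ _).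
  by apply/seteqP; split=> x; rewrite /C/=; tauto.
move=> A mA.
apply: (@dynkin_integral0 _ _ E E R vol (EFin \o G) id _ _ intG (@measurable_id _ _ _) mB
  (measurable_prod_measurableType _ _) (rectI _ _ _ _)) => //; first exact: box_integral0.
by move=> _ [A12 mA12 [A3 mA3 <-]]; exact: step12.
Qed.

Lemma vol_dom : (vol (~` dom Om) = 0)%E.
Proof.
rewrite (_ : vol _ = @lebesgue3 R (~` dom Om `&` dom Om))//.
by rewrite setICl measure0.
Qed.

(** On a box whose closure lies in the domain, integrals over all measurable subsets vanish, so [G]
    is zero almost everywhere there. Countably many rational boxes of this kind cover the domain,
    and [vol] does not charge the rest. *)
Theorem fundamental_ae_eq0 : {ae vol, forall x, G x = 0}.
Proof.
have aebox (a b : E) : cbox a b `<=` dom Om -> {ae vol, forall x, box a b x -> G x = 0}.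
  move=> abO; have mB : measurable (box a b) by exact: measurable_box.
  have := @integral_ae_eq _ _ _ vol (box a b) mB (fun=> 0%E) (EFin \o G) _ _ _.
  have intB : vol.-integrable (box a b) (EFin \o G) by exact: integrableS intG.
  move=> /(_ intB (measurable_cst _)) h.
  have {}h : ae_eq vol (box a b) (EFin \o G) (fun=> 0%E).
    apply: h => A AB mA; rewrite integral0.
    have <- : A `&` box a b = A by apply/setIidPl.
    exact: box_subset_integral0.
  by apply: filterS h => x h /h [].
pose I := (rat * rat * rat * nat)%type.
pose lo (p : I) : E := (((ratr p.1.1.1 - p.2.+1%:R^-1), (ratr p.1.1.2 - p.2.+1%:R^-1)),
  ratr p.1.2 - p.2.+1%:R^-1).
pose hi (p : I) : E := (((ratr p.1.1.1 + p.2.+1%:R^-1), (ratr p.1.1.2 + p.2.+1%:R^-1)),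
  ratr p.1.2 + p.2.+1%:R^-1).
(* Boxes are enumerated by natural numbers to apply [ae_foralln]; numbers coding no box, and boxes
   leaving the domain, impose nothing. *)
pose P n x := if @unpickle I n is Some p then
  cbox (lo p) (hi p) `<=` dom Om -> box (lo p) (hi p) x -> G x = 0 else True.
have : {ae vol, forall x n, P n x}.
  apply: ae_foralln => n; rewrite /P; case: (unpickle n) => [p|]; last exact: aeW.
  have [pO|pO] := pselect (cbox (lo p) (hi p) `<=` dom Om); last exact: aeW.
  by have := aebox _ _ pO; apply: filterS => x h _.
have outae : {ae vol, forall x, dom Om x}.
  exists (~` dom Om); split => //; last exact: vol_dom.
  by apply: measurableC; apply: open_measurable3; exact: dom_open.
apply: filterS2 outae => x Ox Px.
have /nbhs_ballP[e /= e0 xeO] : nbhs x (dom Om).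
  by apply: open_nbhs_nbhs; split=> //; exact: dom_open.
(* With a rational centre closer to [x] than the radius r = 1/(n+1), the closed cube stays within
   distance 2r < e of [x]. *)
have [n ne] : exists n, n.+1%:R^-1 < e / 2.
  have [n _ /(_ n (leqnn n))] := near_infty_natSinv_lt (PosNum (divr_gt0 e0 (ltr0n R 2))).
  by exists n.
have r0 : 0 < n.+1%:R^-1 :> R by rewrite invr_gt0.
have dr (c : R) : exists q : rat, `|c - ratr q| < n.+1%:R^-1.
  have [|t [ct [q _ qt]]] := @dense_rat R (ball c n.+1%:R^-1) _ (ball_open c _).
    by exists c; exact: ballxx.
  by exists q; rewrite qt.
have [q1 h1] := dr x.1.1; have [q2 h2] := dr x.1.2; have [q3 h3] := dr x.2.
have := Px (pickle ((q1, q2, q3, n) : I)); rewrite /P pickleK; apply.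
- move=> y /forall3P[/= k1 k2 k3]; apply: xeO.
  have tr (s t u : R) : `|s - t| < n.+1%:R^-1 -> t - n.+1%:R^-1 <= u <= t + n.+1%:R^-1 ->
      ball s e u.
    move: (n.+1%:R^-1) ne => r ne; rewrite /ball/= ltr_distlC => /andP[m1 m2] /andP[m3 m4].
    by rewrite ltr_distlC; apply/andP; split; move: ne; lra.
  by split; [split|]; [exact: tr h1 k1|exact: tr h2 k2|exact: tr h3 k3].
- have tr (s t r : R) : `|s - t| < r -> t - r < s < t + r.
    by rewrite ltr_distlC => /andP[m1 m2]; apply/andP; split; lra.
  by apply/forall3P; split; exact: tr.
Qed.

End Fundamental.

(** * Function spaces of the Navier-Stokes equations *)

Section Pairing.
Context (R : realType) (Om : smooth_domain R).
Local Notation E := (space3 R).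
Local Notation vol := (vol Om).
Local Notation vfield := (L2 vol 'I_3).
Local Notation tfield := (L2 vol ('I_3 * 'I_3)%type).

Lemma dom_cbox : exists a b : E, dom Om `<=` cbox a b.
Proof.
have [M [_ MP]] := @dom_bounded _ Om.
pose c := M + 1; exists ((- c, - c), - c), ((c, c), c) => x Ox.
have /(_ _)/= := MP c _ x Ox; rewrite ltrDl => /(_ ltr01).
rewrite !prod_normE/= !ge_max => /andP[/andP[h1 h2] h3].
by apply/forall3P; split=> /=; rewrite -ler_norml.
Qed.

(** Finite volume makes square-integrable functions integrable, as the fundamental lemma
    requires. *)
Lemma vol_finite : vol setT \is a fin_num.
Proof.
have [a [b ab]] := dom_cbox; rewrite ge0_fin_numE//.
rewrite (_ : vol setT = @lebesgue3 R (setT `&` dom Om))// setTI.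
pose B : set E := (`[a.1.1, b.1.1] `*` `[a.1.2, b.1.2]) `*` `[a.2, b.2].
have mB : measurable B by apply: measurableX => //; exact: measurableX.
apply: (@le_lt_trans _ _ (@lebesgue3 R B)).
  apply: le_measure; rewrite ?inE//; first by apply: open_measurable3; exact: dom_open.
  by move=> x /ab/forall3P[h1 h2 h3]; rewrite /B/= !in_itv.
rewrite (_ : lebesgue3 R B =
  (((@lebesgue_measure R) \x (@lebesgue_measure R)) \x (@lebesgue_measure R))%E B)//.
rewrite /B product_measure1E//; last exact: measurableX.
have len (x y : R) : @lebesgue_measure R `[x, y] \is a fin_num.
  by rewrite lebesgue_measure_itv/=; case: ifP.
rewrite [X in (X * _)%E](_ : _ = (@lebesgue_measure R `[a.1.1, b.1.1] *
    @lebesgue_measure R `[a.1.2, b.1.2])%E); last exact: product_measure1E.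
by rewrite ltey_eq !fin_numM//; exact: len.
Qed.

Lemma L2fun_integrable (I : finType) (u : L2 vol I) i : vol.-integrable setT (EFin \o u i).
Proof. by apply/Lfun1_integrable/(Lfun_subset12 vol_finite); exact: L2fun_Lfun. Qed.

(** A common notion for the multipliers that occur: continuous functions, square-integrable
    components, and these components times a bounded function. *)
Definition pairable (g : E -> R) := forall (I : finType) (u : L2 vol I) i,
  vol.-integrable setT (EFin \o (fun x => u i x * g x)).

Lemma pairable_L2fun (I : finType) (v : L2 vol I) i : pairable (v i).
Proof.
by move=> J u j; apply/Lfun1_integrable/Lfun2_mul_Lfun1; exact: L2fun_Lfun.
Qed.

Lemma integrable_dom (h : E -> \bar R) : measurable_fun setT h ->
  vol.-integrable (dom Om) h -> vol.-integrable setT h.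
Proof.
move=> mh ih; have mO : measurable (dom Om) by apply: open_measurable3; exact: dom_open.
apply/(@negligible_integrable _ _ _ vol setT (~` dom Om) h) => //.
- exact: measurableC.
- exact: vol_dom.
- by rewrite setTD setCK.
Qed.

(** A continuous [g] is bounded on a compact box around the domain but perhaps not beyond it, so
    integrability is checked on the domain. *)
Lemma pairable_continuous (g : E -> R) : continuous g -> pairable g.
Proof.
move=> cg I u i; have mO : measurable (dom Om) by apply: open_measurable3; exact: dom_open.
have mg : measurable_fun setT g by exact: continuous_measurable3.
have mu' := L2fun_measurable u i.
apply: integrable_dom; first exact/measurable_EFinP/measurable_funM.
have [a [b ab]] := dom_cbox.
have cK := @compact_cbox R a b.
have gC : exists C, forall x, dom Om x -> `|g x| <= C.
  have := compact_bounded (continuous_compact (continuous_subspaceT cg) cK).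
  move=> [M [_ MP]]; exists (M + 1) => x /ab xab.
  by apply: MP; [rewrite ltrDl|exists x].
have [C gCx] := gC.
have iu : vol.-integrable (dom Om) (fun x => (C * u i x)%:E).
  have := integrableZl measurableT C (L2fun_integrable u i).
  by move=> h; apply: integrableS h.
apply: le_integrable iu => //.
  by apply/measurable_EFinP/measurable_funM; exact: measurable_funTS.
move=> x Ox; rewrite lee_fin !normrM mulrC.
rewrite ler_wpM2r//; apply: le_trans (gCx _ Ox) (ler_norm _).
Qed.

(** The representative of [a *: u + v] is the combination of representatives only almost everywhere,
    so linearity is stated for integrals. *)
Lemma pairing_lin (I : finType) g a (u v : L2 vol I) i : pairable g -> measurable_fun setT g ->
  \int[vol]_x (L2fun (a *: u + v) i x * g x) =
  a * \int[vol]_x (u i x * g x) + \int[vol]_x (v i x * g x).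
Proof.
move=> pg mg; rewrite -RintegralZl// -RintegralD//; last first.
  have := integrableZl measurableT a (pg _ u i).
  by apply: eq_integrable => // x _.
have mL (w : L2 vol I) : measurable_fun setT (fun x => w i x * g x).
  by apply: measurable_funM => //; exact: L2fun_measurable.
congr fine; apply: ae_eq_integral => //; first by apply/measurable_EFinP; exact: (mL (a *: u + v)).
  apply/measurable_EFinP.
  apply: (@measurable_funD _ _ _ _ (fun x => a * (u i x * g x)) (fun x => v i x * g x)) => //.
  by apply: measurable_funM => //; exact: mL.
have := L2funD (a *: u) v i; have := L2funZ a u i.
by apply: filterS2 => x /= -> -> _; rewrite mulrDl mulrA.
Qed.

Lemma smooth_continuous (g : E -> R) : smooth g -> continuous g.
Proof. by move=> sg x; exact: (differentiable_continuous (sg [::] x)). Qed.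

Lemma smooth_partial_continuous (g : E -> R) j : smooth g -> continuous (partial j g).
Proof. by move=> sg x; exact: (differentiable_continuous (sg [:: j] x)). Qed.
Arguments smooth_partial_continuous [g] j _.

Lemma weak_grad_lin (I : finType) a (u v : L2 vol I) G H :
  weak_grad u G -> weak_grad v H -> weak_grad (a *: u + v) (a *: G + H).
Proof.
move=> uG vH g tg i j; have [sg _ _] := tg.
have cg := smooth_continuous sg; have cpg := smooth_partial_continuous j sg.
rewrite !pairing_lin; try exact: pairable_continuous; try exact: continuous_measurable3.
by rewrite uG// vH// opprD mulrN.
Qed.

(** The components of [G - H] integrate to zero against every test function. This makes the choice
    in [grad] canonical, hence linear. *)
Lemma weak_grad_unique (I : finType) (u : L2 vol I) G H :
  weak_grad u G -> weak_grad u H -> G = H.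
Proof.
move=> uG uH; apply/eqP; rewrite -subr_eq0; apply/eqP.
apply: L2fun_eq0 => -[i j]; apply: fundamental_ae_eq0; first exact: L2fun_integrable.
move=> g tg; have [sg _ _] := tg; have cg := smooth_continuous sg.
rewrite addrC -scaleN1r pairing_lin; [|exact: pairable_continuous|exact: continuous_measurable3].
have /eqP := uG g tg i j; rewrite (uH g tg i j) eqr_opp => /eqP ->.
by rewrite mulN1r addNr.
Qed.

Lemma gradP (u : vfield) : H1 u -> weak_grad u (grad u).
Proof. by move=> [G uG]; exact: (@xgetPex _ 0 [set G | weak_grad u G] (ex_intro _ G uG)). Qed.

Lemma H1_lin a (u v : vfield) : H1 u -> H1 v -> H1 (a *: u + v).
Proof. by move=> /gradP uG /gradP vH; exists (a *: grad u + grad v); exact: weak_grad_lin. Qed.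

Lemma grad_lin a (u v : vfield) : H1 u -> H1 v ->
  grad (a *: u + v) = a *: grad u + grad v.
Proof.
move=> u1 v1; apply: weak_grad_unique (gradP (H1_lin a u1 v1)) _.
by apply: weak_grad_lin; exact: gradP.
Qed.

Lemma weak_grad0 (I : finType) : weak_grad (0 : L2 vol I) 0.
Proof.
move=> g tg i j; have [sg _ _] := tg.
have z (J : finType) (k : J) h : continuous h -> \int[vol]_x ((0 : L2 vol J) k x * h x) = 0.
  move=> ch; have := @pairing_lin J h (-1) 0 0 k (pairable_continuous ch)
    (continuous_measurable3 ch).
  by rewrite scaler0 addr0 mulN1r addNr.
rewrite (z _ _ _ (smooth_partial_continuous j sg)).
by rewrite (z _ _ _ (smooth_continuous sg)) oppr0.
Qed.

Lemma H1_0 : H1 (0 : vfield). Proof. by exists 0; exact: weak_grad0. Qed.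

Lemma grad0 : grad (0 : vfield) = 0.
Proof. exact: weak_grad_unique (gradP H1_0) (@weak_grad0 _). Qed.

Lemma Hset_lin a (u v : vfield) : Hset u -> Hset v -> Hset (a *: u + v).
Proof.
move=> [du nu] [dv nv]; split=> [g tg|q dq qdq].
  have [sg _ _] := tg.
  transitivity (a * (\sum_j \int[vol]_x (u j x * partial j g x)) +
      \sum_j \int[vol]_x (v j x * partial j g x)).
    rewrite mulr_sumr -big_split; apply: eq_bigr => j _ /=.
    have cpg := smooth_partial_continuous j sg.
    apply: pairing_lin; first exact: pairable_continuous.
    exact: continuous_measurable3.
  by rewrite du// dv// mulr0 addr0.
transitivity (a * (\sum_j \int[vol]_x (u j x * dq (tt, j) x)) +
    \sum_j \int[vol]_x (v j x * dq (tt, j) x)).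
  rewrite mulr_sumr -big_split; apply: eq_bigr => j _ /=.
  by apply: pairing_lin; [exact: pairable_L2fun|exact: L2fun_measurable].
by rewrite (nu q)// (nv q)// mulr0 addr0.
Qed.

End Pairing.

Lemma closureP_norm (R : realType) (V : normedModType R) (S : set V) x :
  closure S x <-> forall e, 0 < e -> exists2 y, S y & `|x - y| < e.
Proof.
split=> [Sx e e0|h].
  have [y [Sy xy]] := Sx _ (nbhsx_ballx x e e0); exists y => //.
  by rewrite -ball_normE in xy.
move=> B /nbhs_ballP[e /= e0 xB]; have [y Sy xy] := h e e0; exists y; split=> //.
by apply: xB; rewrite -ball_normE.
Qed.

Lemma closure_lin (R : realType) (V : normedModType R) (S : set V) :
  (forall a x y, S x -> S y -> S (a *: x + y)) ->
  forall a x y, closure S x -> closure S y -> closure S (a *: x + y).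
Proof.
move=> SL a x y /closureP_norm Sx /closureP_norm Sy; apply/closureP_norm => e e0.
have d0 : 0 < e / 2 / (`|a| + 1) by rewrite !divr_gt0// ltr_wpDl.
have [x' Sx' xx'] := Sx _ d0.
have [y' Sy' yy'] := Sy _ (divr_gt0 e0 (ltr0n R 2)).
exists (a *: x' + y'); first exact: SL.
rewrite opprD addrACA -scalerBr (le_lt_trans (ler_normD _ _))// normrZ.
rewrite [ltRHS](splitr e) ler_ltD//.
apply: (le_trans (ler_wpM2l (normr_ge0 a) (ltW xx'))).
by rewrite mulrCA ler_piMr ?divr_ge0 ?(ltW e0)// ler_pdivrMr ?ltr_wpDl// mul1r lerDl.
Qed.

(** * Linear structure of [V], [DA] and [W] *)

Section Spaces.
Context (R : realType) (Om : smooth_domain R).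
Local Notation E := (space3 R).
Local Notation vol := (vol Om).
Local Notation vfield := (L2 vol 'I_3).
Local Notation tfield := (L2 vol ('I_3 * 'I_3)%type).

Lemma foldr_partial_lin a (f g : E -> R) s : smooth f -> smooth g ->
  foldr (@partial R) (fun x => a * f x + g x) s =
  (fun x => a * foldr (@partial R) f s x + foldr (@partial R) g s x).
Proof.
move=> sf sg; elim: s => // j s /= ->; apply/funext => x.
have df := sf s x; have dg := sg s x.
have daf : differentiable (fun x => a * foldr (@partial R) f s x) x.
  exact: (differentiableM (differentiable_cst _ _)).
rewrite /partial [LHS]deriveD//; try exact: diff_derivable.
by congr (_ + _); rewrite [LHS](deriveZ _ _)//; exact: diff_derivable.
Qed.

Lemma test_fun_lin a (f g : E -> R) : test_fun Om f -> test_fun Om g ->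
  test_fun Om (fun x => a * f x + g x).
Proof.
move=> [sf cf fO] [sg cg gO].
have sub : supp (fun x => a * f x + g x) `<=` supp f `|` supp g.
  rewrite -closureU; apply: closureS => x /= h.
  have [f0|f0] := eqVneq (f x) 0; last by left.
  by right; move: h; rewrite f0 mulr0 add0r.
split.
- move=> s x; rewrite foldr_partial_lin//; apply: differentiableD => //.
  exact: (differentiableM (differentiable_cst _ _)).
- apply: subclosed_compact sub; first exact: closed_closure.
  exact: compactU.
- by move=> x /sub [/fO|/gO].
Qed.

Lemma smooth_cst0 : smooth (fun _ : E => 0 : R).
Proof. exact/elementary_smooth/elementary_cst. Qed.

Lemma test_fun0 : test_fun Om (fun=> 0).
Proof.
have s0 : supp (fun _ : E => 0 : R) = set0.
  rewrite /supp (_ : [set _ | _] = set0) ?closure0//.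
  by apply/seteqP; split=> x //=; rewrite eqxx.
by split; [exact: smooth_cst0|rewrite s0; exact: compact0|rewrite s0].
Qed.

Lemma L2fun_lin (I : finType) a (u v : L2 vol I) i :
  {ae vol, forall x, L2fun (a *: u + v) i x = a * u i x + v i x}.
Proof.
have := L2funD (a *: u) v i; have := L2funZ a u i.
by apply: filterS2 => x /= -> ->.
Qed.

Lemma partial_lin a (f g : E -> R) j x : smooth f -> smooth g ->
  partial j (fun x => a * f x + g x) x = a * partial j f x + partial j g x.
Proof. by move=> sf sg; have /(congr1 (@^~ x)) := foldr_partial_lin a [:: j] sf sg. Qed.

Lemma test_graph_lin a (p q : vfield * tfield) : test_graph p -> test_graph q ->
  test_graph (a *: p + q).
Proof.
move=> [f [tf f1 f2]] [g [tg g1 g2]].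
exists (fun i x => a * f i x + g i x); split.
- by move=> i; exact: test_fun_lin.
- move=> i; have := L2fun_lin a p.1 q.1 i.
  by have := g1 i; have := f1 i; apply: filterS3 => x <- <-.
- move=> i j; have := L2fun_lin a p.2 q.2 (i, j).
  have := g2 i j; have := f2 i j; apply: filterS3 => x fx gx pq.
  have [sf _ _] := tf i; have [sg _ _] := tg i.
  by rewrite partial_lin// -fx -gx.
Qed.

Lemma test_graph0 : test_graph (0 : vfield * tfield).
Proof.
have z (I : finType) (i : I) : {ae vol, forall x, (0 : L2 vol I) i x = 0}.
  by have := L2funZ 0 (0 : L2 vol I) i; rewrite scale0r; apply: filterS => x ->; rewrite mul0r.
exists (fun _ _ => 0); split => [i|i|i j]; [exact: test_fun0|exact: z|].
by have := z _ (i, j); apply: filterS => x /= ->; rewrite /partial derive_cst.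
Qed.

Lemma H10_lin a (u v : vfield) : H10 u -> H10 v -> H10 (a *: u + v).
Proof.
move=> [u1 ug] [v1 vg]; split; first exact: H1_lin.
rewrite grad_lin//.
exact: (closure_lin (a := a) (fun b => @test_graph_lin b) ug vg).
Qed.

Lemma H10_0 : H10 (0 : vfield).
Proof.
split; first exact: H1_0.
by rewrite grad0; apply: subset_closure; exact: test_graph0.
Qed.

Lemma V_lin a (u v : vfield) : V u -> V v -> V (a *: u + v).
Proof. by move=> [? ?] [? ?]; split; [exact: Hset_lin|exact: H10_lin]. Qed.

Lemma V0 : V (0 : vfield). Proof. by split; [exact: Hset0|exact: H10_0]. Qed.

Lemma V_H1 (u : vfield) : V u -> H1 u. Proof. by case=> _ []. Qed.

(** [h - k] is orthogonal to [V] and lies in its closure, hence is orthogonal to itself. *)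
Lemma stokes_repr_unique (w h k : vfield) : stokes_repr w h -> stokes_repr w k -> h = k.
Proof.
move=> [_ ch hw] [_ ck kw]; apply/eqP; rewrite -subr_eq0; apply/eqP.
have cd : closure (@V _ Om) (h - k).
  by rewrite addrC -scaleN1r; exact: (closure_lin (fun b => @V_lin b)).
have dV v : V v -> ip (h - k) v = 0.
  by move=> Vv; rewrite ipDl -scaleN1r ipZl hw// kw// mulN1r subrr.
apply: ip_eq0; apply/le_anti; rewrite ip_ge0 andbT.
apply/ler_addgt0Pr => e e0; rewrite add0r.
have d0 : 0 < e / (`|h - k| + 1) by rewrite divr_gt0// ltr_wpDl.
move: cd => /closureP_norm/(_ _ d0)[v Vv dv].
have -> : ip (h - k) (h - k) = ip (h - k) ((h - k) - v).
  by rewrite (ipDr _ (- v)) -(scaleN1r v) ipZr (dV _ Vv) mulr0 addr0.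
apply: (le_trans (ler_norm _)); apply: (le_trans (ip_le_norm _ _)).
apply: (le_trans (ler_wpM2l (normr_ge0 (h - k)) (ltW dv))).
by rewrite mulrCA ler_piMr ?(ltW e0)// ler_pdivrMr ?ltr_wpDl// mul1r lerDl.
Qed.

Lemma stokes_repr_lin a (u v h k : vfield) : V u -> V v ->
  stokes_repr u h -> stokes_repr v k -> stokes_repr (a *: u + v) (a *: h + k).
Proof.
move=> Vu Vv [Hh ch hu] [Hk ck kv]; split.
- exact: Hset_lin.
- exact: (closure_lin (fun b => @V_lin b)).
- move=> w Vw; rewrite ipDl ipZl hu// kv// grad_lin ?ipDl ?ipZl//; exact: V_H1.
Qed.

Lemma stokesP (w : vfield) : DA w -> stokes_repr w (stokes w).
Proof. by move=> [_ [h wh]]; exact: (@xgetPex _ 0 [set h | stokes_repr w h] (ex_intro _ h wh)). Qed.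

Lemma DA_lin a (u v : vfield) : DA u -> DA v -> DA (a *: u + v).
Proof.
move=> Du Dv; have [[Vu _] [Vv _]] := (Du, Dv); split; first exact: V_lin.
by exists (a *: stokes u + stokes v); apply: stokes_repr_lin => //; exact: stokesP.
Qed.

Lemma stokes_lin a (u v : vfield) : DA u -> DA v ->
  stokes (a *: u + v) = a *: stokes u + stokes v.
Proof.
move=> Du Dv; have [[Vu _] [Vv _]] := (Du, Dv).
apply: stokes_repr_unique (stokesP (DA_lin a Du Dv)) _.
by apply: stokes_repr_lin => //; exact: stokesP.
Qed.

Lemma DA0 : DA (0 : vfield).
Proof.
split; first exact: V0.
exists 0; split; [exact: Hset0|by apply: subset_closure; exact: V0|].
have z (I : finType) (v : L2 vol I) : ip 0 v = 0 by rewrite -(scale0r 0) ipZl mul0r.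
by move=> v _; rewrite grad0 !z.
Qed.

Lemma finite_normP (f : E -> R) :
  finite_norm vol +oo%E f <-> exists C, {ae vol, forall x, `|f x| <= C}.
Proof.
rewrite /finite_norm unlock; case: ifPn => [v0|]; last first.
  (* On a space of measure zero the bound 0 holds with the whole space as exceptional set. *)
  rewrite -leNgt => v0; split=> // _; exists 0; exists setT; split=> //.
  by apply/le_anti; rewrite v0 measure_ge0.
split=> [h|[C fC]].
  have e0 : (0 <= ess_sup vol (abse \o (EFin \o f)))%E.
    by apply: ess_sup_gee => //; apply: aeW => x; exact: abse_ge0.
  exists (fine (ess_sup vol (abse \o (EFin \o f)))).
  have := ess_sup_ge vol (abse \o (EFin \o f)); apply: filterS => x /=.
  by rewrite -lee_fin fineK// ge0_fin_numE.
apply: le_lt_trans (ltry C); apply/ess_supP.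
by apply: filterS fC => x /=; rewrite lee_fin.
Qed.

Lemma finite_norm_lin (I : finType) a (u v : L2 vol I) i :
  finite_norm vol +oo%E (u i) -> finite_norm vol +oo%E (v i) ->
  finite_norm vol +oo%E (L2fun (a *: u + v) i).
Proof.
move=> /finite_normP[C uC] /finite_normP[D vD]; apply/finite_normP.
exists (`|a| * C + D); have := L2fun_lin a u v i; move: uC vD.
apply: filterS3 => x ux vx ->.
by rewrite (le_trans (ler_normD _ _))// lerD// normrM ler_wpM2l.
Qed.

Lemma finite_norm0 (I : finType) i : finite_norm vol +oo%E ((0 : L2 vol I) i).
Proof.
apply/finite_normP; exists 0.
by have := L2funZ 0 (0 : L2 vol I) i; rewrite scale0r; apply: filterS => x ->; rewrite mul0r normr0.
Qed.

Lemma W_DA (u : vfield) : W u -> DA u. Proof. by case. Qed.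
Lemma W_V (u : vfield) : W u -> V u. Proof. by case=> -[]. Qed.
Lemma W_H1 (u : vfield) : W u -> H1 u. Proof. by move=> /W_V/V_H1. Qed.

Lemma W_lin a (u v : vfield) : W u -> W v -> W (a *: u + v).
Proof.
move=> Wu Wv; have [[Du u0 gu] [Dv v0 gv]] := (Wu, Wv); split.
- exact: DA_lin.
- by move=> i; exact: finite_norm_lin.
- by move=> ij; rewrite grad_lin; [exact: finite_norm_lin|exact: W_H1|exact: W_H1].
Qed.

Lemma W0 : W (0 : vfield).
Proof.
split; first exact: DA0.
- by move=> i; exact: finite_norm0.
- by move=> ij; rewrite grad0; exact: finite_norm0.
Qed.

Lemma grad_bounded (w : vfield) ij : W w ->
  exists C, {ae vol, forall x, `|grad w ij x| <= C}.
Proof. by move=> [_ _ /(_ ij)] /finite_normP. Qed.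

End Spaces.

(** * The functional F and its cylindrical test functions *)

Section RintegralSum.
Context d (T : measurableType d) (R : realType) (mu : {measure set T -> \bar R}).

Lemma integrable_sumR (I : Type) (r : seq I) (F : I -> T -> R) :
  (forall i, mu.-integrable setT (EFin \o F i)) ->
  mu.-integrable setT (EFin \o (fun x => \sum_(i <- r) F i x)).
Proof.
move=> iF; elim: r => [|i r ih].
  by under eq_fun do rewrite big_nil; exact: integrable0.
under eq_fun do rewrite big_cons.
have := integrableD measurableT (iF i) ih.
by apply: eq_integrable => // x _.
Qed.

Lemma Rintegral_sum (I : Type) (r : seq I) (F : I -> T -> R) :
  (forall i, mu.-integrable setT (EFin \o F i)) ->
  \int[mu]_x (\sum_(i <- r) F i x) = \sum_(i <- r) \int[mu]_x F i x.
Proof.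
move=> iF; elim: r => [|i r ih].
  rewrite big_nil; transitivity (\int[mu]_(x in [set: T]) (0 : R)).
    by apply: eq_Rintegral => x _; rewrite big_nil.
  by rewrite /Rintegral integral0.
rewrite big_cons -ih -RintegralD//; last exact: integrable_sumR.
by apply: eq_Rintegral => x _; rewrite big_cons.
Qed.

Lemma integrable_ae_le (f g : T -> R) : measurable_fun setT f ->
  mu.-integrable setT (EFin \o g) -> {ae mu, forall x, `|f x| <= `|g x|} ->
  mu.-integrable setT (EFin \o f).
Proof.
move=> mf ig fg; apply/integrableP; split; first exact/measurable_EFinP.
have mg := measurable_int _ ig; have /integrableP[_] := ig; apply: le_lt_trans.
apply: ae_ge0_le_integral => //.
- by apply: measurableT_comp => //; exact/measurable_EFinP.
- exact: measurableT_comp.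
- by apply: filterS fg => x h _; rewrite lee_fin.
Qed.

End RintegralSum.

(** * The convection term as a bounded form *)

Section Trilinear.
Context (R : realType) (Om : smooth_domain R).
Local Notation E := (space3 R).
Local Notation vol := (vol Om).
Local Notation vfield := (L2 vol 'I_3).
Local Notation tfield := (L2 vol ('I_3 * 'I_3)%type).

Definition ae_bounded (b : E -> R) :=
  measurable_fun setT b /\ exists C, {ae vol, forall x, `|b x| <= C}.

Lemma weighted_integrable (u v : vfield) b i j : ae_bounded b ->
  vol.-integrable setT (EFin \o (fun x => u i x * (b x * v j x))).
Proof.
move=> [mb [C bC]].
apply: (@integrable_ae_le _ _ _ _ _ (fun x => C * (u i x * v j x))).
- apply: measurable_funM; first exact: L2fun_measurable.
  by apply: measurable_funM => //; exact: L2fun_measurable.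
- have := integrableZl measurableT C (pairable_L2fun v j u i).
  by apply: eq_integrable => // x _.
- apply: filterS bC => x bx; rewrite mulrCA !normrM ler_wpM2r//.
  exact: le_trans bx (ler_norm _).
Qed.

Lemma pairable_weighted (v : vfield) b j : ae_bounded b ->
  pairable Om (fun x => b x * v j x).
Proof.
move=> bb I u i; have [mb [C bC]] := bb.
apply: (@integrable_ae_le _ _ _ _ _ (fun x => C * (u i x * v j x))).
- apply: measurable_funM; first exact: L2fun_measurable.
  by apply: measurable_funM => //; exact: L2fun_measurable.
- have := integrableZl measurableT C (pairable_L2fun v j u i).
  by apply: eq_integrable => // x _.
- apply: filterS bC => x bx; rewrite mulrCA !normrM ler_wpM2r//.
  exact: le_trans bx (ler_norm _).
Qed.

Definition weighted (b : E -> R) i j (u v : vfield) : R :=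
  \int[vol]_x (u i x * (b x * v j x)).

Lemma weightedC b i j u v : weighted b i j u v = weighted b j i v u.
Proof. by apply: eq_Rintegral => x _; ring. Qed.

Lemma weighted_linl b i j a u u' v : ae_bounded b ->
  weighted b i j (a *: u + u') v = a * weighted b i j u v + weighted b i j u' v.
Proof.
move=> bb; apply: pairing_lin; first exact: pairable_weighted.
by apply: measurable_funM; [exact: bb.1|exact: L2fun_measurable].
Qed.

Lemma weighted_linr b i j a u v v' : ae_bounded b ->
  weighted b i j u (a *: v + v') = a * weighted b i j u v + weighted b i j u v'.
Proof. by move=> bb; rewrite weightedC weighted_linl// !(weightedC _ j). Qed.

Lemma integral_sqr_le (u : vfield) i : \int[vol]_x (u i x * u i x) <= ip u u.
Proof.
rewrite /ip (bigD1 i)//= lerDl sumr_ge0// => k _.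
by apply: Rintegral_ge0 => x _; exact: sqr_ge0.
Qed.

(** Pointwise, [s * t <= s ^+ 2 + t ^+ 2] for nonnegative [s] and [t]; the constant is not
    optimized. *)
Lemma weighted_amgm (b : E -> R) i j (u v : vfield) C : measurable_fun setT b ->
  {ae vol, forall x, `|b x| <= C} -> 0 <= C ->
  `|weighted b i j u v| <= C * (ip u u + ip v v).
Proof.
move=> mb bC C0; have bb : ae_bounded b by split=> //; exists C.
have iw := weighted_integrable u v i j bb.
apply: (le_trans (le_normr_Rintegral _ iw)) => //.
have isq (w : vfield) k : vol.-integrable setT (EFin \o (fun x => w k x * w k x)).
  exact: L2fun_mul_integrable.
apply: (@le_trans _ _ (\int[vol]_x (C * (u i x * u i x) + C * (v j x * v j x)))).
  have iC (w : vfield) k : vol.-integrable setT (EFin \o (fun x => C * (w k x * w k x))).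
    have := integrableZl measurableT C (isq w k).
    by apply: eq_integrable => // x _.
  have iCD : vol.-integrable setT (EFin \o (fun x => C * (u i x * u i x) + C * (v j x * v j x))).
    have := integrableD measurableT (iC u i) (iC v j).
    by apply: eq_integrable => // x _.
  have ia : vol.-integrable setT (EFin \o (fun x => `|u i x * (b x * v j x)|)).
    exact: (integrable_abse iw).
  apply: fine_le; [exact: integrable_fin_num|exact: integrable_fin_num|].
  apply: ae_ge0_le_integral => //.
  - exact: measurable_int ia.
  - by move=> x _; rewrite lee_fin addr_ge0// mulr_ge0// -expr2 sqr_ge0.
  - exact: measurable_int iCD.
  - apply: filterS bC => x bx _; rewrite lee_fin !normrM.
    rewrite -mulrDr mulrCA.
    apply: (@le_trans _ _ (C * (`|u i x| * `|v j x|))); first by rewrite ler_wpM2r// mulr_ge0.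
    rewrite ler_wpM2l// -!expr2 -(real_normK (num_real (u i x))) -(real_normK (num_real (v j x))).
    have := normr_ge0 (u i x); have := normr_ge0 (v j x).
    move: (`|u i x|) (`|v j x|) => s t; nra.
have iC (w : vfield) k : vol.-integrable setT (EFin \o (fun x => C * (w k x * w k x))).
  have := integrableZl measurableT C (isq w k).
  by apply: eq_integrable => // x _.
rewrite RintegralD// !RintegralZl// -mulrDr ler_wpM2l// lerD//; exact: integral_sqr_le.
Qed.

Lemma ip_norm (u : vfield) : ip u u = `|u| ^+ 2.
Proof. by rewrite [`|u|]/(L2norm u) sqr_sqrtr ?ip_ge0. Qed.

(** Homogeneity turns the additive bound into a product: on normalized fields its right side is a
    constant, and zero fields are treated apart. *)
Lemma weighted_bound b : ae_bounded b ->
  exists2 C, 0 <= C & forall i j u v, `|weighted b i j u v| <= C * (`|u| * `|v|).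
Proof.
move=> bb; have [mb [C bC]] := bb.
have bC' : {ae vol, forall x, `|b x| <= `|C|}.
  by apply: filterS bC => x bx; exact: le_trans bx (ler_norm _).
exists (`|C| * 2) => [|i j u v]; first by rewrite mulr_ge0.
have Z a w w' : weighted b i j (a *: w) w' = a * weighted b i j w w'.
  have w0 : weighted b i j 0 w' = 0.
    by have := weighted_linl i j (-1) 0 0 w' bb; rewrite scaler0 addr0 mulN1r addNr.
  by have := weighted_linl i j a w 0 w' bb; rewrite !addr0 w0 addr0.
have Zr a w w' : weighted b i j w (a *: w') = a * weighted b i j w w'.
  have w0 : weighted b i j w 0 = 0.
    by have := weighted_linr i j (-1) w 0 0 bb; rewrite scaler0 addr0 mulN1r addNr.
  by have := weighted_linr i j a w w' 0 bb; rewrite !addr0 w0 addr0.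
have [->|u0] := eqVneq u 0.
  by rewrite -[X in weighted _ _ _ X _](scale0r 0) Z mul0r normr0 !mulr_ge0.
have [->|v0] := eqVneq v 0.
  by rewrite -[X in weighted _ _ _ _ X](scale0r 0) Zr mul0r normr0 !mulr_ge0.
have nu0 : 0 < `|u| by rewrite normr_gt0.
have nv0 : 0 < `|v| by rewrite normr_gt0.
have := weighted_amgm i j (`|u|^-1 *: u) (`|v|^-1 *: v) mb bC' (normr_ge0 C).
rewrite Z Zr !ip_norm !normrZ !normfV !normr_id !mulVf ?gt_eqF// expr1n.
rewrite mulrA -invfM ler_pdivrMl ?mulr_gt0//.
by move=> /le_trans; apply; rewrite mulrC.
Qed.

Lemma grad_ae_bounded (w : vfield) ij : W w -> ae_bounded (grad w ij).
Proof. by move=> Ww; split; [exact: L2fun_measurable|exact: grad_bounded]. Qed.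

Definition convection (w u v : vfield) : R :=
  \sum_(i < 3) \sum_(j < 3) weighted (grad w (j, i)) i j u v.

Lemma convectionE (w u : vfield) : W w ->
  \int[vol]_x (\sum_(i < 3) \sum_(j < 3) u i x * grad w (j, i) x * u j x) = convection w u u.
Proof.
move=> Ww; rewrite /convection.
transitivity (\int[vol]_x (\sum_(i < 3) \sum_(j < 3) u i x * (grad w (j, i) x * u j x))).
  by apply: eq_Rintegral => x _; apply: eq_bigr => i _; apply: eq_bigr => j _; rewrite mulrA.
rewrite Rintegral_sum; last first.
  by move=> i; apply: integrable_sumR => j; exact/weighted_integrable/grad_ae_bounded.
apply: eq_bigr => i _; rewrite Rintegral_sum//.
by move=> j; exact/weighted_integrable/grad_ae_bounded.
Qed.

Lemma convection_linl (w : vfield) a u u' v : W w ->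
  convection w (a *: u + u') v = a * convection w u v + convection w u' v.
Proof.
move=> Ww; rewrite /convection mulr_sumr -big_split; apply: eq_bigr => i _ /=.
rewrite mulr_sumr -big_split; apply: eq_bigr => j _ /=.
by rewrite weighted_linl//; exact: grad_ae_bounded.
Qed.

Lemma convection_linr (w : vfield) a u v v' : W w ->
  convection w u (a *: v + v') = a * convection w u v + convection w u v'.
Proof.
move=> Ww; rewrite /convection mulr_sumr -big_split; apply: eq_bigr => i _ /=.
rewrite mulr_sumr -big_split; apply: eq_bigr => j _ /=.
by rewrite weighted_linr//; exact: grad_ae_bounded.
Qed.

Lemma convection_bound (w : vfield) : W w ->
  exists2 C, 0 <= C & forall u v, `|convection w u v| <= C * (`|u| * `|v|).
Proof.
move=> Ww.
have /choice[C CP] (ij : 'I_3 * 'I_3) : exists C, 0 <= C /\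
    forall i j u v, `|weighted (grad w ij) i j u v| <= C * (`|u| * `|v|).
  by have [C C0 CP] := weighted_bound (grad_ae_bounded ij Ww); exists C.
exists (\sum_(i < 3) \sum_(j < 3) C (j, i)) => [|u v].
  by apply: sumr_ge0 => i _; apply: sumr_ge0 => j _; have [] := CP (j, i).
rewrite mulr_suml (le_trans (ler_norm_sum _ _ _))//; apply: ler_sum => i _.
rewrite mulr_suml (le_trans (ler_norm_sum _ _ _))//; apply: ler_sum => j _.
exact: (CP (j, i)).2.
Qed.

Lemma convection_lin (w w' : vfield) a u v : W w -> W w' ->
  convection (a *: w + w') u v = a * convection w u v + convection w' u v.
Proof.
move=> Ww Ww'; rewrite /convection mulr_sumr -big_split; apply: eq_bigr => i _ /=.
rewrite mulr_sumr -big_split; apply: eq_bigr => j _ /=.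
have bw := grad_ae_bounded (j, i) Ww; have bw' := grad_ae_bounded (j, i) Ww'.
have iw := weighted_integrable u v i j bw; have iw' := weighted_integrable u v i j bw'.
have iaw : vol.-integrable setT (EFin \o (fun x => a * (u i x * (grad w (j, i) x * v j x)))).
  have := integrableZl measurableT a iw.
  by apply: eq_integrable => // x _.
rewrite /weighted -RintegralZl// -RintegralD//; congr fine.
have mu' k (s : vfield) : measurable_fun setT (s k) by exact: L2fun_measurable.
have ib := weighted_integrable u v i j (grad_ae_bounded (j, i) (W_lin a Ww Ww')).
apply: ae_eq_integral => //; first exact: measurable_int ib.
  exact: measurable_int (integrableD measurableT iaw iw').
rewrite grad_lin; [|exact: W_H1|exact: W_H1].
have := L2fun_lin a (grad w) (grad w') (j, i).
by apply: filterS => x /= -> _; congr EFin; ring.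
Qed.

(** The difference of the quadratic form at [u] and [v] splits as c(u - v, u) + c(v, u - v), which
    needs no symmetry of c. *)
Lemma convection_continuous (w : vfield) : W w -> continuous (fun u => convection w u u).
Proof.
move=> Ww u A /nbhs_ballP[e /= e0 eA]; have [C C0 CP] := convection_bound Ww.
(* For [v] within 1 of [u], the two norms add up to at most twice that of [u] plus 1; the last 1
   makes [D] positive. *)
pose D := C * (2 * `|u| + 1) + 1.
have D0 : 0 < D by rewrite ltr_wpDl// mulr_ge0// addr_ge0// mulr_ge0.
apply/nbhs_ballP; exists (Num.min 1 (e / D)) => /= [|v].
  by rewrite lt_min ltr01 divr_gt0.
rewrite -ball_normE/= lt_min => /andP[/ltW uv1 uvD].
apply: eA; rewrite -ball_normE/=.
have -> : convection w u u - convection w v v = convection w (u - v) u + convection w v (u - v).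
  have h1 : convection w (u - v) u = convection w u u - convection w v u.
    by rewrite addrC -scaleN1r convection_linl// mulN1r addrC.
  have h2 : convection w v (u - v) = convection w v u - convection w v v.
    by rewrite addrC -scaleN1r convection_linr// mulN1r addrC.
  by rewrite h1 h2 addrA subrK.
apply: (le_lt_trans (ler_normD _ _)).
apply: (le_lt_trans (lerD (CP _ _) (CP _ _))).
have vu : `|v| <= `|u| + 1.
  have -> : v = u - (u - v) by rewrite opprB addrC subrK.
  by apply: (le_trans (ler_normB _ _)); rewrite lerD2l.
apply: (@le_lt_trans _ _ (D * `|u - v|)).
  rewrite /D; have := normr_ge0 u; have := normr_ge0 (u - v); move: vu.
  rewrite -subr_ge0; move: (`|u - v|) (`|u|) (`|v|) => s t r rt s0 t0.
  have h : 0 <= t + 1 - r by rewrite subr_ge0.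
  by have := mulr_ge0 (mulr_ge0 C0 s0) h; nra.
by rewrite -ltr_pdivlMl// mulrC.
Qed.

End Trilinear.

Lemma lipschitz_bound_continuous (R : realType) (V V' : normedModType R)
    (F : V -> V') C : (forall u v, `|F u - F v| <= C * `|u - v|) -> continuous F.
Proof.
move=> FC u A /nbhs_ballP[e /= e0 eA].
have D0 : 0 < `|C| + 1 by rewrite ltr_wpDl.
apply/nbhs_ballP; exists (e / (`|C| + 1)) => /= [|v]; first by rewrite divr_gt0.
rewrite -ball_normE /= => uv; apply: eA; rewrite -ball_normE/=.
apply: (le_lt_trans (FC u v)); rewrite ltr_pdivlMr// mulrC in uv.
apply: le_lt_trans uv; rewrite ler_wpM2r//.
by rewrite (le_trans (ler_norm _))// lerDl.
Qed.

Lemma sum_split_ord (R : realType) m n (F : 'I_(m + n) -> R) (G : 'I_m -> R) (H : 'I_n -> R) :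
  (forall j, F (lshift n j) = G j) -> (forall j, F (rshift m j) = H j) ->
  \sum_(k < m + n) F k = \sum_(k < m) G k + \sum_(k < n) H k.
Proof. by move=> FG FH; rewrite big_split_ord; congr (_ + _); apply: eq_bigr. Qed.

Section NavierStokes.
Context (R : realType) (Om : smooth_domain R) (nu : R) (f : Vdual Om).
Local Notation vfield := (L2 (vol Om) 'I_3).

Lemma Hval_continuous : continuous (@Hval R Om).
Proof. exact: initial_continuous. Qed.

Lemma Hspace_hausdorff : hausdorff_space (Hspace Om).
Proof.
move=> x y xy; apply/val_inj; apply: norm_hausdorff => A B /Hval_continuous xA /Hval_continuous yB.
by have [z [zA zB]] := xy _ _ xA yB; exists (Hval z).
Qed.

Lemma ip_continuous (h : vfield) : continuous (fun u => ip u h).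
Proof.
apply: (@lipschitz_bound_continuous _ _ _ _ `|h|) => u v.
have -> : ip u h - ip v h = ip (u - v) h by rewrite ipDl -(scaleN1r v) ipZl mulN1r.
by rewrite (le_trans (ip_le_norm _ _))// mulrC.
Qed.

Lemma NSFE (u : Hspace Om) (w : vfield) : W w ->
  NSF nu f u w = f w + - nu * ip u (stokes w) + convection w u u.
Proof. by move=> Ww; rewrite /NSF convectionE// mulNr. Qed.

Lemma NSF_lin (u : Hspace Om) a (w w' : vfield) : W w -> W w' ->
  NSF nu f u (a *: w + w') = a * NSF nu f u w + NSF nu f u w'.
Proof.
have alg (x x' y y' z z' : R) : a * x + x' + - nu * (a * y + y') + (a * z + z') =
    a * (x + - nu * y + z) + (x' + - nu * y' + z') by ring.
move=> Ww Ww'; have Waw := W_lin a Ww Ww'.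
rewrite (NSFE _ Ww) (NSFE _ Ww') (NSFE _ Waw).
rewrite (dual_linear f _ (W_V Ww) (W_V Ww')).
rewrite (stokes_lin a (W_DA Ww) (W_DA Ww')) (convection_lin a u u Ww Ww') ipDr ipZr.
exact: alg.
Qed.

Lemma NSF0 (u : Hspace Om) : NSF nu f u 0 = 0.
Proof.
have := NSF_lin u (-1) (W0 Om) (W0 Om).
by rewrite scaler0 addr0 mulN1r addNr.
Qed.

Lemma W_NSF_sum (u : Hspace Om) (I : Type) (r : seq I) (a : I -> R) (w : I -> vfield) :
  (forall i, W (w i)) -> W (\sum_(i <- r) a i *: w i) /\
  NSF nu f u (\sum_(i <- r) a i *: w i) = \sum_(i <- r) a i * NSF nu f u (w i).
Proof.
move=> Ww; elim: r => [|i r [Wr ih]]; first by rewrite !big_nil NSF0; split=> //; exact: W0.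
by rewrite !big_cons NSF_lin// ih; split=> //; exact: W_lin.
Qed.

(** All derivatives fall on [w]: for fixed [w] the terms are a constant, a bounded linear form and a
    bounded quadratic form in [u]. *)
Lemma NSF_continuous (w : vfield) : W w -> continuous (fun u : Hspace Om => NSF nu f u w).
Proof.
move=> Ww; rewrite (funext (fun u => NSFE u Ww)).
have c1 : continuous (fun u : Hspace Om => ip u (stokes w)).
  move=> u; apply: (@continuous_comp _ _ _ (@Hval R Om) (fun v => ip v (stokes w))).
    exact: Hval_continuous.
  exact: ip_continuous.
have c2 : continuous (fun u : Hspace Om => convection w u u).
  move=> u; apply: (@continuous_comp _ _ _ (@Hval R Om) (fun v => convection w v v)).
    exact: Hval_continuous.
  exact: convection_continuous.
apply: continuous_addR; last exact: c2.
apply: (@continuous_addR _ _ (fun=> f w) (fun u : Hspace Om => - nu * ip u (stokes w))).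
  exact: cst_continuous.
by apply: (@continuous_mulR _ _ (fun=> - nu)) => //; exact: cst_continuous.
Qed.

Lemma NSF_derivE (Psi : cylindrical Om) (u : Hspace Om) : NSF_deriv nu f Psi u =
  \sum_(j < cyl_dim Psi) 'D_(delta_mx 0 j) (@cyl_psi _ _ Psi) (cyl_coord Psi (Wdual_of_H u))
    * NSF nu f u (cyl_vec j).
Proof. by rewrite /NSF_deriv /cyl_deriv (W_NSF_sum _ _ _ (@cyl_vecW _ _ Psi)).2. Qed.

(** This is [cyl_coord] on elements of H, for a free family [w], so that two families can be
    concatenated. *)
Definition coordinates m (w : 'I_m -> vfield) (u : vfield) : 'rV[R]_m := \row_j ip u (w j).

Lemma coordinates_bound m (w : 'I_m -> vfield) u :
  `|coordinates w u| <= (\sum_j `|w j|) * `|u|.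
Proof.
rewrite [leLHS]/Num.norm /= mx_normrE; apply/bigmax_leP; split => /=.
  by rewrite mulr_ge0// sumr_ge0.
move=> [i j] _ /=; rewrite mxE (le_trans (ip_le_norm _ _))// mulrC ler_wpM2r ?sqrtr_ge0//.
by rewrite (bigD1 j)//= lerDl sumr_ge0.
Qed.

Lemma coordinates_continuous m (w : 'I_m -> vfield) : continuous (coordinates w).
Proof.
apply: (@lipschitz_bound_continuous _ _ _ _ (\sum_j `|w j|)) => u v.
have -> : coordinates w u - coordinates w v = coordinates w (u - v).
  by apply/rowP => j; rewrite !mxE ipDl -(scaleN1r v) ipZl mulN1r.
exact: coordinates_bound.
Qed.

Lemma continuous_sumR (T : topologicalType) (I : Type) (r : seq I) (F : I -> T -> R) :
  (forall i, continuous (F i)) -> continuous (fun x => \sum_(i <- r) F i x).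
Proof.
move=> cF; elim: r => [|i r ih].
  rewrite (_ : (fun x => _) = fun=> 0); first exact: cst_continuous.
  by apply/funext => x; rewrite big_nil.
rewrite (_ : (fun x => _) = fun x => F i x + \sum_(j <- r) F j x).
  exact: continuous_addR.
by apply/funext => x; rewrite big_cons.
Qed.

Lemma NSF_deriv_continuous (Psi : cylindrical Om) : continuous (NSF_deriv nu f Psi).
Proof.
have -> : NSF_deriv nu f Psi = (fun u => \sum_(j < cyl_dim Psi)
    'D_(delta_mx 0 j) (@cyl_psi _ _ Psi) (cyl_coord Psi (Wdual_of_H u)) * NSF nu f u (cyl_vec j)).
  by apply/funext => u; exact: NSF_derivE.
apply: continuous_sumR => j; apply: continuous_mulR; last exact/NSF_continuous/cyl_vecW.
have [_ cD _] := cyl_psiC1c Psi.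
move=> u; apply: (@continuous_comp _ _ _ (fun u : Hspace Om => coordinates (@cyl_vec _ _ Psi) u)
   (fun x => 'D_(delta_mx 0 j) (@cyl_psi _ _ Psi) x)); last exact: cD.
apply: (@continuous_comp _ _ _ (@Hval R Om)); first exact: Hval_continuous.
exact: coordinates_continuous.
Qed.

Lemma cylindrical0 : inhabited (cylindrical Om).
Proof.
have C0 : C1c (fun _ : 'rV[R]_0 => 0 : R).
  have [h1 h2] := @C1_cst R 0 0; split=> //.
  by apply: (@bounded_compact_supp _ _ _ 0) => x; rewrite eqxx.
by constructor; apply: (@Cylindrical R Om 0 (fun=> 0) (fun=> 0)) => // j; exact: W0.
Qed.

Lemma cylindrical_scale a (Psi : cylindrical Om) :
  exists Psi' : cylindrical Om, forall u, NSF_deriv nu f Psi' u = a * NSF_deriv nu f Psi u.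
Proof.
have [C1a Da] := C1c_scale a (cyl_psiC1c Psi).
exists (Cylindrical (@cyl_vecW _ _ Psi) C1a) => u.
rewrite !NSF_derivE mulr_sumr; apply: eq_bigr => j _ /=.
by rewrite Da mulrA.
Qed.

Lemma cylindrical_add (K : set (Hspace Om)) (Psi Psi' : cylindrical Om) : compact K ->
  exists Phi : cylindrical Om, forall u, K u ->
    NSF_deriv nu f Phi u = NSF_deriv nu f Psi u + NSF_deriv nu f Psi' u.
Proof.
move=> cK.
have [B KB] : exists B, forall u, K u -> `|Hval u| <= B.
  have : {within K, continuous (fun u : Hspace Om => `|Hval u|)}.
    apply: continuous_subspaceT => u; apply: (@continuous_comp _ _ _ (@Hval R Om)).
      exact: Hval_continuous.
    exact: norm_continuous.
  move=> /(continuous_bounded_on cK)[B KB]; exists B => u /KB.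
  by rewrite normr_id.
pose w := @cyl_vec _ _ Psi; pose w' := @cyl_vec _ _ Psi'.
(* Each summand bounds one block of coordinates over [K]; the sum of these nonnegative numbers
   bounds both. *)
pose B' := (\sum_j `|w j|) * B + (\sum_j `|w' j|) * B.
have [h hC hD] := C1c_glue B' (cyl_psiC1c Psi) (cyl_psiC1c Psi').
pose v (k : 'I_(cyl_dim Psi + cyl_dim Psi')) : vfield :=
  match fintype.split k with inl i => w i | inr j => w' j end.
have Wv k : W (v k) by rewrite /v; case: fintype.split => j; exact: cyl_vecW.
exists (Cylindrical Wv hC) => u Ku.
have cl : lsubmx (coordinates v u) = coordinates w u.
  by apply/rowP => j; rewrite !mxE /v (unsplitK (inl _ j)).
have cr : rsubmx (coordinates v u) = coordinates w' u.
  by apply/rowP => j; rewrite !mxE /v (unsplitK (inr _ j)).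
have B0 : 0 <= B by apply: le_trans (normr_ge0 (Hval u)) (KB _ Ku).
have [|| hl hr] := hD (coordinates v u).
- rewrite cl (le_trans (coordinates_bound _ _))// (le_trans (ler_wpM2l _ (KB _ Ku))) ?sumr_ge0//.
  by rewrite lerDl mulr_ge0// sumr_ge0.
- rewrite cr (le_trans (coordinates_bound _ _))// (le_trans (ler_wpM2l _ (KB _ Ku))) ?sumr_ge0//.
  by rewrite lerDr mulr_ge0// sumr_ge0.
have -> : NSF_deriv nu f (Cylindrical Wv hC) u = \sum_(k < cyl_dim Psi + cyl_dim Psi')
    'D_(delta_mx 0 k) h (coordinates v u) * NSF nu f u (v k) by exact: NSF_derivE.
have -> : NSF_deriv nu f Psi u = \sum_(k < cyl_dim Psi)
    'D_(delta_mx 0 k) (@cyl_psi _ _ Psi) (coordinates w u) * NSF nu f u (w k).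
  exact: NSF_derivE.
have -> : NSF_deriv nu f Psi' u = \sum_(k < cyl_dim Psi')
    'D_(delta_mx 0 k) (@cyl_psi _ _ Psi') (coordinates w' u) * NSF nu f u (w' k).
  exact: NSF_derivE.
have vl j : v (lshift _ j) = w j by rewrite /v (unsplitK (inl _ j)).
have vr j : v (rshift _ j) = w' j by rewrite /v (unsplitK (inr _ j)).
apply: sum_split_ord => j.
  by rewrite hl cl vl.
by rewrite hr cr vr.
Qed.

End NavierStokes.

(** * Statistical solutions *)

Section Statistical.
Context (R : realType) (Om : smooth_domain R) (nu : R) (f : Vdual Om).
Variables (K : set (Hspace Om)) (cK : compact K).

Let closedK : closed K.
Proof. by apply: compact_closed => //; exact: Hspace_hausdorff. Qed.

Let mK : measurable (K : set (borelH Om)).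
Proof.
by rewrite -[K]setCK; apply: measurableC; apply: sub_sigma_algebra; exact: closed_openC.
Qed.

Section Carried.
Variable mu : probability (borelH Om) R.
Hypothesis muK : mu (~` K) = 0%E.

Lemma carried_mass : fine (mu K) = 1.
Proof.
have := probability_setC mu mK; rewrite muK => /eqP.
by rewrite eq_sym sube_eq// ?fin_num_measure// add0e => /eqP <-.
Qed.

Let continuous_measurable (g : Hspace Om -> R) : continuous g ->
  measurable_fun (setT : set (borelH Om)) g.
Proof.
move=> /continuousP cg.
apply: (measurability _ (RGenOInfty.measurableE R)) => //= _ [_ [a ->] <-].
rewrite setTI preimage_itvoy; apply: sub_sigma_algebra.
exact: (cg _ (@open_gt R a)).
Qed.

(** A continuous function may be unbounded on H, but it is bounded on [K] and the complement of [K]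
    is null. *)
Lemma carried_integrable (g : Hspace Om -> R) : continuous g ->
  mu.-integrable (setT : set (borelH Om)) (EFin \o g).
Proof.
move=> cg; have mCK : measurable (~` K : set (borelH Om)) by exact: measurableC.
apply/(@negligible_integrable _ _ _ mu setT (~` K : set (borelH Om))) => //.
  by apply/measurable_EFinP; exact: continuous_measurable.
rewrite setTD setCK; apply: within_continuous_integrable => //.
exact: continuous_subspaceT.
Qed.

Lemma carried_integral (g : Hspace Om -> R) : continuous g ->
  \int[mu]_(u in (setT : set (borelH Om))) g u = \int[mu]_(u in (K : set (borelH Om))) g u.
Proof.
move=> cg; have mCK : measurable (~` K : set (borelH Om)) by exact: measurableC.
rewrite /Rintegral (@negligible_integral _ _ _ mu setT (~` K : set (borelH Om)))//.
  by rewrite setTD setCK.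
exact: carried_integrable.
Qed.

End Carried.

Lemma wsss_integral0 mu (Psi : cylindrical Om) : wsss_on nu f K mu ->
  \int[mu]_(u in (K : set (borelH Om))) NSF_deriv nu f Psi u = 0.
Proof.
move=> [/(_ Psi)[_ h] muK]; rewrite -[RHS]h carried_integral//.
exact: NSF_deriv_continuous.
Qed.

(** Serves twice: with [g] equal to [phi] for the easy inequality, and with [g] zero for the
    hypothesis that keeps the infima finite. *)
Lemma wsss_integral_le mu (Psi : cylindrical Om) (g : Hspace Om -> R) c :
  wsss_on nu f K mu -> {within K, continuous g} ->
  (forall u, K u -> g u + NSF_deriv nu f Psi u <= c) ->
  \int[mu]_(u in (K : set (borelH Om))) g u <= c.
Proof.
move=> hmu cg gc; have [_ muK] := hmu.
have cN : {within K, continuous (NSF_deriv nu f Psi)}.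
  by apply: continuous_subspaceT; exact: NSF_deriv_continuous.
rewrite -[leLHS]addr0 -(wsss_integral0 Psi hmu) -RintegralD//;
  try exact: within_continuous_integrable.
rewrite -[leRHS]mulr1 -(carried_mass muK) -Rintegral_cst//.
apply: le_Rintegral => //.
  by apply: within_continuous_integrable => //; exact: within_continuousD.
by apply: within_continuous_integrable => //; exact: within_continuous_cst.
Qed.

End Statistical.

Theorem theorem6p2 (R : realType) (Om : smooth_domain R) (nu : R)
    (f : Vdual Om) (K : set (Hspace Om)) (phi : Hspace Om -> R) :
  0 < nu ->
  compact K ->
  wsss_on nu f K !=set0 ->
  {within K, continuous phi} ->
  exists M : R,
    is_max [set \int[mu]_(u in (K : set (borelH Om))) phi u
           | mu in wsss_on nu f K] M /\
    exists m : cylindrical Om -> R,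
      (forall Psi : cylindrical Om,
         is_max [set phi u + NSF_deriv nu f Psi u | u in K] (m Psi)) /\
      has_inf (range m) /\ inf (range m) = M.
Proof.
move=> _ cK [mu0 hmu0] cphi.
have closedK : closed K by apply: compact_closed => //; exact: Hspace_hausdorff.
(* The empty set cannot carry mass one; maxima over [K] need a point. *)
have K0 : K !=set0.
  apply/set0P/eqP => K0; have := carried_mass cK hmu0.2.
  by rewrite K0 measure0 /= => /eqP; rewrite eq_sym oner_eq0.
have [Psi0] := cylindrical0 Om.
have cN (Psi : cylindrical Om) : {within K, continuous (NSF_deriv nu f Psi)}.
  by apply: continuous_subspaceT; exact: NSF_deriv_continuous.
pose L := [set NSF_deriv nu f Psi | Psi in [set: cylindrical Om]].
have [P [PK PL Pphi]] : exists P : probability (borelH Om) R,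
  [/\ P (~` K) = 0%E,
      forall l, L l -> \int[P]_(x in (K : set (borelH Om))) l x = 0 &
      \int[P]_(x in (K : set (borelH Om))) phi x = inf (perturbed_bounds K L phi)].
  apply: minimax_measure => //.
  - by move=> _ [Psi _ <-]; exact: cN.
  - by exists (NSF_deriv nu f Psi0); exists Psi0.
  - move=> _ _ [Psi _ <-] [Psi' _ <-].
    have [Phi PhiE] := cylindrical_add nu f Psi Psi' cK.
    by exists (NSF_deriv nu f Phi) => //; exists Phi.
  - move=> a _ [Psi _ <-]; have [Phi PhiE] := cylindrical_scale nu f a Psi.
    by exists (NSF_deriv nu f Phi) => //; exists Phi.
  - move=> _ c [Psi _ <-] lc.
    have -> : 0 = \int[mu0]_(u in (K : set (borelH Om))) (0 : R).
      by rewrite /Rintegral integral0.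
    apply: (wsss_integral_le cK hmu0 (Psi := Psi)) => [|u Ku]; first exact: within_continuous_cst.
    by rewrite add0r lc.
(* [PL] concerns integrals over [K]; continuity of [NSF_deriv] gives integrability and transfers the
   equality to all of H. *)
have hP : wsss_on nu f K P.
  split=> // Psi; have cPsi := @NSF_deriv_continuous _ _ nu f Psi.
  split; first exact: (carried_integrable cK PK cPsi).
  by rewrite (carried_integral cK PK cPsi) PL//; exists Psi.
have /choice[m mP] (Psi : cylindrical Om) : exists m,
    is_max [set phi u + NSF_deriv nu f Psi u | u in K] m.
  have [c Kc cmax] := compact_EVT_max K0 cK (within_continuousD cphi (cN Psi)).
  exists (phi c + NSF_deriv nu f Psi c); split; first by exists c => //; exact: set_mem.
  by move=> _ [u Ku <-]; apply: cmax; exact: mem_set.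
have m_bound Psi : perturbed_bounds K L phi (m Psi).
  exists (NSF_deriv nu f Psi); first by exists Psi.
  by move=> u Ku; apply: (mP Psi).2; exists u.
have le_bound mu c : wsss_on nu f K mu -> perturbed_bounds K L phi c ->
    \int[mu]_(u in (K : set (borelH Om))) phi u <= c.
  by move=> hmu [_ [Psi _ <-] h]; exact: (wsss_integral_le cK hmu cphi h).
have inf_m : has_inf (range m).
  split; first by exists (m Psi0); exists Psi0.
  by exists (\int[mu0]_(u in (K : set (borelH Om))) phi u) => _ [Psi _ <-]; exact: le_bound.
exists (inf (perturbed_bounds K L phi)); split.
  split; first by exists P.
  move=> _ [mu hmu <-]; apply: lb_le_inf; first by exists (m Psi0).
  by move=> c; exact: le_bound.
(* Each [m Psi] is an admissible bound and, being attained, lies below every other bound for the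
   same [Psi]; the two infima therefore agree. *)
exists m; split=> //; split=> //; apply/le_anti/andP; split.
  apply: lb_le_inf; first by exists (m Psi0).
  move=> c [_ [Psi _ <-] h].
  apply: (@le_trans _ _ (m Psi)); first by apply: ge_inf; [exact: inf_m.2|exists Psi].
  by have [[u Ku <-] _] := mP Psi; exact: h.
apply: lb_le_inf; first exact: inf_m.1.
move=> _ [Psi _ <-]; apply: ge_inf => //.
by exists (\int[mu0]_(u in (K : set (borelH Om))) phi u) => c; exact: le_bound.
Qed.
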